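(* Let $\Delta(x,\hat x)=(x-\hat x)^2$, let the perception measure be $\phi(p_X,p_{\hat X})=\phi_{KL}(p_{\hat X}\|p_X)$, let $\mu_X\in\mathbb R$, $\sigma_X>0$, $R,R_c\ge0$ and $P\ge0$. Then $$\underline D(R,R_c,P|\mathcal N(\mu_X,\sigma_X^2))\le D(R,R_c,P|\mathcal N(\mu_X,\sigma_X^2))\le \overline D(R,R_c,P|\mathcal N(\mu_X,\sigma_X^2)),$$ where $$\overline D(R,R_c,P|\mathcal N(\mu_X,\sigma_X^2)):=\begin{cases}\sigma_X^2-\sigma_X^2\xi^2(R,R_c)&\text{if }\sigma(P)\le\sigma_X\xi(R,R_c),\\ \sigma_X^2+\sigma^2(P)-2\sigma_X\sigma(P)\xi(R,R_c)&\text{if }\sigma(P)>\sigma_X\xi(R,R_c),\end{cases}$$ $$\underline D(R,R_c,P|\mathcal N(\mu_X,\sigma_X^2)):=\min_{\sigma_{\hat X}\in[\sigma(P),\sigma_X]}\Big(\sigma_X^2+\sigma_{\hat X}^2-2\sigma_X\sigma_{\hat X}\sqrt{(1-e^{-2R})(1-e^{-2(R+R_c+P-\psi(\sigma_{\hat X}))})}\Big).$$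
   Context: All logarithms are natural. $\xi(R,R_c):=\sqrt{(1-e^{-2R})(1-e^{-2(R+R_c)})}$. For $\sigma\in(0,\sigma_X]$, $\psi(\sigma):=\log\frac{\sigma_X}{\sigma}+\frac{\sigma^2-\sigma_X^2}{2\sigma_X^2}$; $\psi$ is strictly decreasing on $(0,\sigma_X]$ with $\psi(\sigma)\to\infty$ as $\sigma\to0$ and $\psi(\sigma_X)=0$, and $\sigma(P)$ denotes the unique $\sigma\in(0,\sigma_X]$ with $\psi(\sigma)=P$. Kullback–Leibler divergence: $\phi_{KL}(q\|p):=\mathbb E_{Z\sim q}\big[\log\frac{q(Z)}{p(Z)}\big]$ for densities $q\ll p$, and $+\infty$ if $q$ is not absolutely continuous with respect to $p$. Rate-distortion-perception function $D(R,R_c,P|p_X)$: for a block length $n\ge1$, a code consists of finite sets $\mathcal J,\mathcal K$, a random seed $K$ uniform on $\mathcal K$ and independent of the source sequence $X^n=(X_1,\dots,X_n)$ (i.i.d. with marginal $p_X$), a stochastic encoder $p_{J|X^nK}$ producing $J\in\mathcal J$, and a stochastic decoder $p_{\hat X^n|JK}$ producing $\hat X^n\in\mathbb R^n$. A level $D$ is achievable subject to rate constraints $(R,R_c)$ and perception constraint $P$ if for some $n$ there is such a code with $\frac1n\log|\mathcal J|\le R$, $\frac1n\log|\mathcal K|\le R_c$, $\frac1n\sum_{t=1}^n\mathbb E[\Delta(X_t,\hat X_t)]\le D$, $\frac1n\sum_{t=1}^n\phi(p_{X_t},p_{\hat X_t})\le P$, and $\hat X_1,\dots,\hat X_n$ i.i.d.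 (with some marginal). $D(R,R_c,P|p_X)$ is the infimum of achievable $D$. *)

(* Defs.v *)
From HB Require Import structures.
From mathcomp Require Import all_boot all_order all_algebra.
From mathcomp Require Import all_classical all_reals all_analysis.
Set Implicit Arguments.
Unset Strict Implicit.
Unset Printing Implicit Defensive.
Import Order.TTheory GRing.Theory Num.Def Num.Theory.

Local Open Scope classical_set_scope.
Local Open Scope ring_scope.

Section RDP.
Context {R : realType}.

Definition xi (Rr Rc : R) : R :=
  Num.sqrt ((1 - expR (- (2 * Rr))) * (1 - expR (- (2 * (Rr + Rc))))).

Definition psi (sX s : R) : R :=
  ln (sX / s) + (s ^+ 2 - sX ^+ 2) / (2 * sX ^+ 2).

(* sigma(P): the unique sigma in (0, sigma_X] with psi(sigma) = P *)
Definition sigmaP (sX P : R) : R :=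
  xget 0 [set s | 0 < s <= sX /\ psi sX s = P].

Definition Dupper (sX Rr Rc P : R) : R :=
  if sigmaP sX P <= sX * xi Rr Rc then sX ^+ 2 - sX ^+ 2 * (xi Rr Rc) ^+ 2
  else sX ^+ 2 + (sigmaP sX P) ^+ 2 - 2 * sX * sigmaP sX P * xi Rr Rc.

Definition Dlower_obj (sX Rr Rc P s : R) : R :=
  sX ^+ 2 + s ^+ 2 - 2 * sX * s *
    Num.sqrt ((1 - expR (- (2 * Rr))) *
              (1 - expR (- (2 * (Rr + Rc + P - psi sX s))))).

(* lower bound \underline D: min over sigma_hat in [sigma(P), sigma_X]
   (written as an infimum; the objective is continuous on a compact interval) *)
Definition Dlower (sX Rr Rc P : R) : \bar R :=
  ereal_inf [set (Dlower_obj sX Rr Rc P s)%:E | s in `[sigmaP sX P, sX]%classic].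

Definition is_density (q : set (measurableTypeR R) -> \bar R) (p : {measure set (measurableTypeR R) -> \bar R})
  (f : R -> R) : Prop :=
  [/\ measurable_fun setT f, (forall x, 0 <= f x) &
      forall A, measurable A -> q A = (\int[p]_(x in A) (f x)%:E)%E].

(* Kullback-Leibler divergence phi_KL(q || p) = E_q[log dq/dp] = int (dq/dp) log (dq/dp) dp
   if q << p (i.e. q has a density w.r.t. p), +oo otherwise *)
Definition KL (q : set (measurableTypeR R) -> \bar R) (p : {measure set (measurableTypeR R) -> \bar R}) : \bar R :=
  if pselect (exists f, is_density q p f) is left _ then
    let g := xget (fun _ => 0) [set f | is_density q p f] in
    (\int[p]_x (g x * ln (g x))%:E)%E
  else +oo%E.

Definition law d (T : measurableType d) (Pr : probability T R) (Y : T -> R) :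
  set R -> \bar R := fun B => Pr (Y @^-1` B).

(* Achievability of distortion level D for the source N(mu, sX^2),
   squared error distortion and KL perception measure phi_KL(p_Xhat_t || p_X).
   A code of block length n, with message set 'I_a (|J| = a) and seed set
   'I_b (|K| = b), is represented by the joint law of (X^n, K, J, Xhat^n) on
   a probability space:
   - X_1..X_n i.i.d. N(mu, sX^2);
   - K uniform on 'I_b and independent of X^n;
   - J arbitrary (finite-valued) : any joint law of (X^n,K,J) is realised by
     a stochastic encoder p_{J|X^n K};
   - Xhat^n conditionally independent of X^n given (J,K) (Markov chain
     X^n - (J,K) - Xhat^n), i.e. Xhat^n is produced by a stochastic decoder
     p_{Xhat^n | J K};
   - Xhat_1..Xhat_n i.i.d. *)
Definition achievable (mu sX Rr Rc P D : R) : Prop :=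
  exists (n a b : nat) (d : measure_display) (T : measurableType d)
    (Pr : probability T R) (X Xh : 'I_n -> T -> R) (J : T -> 'I_a) (K : T -> 'I_b),
  [/\ (0 < n)%N, (0 < b)%N,
      ln a%:R / n%:R <= Rr & ln b%:R / n%:R <= Rc] /\
  [/\ forall t, measurable_fun setT (X t),
      forall t, measurable_fun setT (Xh t),
      forall j, measurable (J @^-1` [set j]) &
      forall k, measurable (K @^-1` [set k])] /\
  (forall A : 'I_n -> set R, (forall t, measurable (A t)) ->
     Pr [set w | forall t, A t (X t w)] = (\prod_(t < n) normal_prob mu sX (A t))%E) /\
  (forall (k : 'I_b) (A : 'I_n -> set R), (forall t, measurable (A t)) ->
     Pr ([set w | K w = k] `&` [set w | forall t, A t (X t w)]) =
     ((b%:R)^-1%:E * Pr [set w | forall t, A t (X t w)])%E) /\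
  (forall (j : 'I_a) (k : 'I_b) (A B : 'I_n -> set R),
     (forall t, measurable (A t)) -> (forall t, measurable (B t)) ->
     (Pr ([set w | forall t, A t (X t w)] `&` [set w | J w = j /\ K w = k]
          `&` [set w | forall t, B t (Xh t w)]) *
      Pr [set w | J w = j /\ K w = k])%E =
     (Pr ([set w | forall t, A t (X t w)] `&` [set w | J w = j /\ K w = k]) *
      Pr ([set w | J w = j /\ K w = k] `&` [set w | forall t, B t (Xh t w)]))%E) /\
  (forall B : 'I_n -> set R, (forall t, measurable (B t)) ->
     Pr [set w | forall t, B t (Xh t w)] = (\prod_(t < n) Pr (Xh t @^-1` B t))%E) /\
  (forall (t t' : 'I_n) (B : set R), measurable B ->
     Pr (Xh t @^-1` B) = Pr (Xh t' @^-1` B)) /\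
  ((n%:R)^-1%:E * \sum_(t < n) \int[Pr]_w ((X t w - Xh t w) ^+ 2)%:E <= D%:E)%E /\
  ((n%:R)^-1%:E * \sum_(t < n) KL (law Pr (Xh t)) (normal_prob mu sX) <= P%:E)%E.

Definition RDP (mu sX Rr Rc P : R) : \bar R :=
  ereal_inf [set D%:E | D in achievable mu sX Rr Rc P].

End RDP.

(* Main.v *)
Require Import Defs.
From HB Require Import structures.
From mathcomp Require Import all_boot all_order all_algebra.
From mathcomp Require Import all_classical all_reals all_analysis.
From mathcomp Require Import measurable_realfun ring lra.
Set Implicit Arguments.
Unset Strict Implicit.
Unset Printing Implicit Defensive.
Import Order.TTheory GRing.Theory Num.Def Num.Theory.
Import numFieldNormedType.Exports HBNNSimple.
Local Open Scope classical_set_scope.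
Local Open Scope ring_scope.

(* Lower bound.  Fix a code and a cell {J = j, K = k}.  Conditioning on a cell multiplies the
   probabilities of events of X^n by at most |J|, those of events of Xhat^n by at most |J||K|, and
   the law of Xhat has relative entropy at most P with respect to that of X.  Applying Jensen's
   inequality to a logarithmic ratio of Gaussian densities on each cell bounds from below the mean
   conditional variances of X and Xhat, without any entropy.  Given the cell X and Xhat are
   independent, so Cauchy-Schwarz applied to the conditional means bounds the correlation of X and
   Xhat by the square root in the objective of Dlower.

   Upper bound.  After rescaling it is enough to produce standard normal sequences X^n, Y^n whose
   mean correlation is close to rho1 rho2, where rho1^2 < 1 - exp (-2R) and
   rho2^2 < 1 - exp (-2(R + Rc)).  Draw a random codebook of Gaussian codewords u_jk.  By soft
   covering, for fixed k the channel of correlation rho1 applied to a uniform u_jk outputs nearly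
   the law of X^n, and the channel of correlation rho2 applied to a uniform u_jk (j and k both
   varying) outputs nearly the law of Y^n.  Likelihood encoders for both channels, corrected so
   that the messages are exactly uniform, then give laws of (X^n, J, K) and (J, K, Y^n) with the
   required marginals, which are glued along (J, K).  The reconstruction is exactly i.i.d. Gaussian
   with standard deviation max(sigma(P), sX xi), and the correlation is the mean of
   E[X^n | j, k] . E[Y^n | j, k] / n, close to rho1 rho2 |u_jk|^2 / n. *)

(** * Densities and product rules *)

(** The seed K is independent of X^n but not of Xhat^n. An event of X^n can therefore be intersected
    with {K = k} at the exact price 1/|K|, and summing over the cells leaves |J|; for Xhat^n the
    cell is simply enlarged to the whole space, and the sum is |J||K|. The Gaussian densities
    compared by Jensen's inequality carry a free standard deviation t; setting t^2 equal to the mean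
    conditional variance at the very end reproduces the bound that entropy powers would give. In the
    upper bound the marginals have to be exact: Xhat^n must be i.i.d., K uniform and independent of
    X^n, and two laws can be glued along (J, K) only if they give (J, K) the same law. This forces
    the correction of the likelihood encoders. Closeness in total variation says nothing about means
    of the unbounded X^n, so the covering error is weighted by |x|^2 / n. If R = 0 no rho1 satisfies
    the strict inequality, and a code with independent X^n and Xhat^n takes over. *)

Section density_measure.
Context d (T : measurableType d) (R : realType).
Variables (m : {measure set T -> \bar R}) (w : T -> R).
Hypotheses (mw : measurable_fun setT w) (w0 : forall x, 0 <= w x).
Local Open Scope ereal_scope.

Definition density_measure (mw : measurable_fun setT w)
  (w0 : forall x, (0 <= w x)%R) (A : set T) : \bar R := \int[m]_(x in A) (w x)%:E.

Local Notation dens := (density_measure mw w0).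

Let dens0 : dens set0 = 0.
Proof. by rewrite /density_measure integral_set0. Qed.

Let dens_ge0 A : 0 <= dens A.
Proof. by apply: integral_ge0 => x _; rewrite lee_fin. Qed.

Let dens_sigma_additive : semi_sigma_additive dens.
Proof.
move=> F mF tF mUF; rewrite /density_measure ge0_integral_bigcup//.
- by apply: is_cvg_ereal_nneg_natsum_cond => n _ _; exact: dens_ge0.
- exact/measurable_funTS/measurable_EFinP.
- by move=> x _; rewrite lee_fin.
Qed.

HB.instance Definition _ :=
  isMeasure.Build _ _ _ dens dens0 dens_ge0 dens_sigma_additive.

Lemma ge0_integral_density (F : T -> \bar R) :
  measurable_fun setT F -> (forall x, 0 <= F x) ->
  \int[dens]_x F x = \int[m]_x ((w x)%:E * F x).
Proof.
move=> mF F0; pose h := nnsfun_approx measurableT mF.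
have mEw : measurable_fun setT (EFin \o w) by exact/measurable_EFinP.
have FE x : F x = limn (fun n => (h n x)%:E).
  by apply/esym/cvg_lim => //; exact: cvg_nnsfun_approx.
transitivity (limn (fun n => \int[dens]_x (h n x)%:E)).
  under eq_integral do rewrite FE.
  apply: monotone_convergence => //.
  - by move=> n; exact/measurable_EFinP.
  - by move=> n x _; rewrite lee_fin.
  - by move=> x _ a b ab; rewrite lee_fin; exact/lefP/nd_nnsfun_approx.
transitivity (limn (fun n => \int[m]_x ((w x)%:E * (h n x)%:E))); last first.
  rewrite -monotone_convergence//; last 3 first.
  - by move=> n; apply: emeasurable_funM => //; exact/measurable_EFinP.
  - by move=> n x _; rewrite mule_ge0 ?lee_fin.
  - move=> x _ a b ab; apply: lee_wpmul2l; rewrite lee_fin//.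
    exact/lefP/nd_nnsfun_approx.
  apply: eq_integral => x _; apply/cvg_lim => //.
  by apply: cvgeZl => //; exact: cvg_nnsfun_approx.
congr (limn _); apply/funext => n.
transitivity (\int[dens]_x
   (\sum_(y \in range (h n)) (y * \1_(h n @^-1` [set y]) x)%:E)).
  by apply: eq_integral => t tE; rewrite /= fimfunE -fsumEFin.
rewrite ge0_integral_fsum//; last 2 first.
- by move=> y; exact/measurable_EFinP/measurable_funM.
- by move=> y x _; exact: nnfun_muleindic_ge0.
transitivity (\int[m]_x (\sum_(y \in range (h n))
    (w x)%:E * (y * \1_(h n @^-1` [set y]) x)%:E)); last first.
  apply: eq_integral => x _.
  rewrite -ge0_mule_fsumr; last by move=> y; exact: nnfun_muleindic_ge0.
  by rewrite fsumEFin // -(fimfunE _ x).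
rewrite ge0_integral_fsum//; last 2 first.
- move=> y; apply: emeasurable_funM => //; exact/measurable_EFinP/measurable_funM.
- by move=> y x _; apply: mule_ge0; [rewrite lee_fin|exact: nnfun_muleindic_ge0].
apply: eq_fsbigr => r rhn.
rewrite integralZl_indic_nnsfun// integral_indic// setIT /= /density_measure.
rewrite integral_mkcond/=.
under [RHS]eq_integral do rewrite EFinM muleCA.
rewrite ge0_integralZl//.
- congr (_ * _); apply: eq_integral => x _; rewrite patchE indicE.
  by case: ifP => _; rewrite ?mule1 ?mule0.
- by apply: emeasurable_funM => //; exact/measurable_EFinP.
- by move=> x _; rewrite mule_ge0 ?lee_fin.
- by move: rhn; rewrite inE => -[t _ <-]; rewrite lee_fin.
Qed.

End density_measure.

Section image_measure.
Context d d' (T : measurableType d) (U : measurableType d') (R : realType).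
Variables (m : {measure set T -> \bar R}) (Z : T -> U) (mZ : measurable_fun setT Z).

(* [pushforward] is a measure only through a canonical instance taking [mZ] as an argument,
   which unification cannot supply. *)
Definition image_measure : {measure set U -> \bar R} :=
  measure_function_pushforward__canonical__measure_function_Measure m mZ.

Lemma image_measureE A : image_measure A = m (Z @^-1` A).
Proof. by []. Qed.

Lemma ge0_integral_image_measure (F : U -> \bar R) :
  measurable_fun setT F -> (forall x, 0 <= F x)%E ->
  (\int[image_measure]_x F x = \int[m]_w F (Z w))%E.
Proof.
by move=> mF F0; rewrite /image_measure ge0_integral_pushforward.
Qed.

End image_measure.

(* [w] need not be bounded and [nu] need not be finite: this is the step that upgrades a
   product rule on events to one on nonnegative functions, one variable at a time. *)
Lemma ge0_integral_product_rule d d' (T : measurableType d) (U : measurableType d')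
    (R : realType) (m : {measure set T -> \bar R}) (nu : {measure set U -> \bar R})
    (w : T -> R) (Y : T -> U) (c : R) :
  measurable_fun setT w -> (forall x, 0 <= w x) -> measurable_fun setT Y -> 0 <= c ->
  (forall B, measurable B -> \int[m]_x ((w x)%:E * (\1_B (Y x))%:E) = c%:E * nu B)%E ->
  forall F : U -> \bar R, measurable_fun setT F -> (forall x, 0 <= F x)%E ->
  (\int[m]_x ((w x)%:E * F (Y x)) = c%:E * \int[nu]_y F y)%E.
Proof.
move=> mw w0 mY c0 H F mF F0.
rewrite -(@ge0_integral_density _ _ _ m w mw w0 (F \o Y)); [|exact: measurableT_comp|by move=> x; exact: F0].
have -> : c%:E = (NngNum c0)%:num%:E by [].
rewrite -ge0_integral_mscale//.
rewrite -(@ge0_integral_pushforward _ _ _ _ _ Y mY _ setT)//.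
apply: eq_measure_integral => B mB _.
transitivity (c%:E * nu B)%E; last by [].
rewrite -H//=; transitivity (\int[m]_(x in Y @^-1` B) (w x)%:E)%E; first by [].
rewrite integral_mkcond; apply: eq_integral => x _.
rewrite patchE indicE (_ : (x \in Y @^-1` B) = (Y x \in B))//.
by case: (_ \in _) => /=; rewrite ?mule1 ?mule0.
Qed.

Lemma prod_indicE (R : comNzRingType) (I : finType) (U : I -> Type)
    (A : forall i, set (U i)) (x : forall i, U i) :
  \prod_i (\1_(A i) (x i) : R) = (`[< forall i, A i (x i) >])%:R.
Proof.
case: asboolP => [Ax|/existsNP[i nAx]].
  by rewrite big1// => i _; rewrite indicE mem_set.
by rewrite (bigD1 i)//= indicE memNset// mul0r.
Qed.

Lemma measurable_cylinder d d' (T : measurableType d) (U : measurableType d') (I : finType)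
    (X : I -> T -> U) (A : I -> set U) :
  (forall i, measurable_fun setT (X i)) -> (forall i, measurable (A i)) ->
  measurable [set w | forall i, A i (X i w)].
Proof.
move=> mX mA; rewrite (_ : [set _ | _] = \big[setI/setT]_i (X i @^-1` A i)).
  apply: bigsetI_measurable => i _.
  by rewrite -[X in measurable X]setTI; exact: mX.
by apply/seteqP; split => [w /= Aw|w]; rewrite -bigcap_seq;
  [move=> i _; exact: Aw|move=> Aw i; apply: Aw; rewrite /= mem_index_enum].
Qed.

(** The factorisation is assumed only inside [E] and up to the factor [c]: in the lower bound [E] is
    the event {K = k}, with [c] equal to 1/|K|. *)
Lemma ge0_integral_prod_independent d d' (T : measurableType d) (U : measurableType d')
    (R : realType) (m : {measure set T -> \bar R}) (I : finType) (X : I -> T -> U)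
    (nu : I -> {measure set U -> \bar R}) (E : set T) (c : R) :
  measurable E -> (forall i, measurable_fun setT (X i)) -> 0 <= c ->
  (forall i, nu i setT < +oo)%E ->
  (forall A : I -> set U, (forall i, measurable (A i)) ->
    m (E `&` [set w | forall i, A i (X i w)]) = (c%:E * \prod_i nu i (A i))%E) ->
  forall (F : I -> U -> R) (v : I -> R), (forall i, measurable_fun setT (F i)) ->
  (forall i x, 0 <= F i x) ->
  (forall i, \int[nu i]_x (F i x)%:E = (v i)%:E)%E ->
  (\int[m]_(w in E) (\prod_i F i (X i w))%:E = (c * \prod_i v i)%:E)%E.
Proof.
move=> mE mX c0 nuT H.
(* [k] bounds the ranks of the coordinates whose function is still arbitrary; those of rank at least
   [k] carry indicators. At [k = 0] this is the hypothesis on events, at [k = #|I|] the claim. *)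
suff K k (F : I -> U -> R) (v : I -> R) : (forall i, measurable_fun setT (F i)) ->
  (forall i x, 0 <= F i x) ->
  (forall i, \int[nu i]_x (F i x)%:E = (v i)%:E)%E ->
  (forall i, (k <= enum_rank i)%N ->
    exists2 A, measurable A & F i = \1_A) ->
  (\int[m]_w (\1_E w * \prod_i F i (X i w))%:E = (c * \prod_i v i)%:E)%E.
  move=> F v mF F0 vE; rewrite -(K #|I| F v)// => [|i]; last first.
    by rewrite leqNgt ltn_ord.
  rewrite integral_mkcond; apply: eq_integral => w _.
  by rewrite patchE indicE; case: ifP; rewrite ?mul1r ?mul0r.
elim: k => [|k IH] in F v *.
  move=> mF F0 vE /(_ _ (leq0n _)) FA.
  have {}FA i : exists A, measurable A /\ F i = \1_A by have [A mA ->] := FA i; exists A.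
  have {FA} [A FA] := boolp.choice FA.
  have mA i := (FA i).1.
  have vA i : nu i (A i) = (v i)%:E.
    by rewrite -vE (FA i).2 integral_indic// setIT.
  transitivity (m (E `&` [set w | forall i, A i (X i w)])).
    have mEA : measurable (E `&` [set w | forall i, A i (X i w)]).
      by apply: measurableI => //; exact: measurable_cylinder.
    rewrite -[in RHS](setIT (_ `&` _)) -integral_indic//.
    apply: eq_integral => w _; congr EFin.
    rewrite (eq_bigr (fun i => \1_(A i) (X i w))); last by move=> i _; rewrite (FA i).2.
    by rewrite prod_indicE !indicE in_setI -natrM mulnb.
  rewrite H// (eq_bigr (fun i => (v i)%:E))//.
  by rewrite EFinM prodEFin.
move=> mF F0 vE FA.
have [kI|Ik] := ltnP k #|I|; last first.
  by apply: IH => // i; rewrite leqNgt (leq_trans (ltn_ord _) Ik).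
pose i0 := enum_val (Ordinal kI).
have v0 i : 0 <= v i.
  by rewrite -lee_fin -vE; apply: integral_ge0 => x _; rewrite lee_fin.
have mFX i : measurable_fun setT (fun w => F i (X i w)).
  exact: measurableT_comp.
(* All factors except that of [i0] form the weight of the product rule. Its hypothesis, with an
   indicator in place of [F i0], is the induction hypothesis. *)
pose w0 := fun w => \1_E w * \prod_(i | i != i0) F i (X i w).
rewrite (bigD1 i0)//= mulrCA EFinM muleC -(vE i0) EFinM.
under eq_integral => w _.
  rewrite (bigD1 i0)//= mulrCA mulrC EFinM -/(w0 w).
  over.
rewrite (@ge0_integral_product_rule _ _ _ _ _ m (nu i0) w0 (X i0) (c * \prod_(i | i != i0) v i) _ _ _ _ _ (fun x => (F i0 x)%:E))//.
- apply: measurable_funM; first exact: measurable_indic.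
  under eq_fun do rewrite -big_filter.
  exact: measurable_prod.
- by move=> w; rewrite mulr_ge0// prodr_ge0.
- by rewrite mulr_ge0// prodr_ge0.
- move=> B mB.
  pose F' i := if i == i0 then \1_B : U -> R else F i.
  pose v' i := if i == i0 then fine (nu i0 B) else v i.
  have fB : (nu i0 B \is a fin_num)%E.
    by rewrite ge0_fin_numE// (le_lt_trans _ (nuT i0))// le_measure ?inE.
  transitivity (\int[m]_w (\1_E w * \prod_i F' i (X i w))%:E)%E.
    apply: eq_integral => w _; rewrite (bigD1 i0)//= {1}/F' eqxx mulrCA mulrC.
    rewrite -!EFinM; congr (_ * _ * _)%:E; apply: eq_bigr => i /negbTE ii0.
    by rewrite /F' ii0.
  rewrite (IH F' v').
  + rewrite (bigD1 i0)//= {1}/v' eqxx mulrCA mulrC EFinM fineK//.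
    congr ((_ * _)%:E * _)%E; apply: eq_bigr => i /negbTE ii0.
    by rewrite /v' ii0.
  + by move=> i; rewrite /F'; case: ifP.
  + by move=> i x; rewrite /F'; case: ifP.
  + move=> i; rewrite /F' /v'; case: eqP => [->|//].
    by rewrite integral_indic// setIT fineK.
  + move=> i ki; rewrite /F'; case: eqP => [_|ii0]; first by exists B.
    apply: FA; rewrite ltn_neqAle ki andbT; apply/eqP => kE; apply: ii0.
    by rewrite /i0 -[i]enum_rankK; congr enum_val; exact: val_inj.
- exact/measurable_EFinP.
- by move=> x; rewrite lee_fin.
Qed.

(** * Real-valued means *)

Lemma sqr_le_discriminant (R : realFieldType) (A B C : R) : 0 <= C ->
  (forall s, 0 <= A - 2 * s * B + s ^+ 2 * C) -> B ^+ 2 <= A * C.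
Proof.
move=> C0 key; have [C00|Cn0] := eqVneq C 0.
  have [->|Bn0] := eqVneq B 0; first by rewrite C00 mulr0 expr0n.
  (* With [C = 0] the polynomial is affine in [s], and here it takes the value -1. *)
  have := key ((A + 1) / (2 * B)); rewrite C00 mulr0 addr0.
  have -> : 2 * ((A + 1) / (2 * B)) * B = A + 1 by field.
  by lra.
have := key (B / C) => /(mulr_ge0 C0).
have -> : C * (A - 2 * (B / C) * B + (B / C) ^+ 2 * C) = A * C - B ^+ 2 by field.
by rewrite subr_ge0.
Qed.

Lemma Cauchy_Schwarz_sum (R : realFieldType) (I : finType) (p x y : I -> R) :
  (forall i, 0 <= p i) ->
  (\sum_i p i * (x i * y i)) ^+ 2 <= (\sum_i p i * x i ^+ 2) * (\sum_i p i * y i ^+ 2).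
Proof.
move=> p0; apply: sqr_le_discriminant => [|s].
  by apply: sumr_ge0 => i _; rewrite mulr_ge0 ?sqr_ge0.
have -> : \sum_i p i * x i ^+ 2 - 2 * s * (\sum_i p i * (x i * y i)) +
    s ^+ 2 * (\sum_i p i * y i ^+ 2) = \sum_i p i * (x i - s * y i) ^+ 2.
  rewrite !mulr_sumr -sumrB -big_split/=; apply: eq_bigr => i _; ring.
by apply: sumr_ge0 => i _; rewrite mulr_ge0 ?sqr_ge0.
Qed.

Section mean.
Context d (T : measurableType d) (R : realType) (P : probability T R).
Implicit Types f g : T -> R.

Definition has_mean f : Prop := P.-integrable setT (EFin \o f).

Definition mean f : R := \int[P]_w f w.

Lemma has_mean_measurable f : has_mean f -> measurable_fun setT f.
Proof. by move=> /integrableP[/measurable_EFinP]. Qed.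

Lemma meanE f : has_mean f -> (\int[P]_w (f w)%:E = (mean f)%:E)%E.
Proof.
by move=> Lf; rewrite /mean /Rintegral fineK//; exact: integrable_fin_num.
Qed.

Lemma eq_mean f g : f =1 g -> mean f = mean g.
Proof. by move=> fg; rewrite /mean (_ : f = g)//; exact/funext. Qed.

Lemma eq_has_mean f g : f =1 g -> has_mean f -> has_mean g.
Proof. by move=> fg; rewrite (_ : f = g)//; exact/funext. Qed.

Lemma has_mean_ge0 f a : measurable_fun setT f -> (forall w, 0 <= f w) ->
  (\int[P]_w (f w)%:E = a%:E)%E -> has_mean f /\ mean f = a.
Proof.
move=> mf f0 fa; split; last by rewrite /mean /Rintegral fa.
apply/integrableP; split; first exact/measurable_EFinP.
under eq_integral => w _ do rewrite /= ger0_norm//.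
by rewrite fa ltry.
Qed.

Lemma has_mean_le_fin f a : measurable_fun setT f -> (forall w, 0 <= f w) ->
  (\int[P]_w (f w)%:E <= a%:E)%E -> has_mean f /\ mean f <= a.
Proof.
move=> mf f0 fa.
have I0 : (0 <= \int[P]_w (f w)%:E)%E by apply: integral_ge0 => w _; rewrite lee_fin.
have fin : (\int[P]_w (f w)%:E)%E \is a fin_num.
  by rewrite ge0_fin_numE// (le_lt_trans fa)// ltry.
have [|Lf Ef] := @has_mean_ge0 f (fine (\int[P]_w (f w)%:E)%E) mf f0.
  by rewrite fineK.
by split=> //; rewrite Ef -lee_fin fineK.
Qed.

Lemma has_mean_dom f g : measurable_fun setT f -> (forall w, `|f w| <= g w) ->
  has_mean g -> has_mean f.
Proof.
move=> mf fg Lg; apply: (le_integrable measurableT _ _ Lg).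
  exact/measurable_EFinP.
by move=> w _; rewrite /= lee_fin (le_trans (fg w))// ler_norm.
Qed.

Lemma has_mean_cst a : has_mean (fun=> a).
Proof. exact: finite_measure_integrable_cst. Qed.

Lemma mean_cst a : mean (fun=> a) = a.
Proof. by rewrite /mean Rintegral_cst// -[X in fine X]/(P setT) probability_setT mulr1. Qed.

Lemma has_meanD f g : has_mean f -> has_mean g -> has_mean (fun w => f w + g w).
Proof. by move=> Lf Lg; have := integrableD measurableT Lf Lg. Qed.

Lemma has_meanB f g : has_mean f -> has_mean g -> has_mean (fun w => f w - g w).
Proof. by move=> Lf Lg; have := integrableB measurableT Lf Lg. Qed.

Lemma has_meanZ a f : has_mean f -> has_mean (fun w => a * f w).
Proof. by move=> Lf; have := integrableZl measurableT a Lf. Qed.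

Lemma has_mean_norm f : has_mean f -> has_mean (fun w => `|f w|).
Proof. exact: integrable_norm. Qed.

Lemma meanD f g : has_mean f -> has_mean g -> mean (fun w => f w + g w) = mean f + mean g.
Proof. by move=> Lf Lg; rewrite /mean RintegralD. Qed.

Lemma meanB f g : has_mean f -> has_mean g -> mean (fun w => f w - g w) = mean f - mean g.
Proof. by move=> Lf Lg; rewrite /mean RintegralB. Qed.

Lemma meanZ a f : has_mean f -> mean (fun w => a * f w) = a * mean f.
Proof. by move=> Lf; rewrite /mean RintegralZl. Qed.

Lemma has_mean_sum (I : Type) (s : seq I) (F : I -> T -> R) :
  (forall i, has_mean (F i)) -> has_mean (fun w => \sum_(i <- s) F i w).
Proof.
move=> LF; elim: s => [|i s IH].
  by apply: (eq_has_mean _ (has_mean_cst 0)) => w; rewrite big_nil.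
by apply: (eq_has_mean _ (has_meanD (LF i) IH)) => w; rewrite big_cons.
Qed.

Lemma mean_sum (I : Type) (s : seq I) (F : I -> T -> R) :
  (forall i, has_mean (F i)) ->
  mean (fun w => \sum_(i <- s) F i w) = \sum_(i <- s) mean (F i).
Proof.
move=> LF; elim: s => [|i s IH].
  rewrite big_nil; transitivity (mean (fun=> 0)); last exact: mean_cst.
  by apply: eq_mean => w; rewrite big_nil.
rewrite big_cons -IH -meanD//; last exact: has_mean_sum.
by apply: eq_mean => w; rewrite big_cons.
Qed.

Lemma le_mean f g : has_mean f -> has_mean g -> (forall w, f w <= g w) ->
  mean f <= mean g.
Proof. by move=> Lf Lg fg; apply: le_Rintegral => // w _; exact: fg. Qed.

Lemma mean_ge0 f : (forall w, 0 <= f w) -> 0 <= mean f.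
Proof. by move=> f0; apply: Rintegral_ge0 => w _; exact: f0. Qed.

Lemma norm_mean_le f : has_mean f -> `|mean f| <= mean (fun w => `|f w|).
Proof. by move=> Lf; apply: le_normr_Rintegral. Qed.

Lemma has_mean_indic E f : measurable E -> has_mean f -> has_mean (fun w => \1_E w * f w).
Proof.
move=> mE Lf; apply: (has_mean_dom _ _ (has_mean_norm Lf)).
  by apply: measurable_funM; [exact: measurable_indic|exact: has_mean_measurable].
by move=> w; rewrite indicE; case: (_ \in _); rewrite ?mul1r ?mul0r ?normr0.
Qed.

Lemma mean_indic E : measurable E -> has_mean (\1_E) /\ mean (\1_E) = fine (P E).
Proof.
move=> mE; apply: has_mean_ge0; first exact: measurable_indic.
  by move=> w; rewrite indicE.
by rewrite integral_indic// setIT fineK// fin_num_measure.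
Qed.

Lemma has_mean_sqr f : measurable_fun setT f -> has_mean (fun w => f w ^+ 2) -> has_mean f.
Proof.
move=> mf L2; apply: (has_mean_dom mf _ (has_meanD (has_mean_cst 1) L2)) => w.
by rewrite -real_normK ?num_real//; set z := `|f w|; nra.
Qed.

Lemma has_mean_mul f g : measurable_fun setT f -> measurable_fun setT g ->
  has_mean (fun w => f w ^+ 2) -> has_mean (fun w => g w ^+ 2) ->
  has_mean (fun w => f w * g w).
Proof.
move=> mf mg Lf Lg; apply: (has_mean_dom _ _ (has_meanD Lf Lg)).
  exact: measurable_funM.
move=> w; rewrite normrM -[f w ^+ 2]real_normK ?num_real// -[g w ^+ 2]real_normK ?num_real//.
by set x := `|f w|; set y := `|g w|; nra.
Qed.

Lemma has_mean_sqrD f g : measurable_fun setT f -> measurable_fun setT g ->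
  has_mean (fun w => f w ^+ 2) -> has_mean (fun w => g w ^+ 2) ->
  has_mean (fun w => (f w + g w) ^+ 2).
Proof.
move=> mf mg Lf Lg.
apply: (has_mean_dom _ _ (has_meanD (has_meanZ 2 Lf) (has_meanZ 2 Lg))).
  by apply: measurable_funX; exact: measurable_funD.
by move=> w; rewrite ger0_norm ?sqr_ge0//; have := sqr_ge0 (f w - g w); nra.
Qed.

(** Cauchy-Schwarz for [f] and 1 under the measure |h| dP. The sign of [h] is free because [h] will
    be the difference between an encoder and its likelihood. *)
Lemma sqr_mean_le h f : measurable_fun setT f -> has_mean h ->
  has_mean (fun w => f w ^+ 2 * `|h w|) ->
  has_mean (fun w => f w * h w) /\
  mean (fun w => f w * h w) ^+ 2 <= mean (fun w => f w ^+ 2 * `|h w|) * mean (fun w => `|h w|).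
Proof.
move=> mf Lh L2; have mh := has_mean_measurable Lh; have Lnh := has_mean_norm Lh.
have L1 : has_mean (fun w => f w * h w).
  apply: (has_mean_dom _ _ (has_meanD Lnh L2)); first exact: measurable_funM.
  move=> w; rewrite normrM -[f w ^+ 2]real_normK ?num_real//.
  have := normr_ge0 (h w); set x := `|f w|; set y := `|h w| => y0.
  have : x <= 1 + x ^+ 2 by nra.
  by move=> /(ler_wpM2r y0); lra.
split=> //; set A := mean _; set B := mean _; set C := mean _.
have C0 : 0 <= C by apply: mean_ge0.
(* For [s > 0] compare with the mean of (|f| - s)^2 |h|; for [s <= 0] every term is nonnegative. *)
have key s : 0 <= B - 2 * s * `|A| + s ^+ 2 * C.
  have La : has_mean (fun w => `|f w| * `|h w|).
    by apply: (eq_has_mean _ (has_mean_norm L1)) => w; rewrite normrM.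
  have AA : `|A| <= mean (fun w => `|f w| * `|h w|).
    apply: (le_trans (norm_mean_le L1)); apply: le_mean La _ => [|w].
      exact: has_mean_norm.
    by rewrite normrM.
  have [s0|s0] := leP s 0.
    have B0 : 0 <= B by apply: mean_ge0 => w; rewrite mulr_ge0 ?sqr_ge0.
    have := mulr_ge0 (sqr_ge0 s) C0; have : s * `|A| <= 0 by rewrite mulr_le0_ge0.
    by lra.
  have : 0 <= mean (fun w => (f w ^+ 2 * `|h w| + s ^+ 2 * `|h w|) - 2 * s * (`|f w| * `|h w|)).
    apply: mean_ge0 => w; rewrite -[f w ^+ 2]real_normK ?num_real//.
    have := normr_ge0 (h w); set x := `|f w|; set y := `|h w| => y0.
    have -> : x ^+ 2 * y + s ^+ 2 * y - 2 * s * (x * y) = (x - s) ^+ 2 * y by ring.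
    by rewrite mulr_ge0 ?sqr_ge0.
  have LX : has_mean (fun w => f w ^+ 2 * `|h w| + s ^+ 2 * `|h w|).
    by apply: has_meanD => //; exact: has_meanZ.
  rewrite meanB//; last exact: has_meanZ.
  rewrite meanD//; last exact: has_meanZ.
  rewrite !meanZ// -/B -/C => /le_trans; apply.
  have : 2 * s * `|A| <= 2 * s * mean (fun w => `|f w| * `|h w|).
    by rewrite ler_wpM2l// mulr_ge0// ltW.
  by lra.
by rewrite -(real_normK (num_real A)); exact: sqr_le_discriminant.
Qed.

Lemma mean_indic_eq0 E f : measurable E -> measurable_fun setT f -> mean \1_E = 0 -> mean (fun w => \1_E w * f w) = 0.
Proof.
move=> mE mf E0; have PE : P E = 0%E.
  by rewrite -[P E]fineK ?fin_num_measure// -(mean_indic mE).2 E0.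
rewrite /mean /Rintegral (_ : \int[P]_w _ = 0)%E//.
transitivity (\int[P]_(w in E) (f w)%:E)%E.
  rewrite [RHS]integral_mkcond; apply: eq_integral => w _.
  by rewrite patchE indicE; case: ifP; rewrite ?mul1r ?mul0r.
apply: null_set_integral => //; exact/measurable_funTS/measurable_EFinP.
Qed.

(** The negative part is bounded, so an upper bound on the extended integral forces the positive
    part to be integrable. This turns a finite divergence into integrability of g ln g, which is at
    least -1. *)
Lemma has_mean_ge_le f b a : measurable_fun setT f -> (forall w, b <= f w) ->
  (\int[P]_w (f w)%:E <= a%:E)%E -> has_mean f /\ mean f <= a.
Proof.
move=> mf fb fa.
have mEf : measurable_fun setT (EFin \o f) by exact/measurable_EFinP.
have neg : (\int[P]_w (EFin \o f)^\- w <= `|b|%:E)%E.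
  apply: (@le_trans _ _ (\int[P]_w (cst `|b|%:E w))%E).
    apply: ge0_le_integral => //.
    - exact: measurable_funeneg.
    - move=> w _; have h1 : (- (f w)%:E <= `|b|%:E)%E.
        have := fb w; have := ler_norm (- b); rewrite -EFinN lee_fin normrN.
        by move: (f w) => x; lra.
      by rewrite funenegE ge_max; apply/andP; split=> //; rewrite lee_fin.
  by rewrite integral_cst// -[X in (_ * X)%E]/(P setT) probability_setT mule1.
have n0 : (0 <= \int[P]_w (EFin \o f)^\- w)%E by apply: integral_ge0 => w _; exact: funeneg_ge0.
have nfin : (\int[P]_w (EFin \o f)^\- w)%E \is a fin_num.
  by rewrite ge0_fin_numE// (le_lt_trans neg)// ltry.
have Lf : has_mean f.
  apply/integrableP; split=> //.
  rewrite (_ : (fun w => _) = abse \o (EFin \o f))// fune_abse.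
  rewrite ge0_integralD//; last 2 first.
  - exact: measurable_funepos.
  - exact: measurable_funeneg.
  have nlt : (\int[P]_w (EFin \o f)^\- w < +oo)%E by rewrite -ge0_fin_numE.
  have plt : (\int[P]_w (EFin \o f)^\+ w < +oo)%E.
    apply: (@le_lt_trans _ _ (a%:E + \int[P]_w (EFin \o f)^\- w)%E).
      by rewrite -leeBlDr// -[X in (X <= _)%E]integralE.
    by rewrite lte_add_pinfty// ltry.
  by rewrite lte_add_pinfty.
by split=> //; rewrite -lee_fin -meanE.
Qed.

End mean.

(** * Products of variables that are independent given an event *)

Section conditional_independence.
Context d (T : measurableType d) (R : realType) (P : probability T R).
Variables (E : set T) (X Y : T -> R).
Hypotheses (mE : measurable E) (mX : measurable_fun setT X) (mY : measurable_fun setT Y).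
Hypothesis XEY : forall A B, measurable A -> measurable B ->
  (P (X @^-1` A `&` E `&` Y @^-1` B) * P E = P (X @^-1` A `&` E) * P (E `&` Y @^-1` B))%E.

Let m1E : measurable_fun setT (\1_E : T -> R).
Proof. exact: measurable_indic. Qed.

Let ge01E w : 0 <= \1_E w :> R.
Proof. by rewrite indicE. Qed.

Let PE := mean P \1_E.

Let preimage_meas (Z : T -> R) A : measurable_fun setT Z -> measurable A -> measurable (Z @^-1` A).
Proof. by move=> mZ mA; rewrite -[X in measurable X]setTI; exact: mZ. Qed.

Let integral_indic3 (Z Z' : T -> R) A B : measurable_fun setT Z -> measurable_fun setT Z' ->
  measurable A -> measurable B ->
  (\int[P]_w (\1_E w * \1_A (Z w) * \1_B (Z' w))%:E = P (Z @^-1` A `&` E `&` Z' @^-1` B))%E.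
Proof.
move=> mZ mZ' mA mB.
rewrite -[in RHS](setIT (_ `&` _)) -integral_indic//; last first.
  by apply: measurableI; [apply: measurableI => //|]; exact: preimage_meas.
apply: eq_integral => w _; rewrite !indicE !in_setI -!natrM !mulnb.
by congr ((_ && _)%:R%:E); rewrite andbC.
Qed.

(** The product rule is applied twice: [G (Y w)] replaces an indicator while X still carries one,
    then [F (X w)] replaces the indicator of X, with [G (Y w)] in the weight. *)
Let fsteps (F G : R -> R) (a b : R) : measurable_fun setT F -> measurable_fun setT G ->
  (forall x, 0 <= F x) -> (forall x, 0 <= G x) ->
  (\int[P]_w (\1_E w * F (X w))%:E = a%:E)%E ->
  (\int[P]_w (\1_E w * G (Y w))%:E = b%:E)%E ->
  (\int[P]_w (PE * (\1_E w * (F (X w) * G (Y w))))%:E = (a * b)%:E)%E.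
Proof.
move=> mF mG F0 G0 Fa Gb.
have PE0 : 0 <= PE by apply: mean_ge0.
have PEE : P E = PE%:E by rewrite /PE (mean_indic P mE).2 fineK// fin_num_measure.
pose nu (Z : T -> R) (mZ : measurable_fun setT Z) :=
  image_measure (density_measure P m1E ge01E) mZ.
have nuE (Z : T -> R) (mZ : measurable_fun setT Z) (H : R -> R) : measurable_fun setT H -> (forall x, 0 <= H x) ->
    (\int[nu Z mZ]_x (H x)%:E = \int[P]_w (\1_E w * H (Z w))%:E)%E.
  move=> mH H0; rewrite /nu ge0_integral_image_measure; last 2 first.
  - exact/measurable_EFinP.
  - by move=> x; rewrite lee_fin.
  rewrite ge0_integral_density//=.
  - by apply/measurable_EFinP; exact: measurableT_comp.
  - by move=> x; rewrite lee_fin.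
have nuB (Z : T -> R) (mZ : measurable_fun setT Z) B : measurable B -> (nu Z mZ B = P (E `&` Z @^-1` B))%E.
  move=> mB; transitivity (\int[nu Z mZ]_x (\1_B x)%:E)%E.
    by rewrite integral_indic// setIT.
  rewrite nuE; [|exact: measurable_indic|by move=> x; rewrite indicE].
  rewrite -[in RHS](setIT (_ `&` _)) -integral_indic//; last first.
    by apply: measurableI => //; exact: preimage_meas.
  by apply: eq_integral => w _; rewrite !indicE in_setI -natrM mulnb.
have step1 A : measurable A ->
    (\int[P]_w (PE * (\1_E w * (\1_A (X w) * G (Y w))))%:E = P (X @^-1` A `&` E) * b%:E)%E.
  move=> mA; have mXA : measurable (X @^-1` A `&` E).
    by apply: measurableI => //; exact: preimage_meas.
  under eq_integral do rewrite !mulrA EFinM.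
  have m1A : measurable_fun setT (fun w => \1_A (X w) : R).
    by apply: measurableT_comp => //; exact: measurable_indic.
  rewrite (@ge0_integral_product_rule _ _ _ _ _ P (nu Y mY)
     (fun w => PE * \1_E w * \1_A (X w)) Y (fine (P (X @^-1` A `&` E))) _ _ _ _ _
     (fun y => (G y)%:E))//.
  - by rewrite nuE// Gb fineK// fin_num_measure.
  - by do 2 apply: measurable_funM => //.
  - by move=> w; rewrite !mulr_ge0// indicE.
  - by rewrite fine_ge0.
  - move=> B mB; rewrite nuB// fineK ?fin_num_measure// -XEY// muleC PEE.
    rewrite -(integral_indic3 mX mY)// -ge0_integralZl//.
    + by apply: eq_integral => w _; rewrite -!EFinM !mulrA.
    + apply/measurable_EFinP; apply: measurable_funM; first exact: measurable_funM.
      by apply: measurableT_comp => //; exact: measurable_indic.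
  - exact/measurable_EFinP.
under eq_integral => w _.
  rewrite [F _ * _]mulrC !mulrA EFinM.
  over.
rewrite (@ge0_integral_product_rule _ _ _ _ _ P (nu X mX)
   (fun w => PE * \1_E w * G (Y w)) X b _ _ _ _ _ (fun y => (F y)%:E))//.
- by rewrite nuE// Fa -EFinM mulrC.
- by apply: measurable_funM; [exact: measurable_funM|exact: measurableT_comp].
- by move=> w; rewrite !mulr_ge0.
- by rewrite -lee_fin -Gb; apply: integral_ge0 => w _; rewrite lee_fin mulr_ge0.
- move=> A mA; rewrite nuB// setIC muleC -step1//.
  by apply: eq_integral => w _; rewrite -EFinM; congr EFin; ring.
- exact/measurable_EFinP.
Qed.

(** Splitting X and Y into positive and negative parts reduces to nonnegative functions. Multiplying
    through by the probability of [E] keeps the formula valid when [E] is null. *)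
Lemma mean_mul_conditional_independent :
  has_mean P (fun w => X w ^+ 2) -> has_mean P (fun w => Y w ^+ 2) ->
  mean P \1_E * mean P (fun w => \1_E w * (X w * Y w)) =
  mean P (fun w => \1_E w * X w) * mean P (fun w => \1_E w * Y w).
Proof.
move=> X2 Y2.
pose p (x : R) := Num.max x 0; pose q (x : R) := Num.max (- x) 0.
have pq x : x = p x - q x.
  by rewrite /p /q; case: (leP x 0) => x0; case: (leP (- x) 0); lra.
have p0 x : 0 <= p x by rewrite le_max lexx orbT.
have q0 x : 0 <= q x by rewrite le_max lexx orbT.
have mp : measurable_fun setT p by exact: measurable_maxr.
have mq : measurable_fun setT q by apply: measurable_maxr => //; exact: measurable_funN.
have key (F G : R -> R) : measurable_fun setT F -> measurable_fun setT G ->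
    (forall x, 0 <= F x) -> (forall x, 0 <= G x) ->
    has_mean P (fun w => F (X w)) -> has_mean P (fun w => G (Y w)) ->
    has_mean P (fun w => PE * (\1_E w * (F (X w) * G (Y w)))) /\
    mean P (fun w => PE * (\1_E w * (F (X w) * G (Y w)))) =
    mean P (fun w => \1_E w * F (X w)) * mean P (fun w => \1_E w * G (Y w)).
  move=> mF mG F0 G0 LF LG; apply: has_mean_ge0.
  - do 2 apply: measurable_funM => //.
    by apply: measurable_funM; exact: measurableT_comp.
  - by move=> w; rewrite !mulr_ge0// mean_ge0.
  - by apply: fsteps => //; rewrite meanE//; exact: has_mean_indic.
have abs_le (F : R -> R) (Z : T -> R) : measurable_fun setT F -> measurable_fun setT Z ->
    (forall x, `|F x| <= `|x|) -> has_mean P (fun w => Z w ^+ 2) ->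
    has_mean P (fun w => F (Z w)).
  move=> mF mZ FZ /(has_mean_sqr mZ)/has_mean_norm; apply: has_mean_dom => //.
  exact: measurableT_comp.
have pa x : `|p x| <= `|x|.
  by rewrite ger0_norm// /p ge_max ler_norm normr_ge0.
have qa x : `|q x| <= `|x|.
  by rewrite ger0_norm// /q ge_max normr_ge0 -normrN ler_norm.
have [pX qX] := (abs_le p X mp mX pa X2, abs_le q X mq mX qa X2).
have [pY qY] := (abs_le p Y mp mY pa Y2, abs_le q Y mq mY qa Y2).
have [Lpp Epp] := key p p mp mp p0 p0 pX pY.
have [Lpq Epq] := key p q mp mq p0 q0 pX qY.
have [Lqp Eqp] := key q p mq mp q0 p0 qX pY.
have [Lqq Eqq] := key q q mq mq q0 q0 qX qY.
have EZ (Z : T -> R) : has_mean P (fun w => p (Z w)) -> has_mean P (fun w => q (Z w)) ->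
    mean P (fun w => \1_E w * Z w) =
    mean P (fun w => \1_E w * p (Z w)) - mean P (fun w => \1_E w * q (Z w)).
  move=> Lp Lq; rewrite -meanB; [|exact: has_mean_indic..].
  by apply: eq_mean => w; rewrite [in LHS](pq (Z w)) mulrBr.
rewrite (EZ X)// (EZ Y)// -/PE -meanZ; last first.
  by apply: has_mean_indic => //; exact: has_mean_mul.
transitivity (mean P (fun w =>
   (PE * (\1_E w * (p (X w) * p (Y w))) + PE * (\1_E w * (q (X w) * q (Y w)))) -
   (PE * (\1_E w * (p (X w) * q (Y w))) + PE * (\1_E w * (q (X w) * p (Y w)))))).
  by apply: eq_mean => w; rewrite [in LHS](pq (X w)) [in LHS](pq (Y w)); ring.
rewrite meanB ?meanD//; [|exact: has_meanD..].
by rewrite Epp Epq Eqp Eqq; ring.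
Qed.

End conditional_independence.

(** * Gaussian integrals *)

Section normal.
Context (R : realType).
Implicit Types (m s c r b : R) (F : R -> R).
Local Notation leb := (@lebesgue_measure R).

(** The image of Lebesgue measure under the affine map, multiplied by [s], agrees with Lebesgue
    measure on half-open intervals, hence everywhere. *)
Lemma ge0_integral_lebesgue_affine m s F : 0 < s -> measurable_fun setT F ->
  (forall x, 0 <= F x) ->
  (\int[leb]_x (F x)%:E = s%:E * \int[leb]_x (F (m + s * x))%:E)%E.
Proof.
move=> s0 mF F0; have s_ge0 := ltW s0.
pose phi x : measurableTypeR R := m + s * x.
have mphi : measurable_fun setT phi by apply: measurable_funD => //; exact: measurable_funM.
transitivity (\int[mscale (NngNum s_ge0) (image_measure leb mphi)]_x (F x)%:E)%E.
  apply: eq_measure_integral => A mA _; apply: lebesgue_measure_unique => // _ [[a b]] _ <-.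
  transitivity (s%:E * leb `](((a - m) / s)%R), (((b - m) / s)%R)]%classic)%E; last first.
    congr (_ * leb _)%E; apply/seteqP.
    by split=> x; rewrite /phi /= !in_itv/= ltr_pdivrMr// ler_pdivlMr// ltrBlDl lerBrDl mulrC.
  rewrite !lebesgue_measure_itv/= !lte_fin ltr_pM2r ?invr_gt0// ltrD2r.
  case: ifPn => _; last by rewrite mule0.
  by rewrite -!EFinD -EFinM; congr EFin; field; rewrite gt_eqF.
rewrite ge0_integral_mscale//=; last 2 first.
- exact/measurable_EFinP.
- by move=> x _; rewrite lee_fin.
by rewrite ge0_integral_image_measure//; exact/measurable_EFinP.
Qed.

Lemma ge0_integral_normal m s F : measurable_fun setT F -> (forall x, 0 <= F x) ->
  (\int[normal_prob m s]_x (F x)%:E = \int[leb]_x (F x * normal_pdf m s x)%:E)%E.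
Proof.
move=> mF F0.
rewrite (eq_measure_integral (density_measure leb (measurable_normal_pdf m s)
  (normal_pdf_ge0 m s)))//.
rewrite ge0_integral_density//.
- by apply: eq_integral => x _; rewrite -EFinM mulrC.
- exact/measurable_EFinP.
Qed.

Lemma normal_peakE s : 0 < s -> normal_peak s = s^-1 / Num.sqrt (pi *+ 2).
Proof.
move=> s0; rewrite /normal_peak -(mulrnAr (s ^+ 2)) sqrtrM ?sqr_ge0//.
by rewrite sqrtr_sqr gtr0_norm// invfM.
Qed.

Lemma ge0_integral_normal_standard m s F : 0 < s ->
  measurable_fun setT F -> (forall x, 0 <= F x) ->
  (\int[normal_prob m s]_x (F x)%:E = \int[normal_prob 0 1]_x (F (m + s * x))%:E)%E.
Proof.
move=> s0 mF F0.
have mFa : measurable_fun setT (fun x => F (m + s * x)).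
  apply: measurableT_comp => //; apply: measurable_funD => //; exact: measurable_funM.
transitivity (\int[leb]_x (F x * normal_pdf m s x)%:E)%E.
  exact: ge0_integral_normal.
transitivity (\int[leb]_x (F (m + s * x) * normal_pdf 0 1 x)%:E)%E; last first.
  by apply/esym; exact: ge0_integral_normal.
rewrite (@ge0_integral_lebesgue_affine m s _ s0); last 2 first.
- by apply: measurable_funM => //; exact: measurable_normal_pdf.
- by move=> x; rewrite mulr_ge0// normal_pdf_ge0.
rewrite -ge0_integralZl//; last 3 first.
- apply/measurable_EFinP; apply: (measurableT_comp (f := fun x => F x * normal_pdf m s x)).
    by apply: measurable_funM => //; exact: measurable_normal_pdf.
  by apply: measurable_funD => //; exact: measurable_funM.
- by move=> x _; rewrite lee_fin mulr_ge0// normal_pdf_ge0.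
- by rewrite lee_fin ltW.
apply: eq_integral => x _; rewrite -EFinM; congr EFin.
rewrite !normal_pdfE ?gt_eqF// !normal_peakE// /normal_fun.
have -> : m + s * x - m = s * x by ring.
rewrite subr0 invr1 mul1r mulrCA; congr (F _ * _).
rewrite !mulrA divff ?gt_eqF// mul1r; congr (_ * expR _).
rewrite -[s ^+ 2 *+ 2]mulr_natr; field.
by rewrite gt_eqF.
Qed.

Lemma normal_prob_affine m s (A : set R) : 0 < s -> measurable A ->
  normal_prob m s A = normal_prob 0 1 [set x | A (m + s * x)].
Proof.
move=> s0 mA; have mphi : measurable_fun setT (fun x : R => m + s * x).
  by apply: measurable_funD => //; exact: measurable_funM.
rewrite -[A in LHS]setIT -(@integral_indic _ _ _ (normal_prob m s) setT)//.
rewrite ge0_integral_normal_standard//.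
- rewrite -[RHS]/(normal_prob 0 1 ((fun x : R => m + s * x) @^-1` A)).
  rewrite -[in RHS](setIT (_ @^-1` A)) -(@integral_indic _ _ _ (normal_prob 0 1) setT)//.
  by rewrite -[X in measurable X]setTI; exact: mphi.
Qed.

(** Up to the factor t/s the integrand is the density of N(c, t^2) with respect to N(m, s^2). *)
Lemma integral_normal_tilt m s c t : 0 < s -> 0 < t ->
  (\int[normal_prob m s]_x
     (expR ((x - m) ^+ 2 / (2 * s ^+ 2) - (x - c) ^+ 2 / (2 * t ^+ 2)))%:E = (t / s)%:E)%E.
Proof.
move=> s0 t0; rewrite ge0_integral_normal; last 2 first.
- apply: measurableT_comp => //; apply: measurable_funB; apply: measurable_funM => //;
    by apply: measurable_funX; exact: measurable_funB.
- by move=> x; exact: expR_ge0.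
transitivity (\int[leb]_x ((t / s)%:E * (normal_pdf c t x)%:E))%E.
  apply: eq_integral => x _; rewrite -EFinM; congr EFin.
  rewrite !normal_pdfE ?gt_eqF// mulrCA -expRD !normal_peakE// /normal_fun.
  have -> : t / s * (t^-1 / Num.sqrt (pi *+ 2) * expR (- (x - c) ^+ 2 / (t ^+ 2 *+ 2))) =
    s^-1 / Num.sqrt (pi *+ 2) * expR (- (x - c) ^+ 2 / (t ^+ 2 *+ 2)) :> R.
    by rewrite !mulrA (mulrAC t) mulfV ?gt_eqF// mul1r.
  congr (_ * expR _).
  rewrite -[s ^+ 2 *+ 2]mulr_natr -[t ^+ 2 *+ 2]mulr_natr; field.
  by rewrite (gt_eqF s0) (gt_eqF t0).
rewrite ge0_integralZl//.
- by rewrite integral_normal_pdf mule1.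
- by apply/measurable_EFinP; exact: measurable_normal_pdf.
- by move=> x _; rewrite lee_fin normal_pdf_ge0.
- by rewrite lee_fin divr_ge0 ?ltW.
Qed.

(** Completing the square makes this the tilt of centre b/r^2 and deviation 1/r. All later Gaussian
    moments and exponential moments come from this formula. *)
Lemma integral_normal_quadratic r b : 0 < r ->
  (\int[normal_prob 0 1]_x (expR (b * x - (r ^+ 2 - 1) / 2 * x ^+ 2))%:E =
   (expR (b ^+ 2 / (2 * r ^+ 2)) / r)%:E)%E.
Proof.
move=> r0.
have := @integral_normal_tilt 0 1 (b / r ^+ 2) r^-1 ltr01; rewrite invr_gt0 => /(_ r0).
rewrite divr1 => tilt; rewrite EFinM -tilt -ge0_integralZl; last 4 first.
- by [].
- apply/measurable_EFinP/measurableT_comp => //; apply: measurable_funB;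
    apply: measurable_funM => //; by apply: measurable_funX; exact: measurable_funB.
- by move=> x _; rewrite lee_fin expR_ge0.
- by rewrite lee_fin expR_ge0.
apply: eq_integral => x _; rewrite -EFinM -expRD; congr (expR _)%:E.
by field; rewrite gt_eqF.
Qed.

(** With E the second moment, integrating 1 + z <= exp z against the known Gaussian integral gives 1
    - (r^2 - 1)/2 * E <= 1/r for all r > 0. Both sides equal 1 at r = 1, so the slopes there must
    agree, which forces E = 1. *)
Lemma normal_standard_sqr :
  has_mean (normal_prob 0 1) (fun x : R => x ^+ 2) /\
  mean (normal_prob 0 1) (fun x : R => x ^+ 2) = 1.
Proof.
pose N : probability _ R := normal_prob 0 1.
have G r : 0 < r -> has_mean N (fun x => expR (- ((r ^+ 2 - 1) / 2 * x ^+ 2))) /\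
    mean N (fun x => expR (- ((r ^+ 2 - 1) / 2 * x ^+ 2))) = r^-1.
  move=> r0; apply: has_mean_ge0 => [|x|]; last 2 first.
  - exact: expR_ge0.
  - have := @integral_normal_quadratic r 0 r0.
    rewrite expr0n/= mul0r expR0 mul1r => <-.
    by apply: eq_integral => x _; rewrite mul0r sub0r.
  by apply: measurableT_comp => //; apply: measurable_funN; exact: measurable_funM.
have lin r x : 1 - (r ^+ 2 - 1) / 2 * x ^+ 2 <= expR (- ((r ^+ 2 - 1) / 2 * x ^+ 2)).
  exact: expR_ge1Dx.
have L : has_mean N (fun x => x ^+ 2).
  (* At r = 1/2 the exponent is 3/8 x^2, hence the domination x^2 <= 8/3 exp(3/8 x^2). *)
  have [L _] := G 2^-1 (ltac:(by rewrite invr_gt0)).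
  apply: (has_mean_dom _ _ (has_meanZ (8 / 3) L)); first by [].
  move=> x; rewrite ger0_norm ?sqr_ge0//.
  have := lin 2^-1 x; set e := expR _.
  by have := sqr_ge0 x; lra.
split=> //; set E := mean _ _.
have E0 : 0 <= E by apply: mean_ge0 => x; exact: sqr_ge0.
have key r : 0 < r -> 1 - (r ^+ 2 - 1) / 2 * E <= r^-1.
  move=> r0; have [Lr <-] := G r r0.
  have LZ := has_meanZ ((r ^+ 2 - 1) / 2) L.
  have -> : 1 - (r ^+ 2 - 1) / 2 * E = mean N (fun x => 1 - (r ^+ 2 - 1) / 2 * x ^+ 2).
    by rewrite meanB// ?mean_cst ?meanZ//; exact: has_mean_cst.
  by apply: le_mean => //; apply: has_meanB => //; exact: has_mean_cst.
have key' r : 0 < r -> 0 <= (r - 1) * ((r + 1) * r * E - 2).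
  move=> r0; have := key r r0; rewrite -(ler_pM2l r0) divff ?gt_eqF//.
  by nra.
apply/eqP; rewrite eq_le; apply/andP; split; rewrite leNgt; apply/negP => E1.
- have Ep : 0 < E by lra.
  (* A point below 1 with r^2 E > 1, by the inequality E + 1/E > 2; the point 2/(1 + E) in the other
     case lies above 1 and has r^2 E < 1. *)
  pose r := (1 + E^-1) / 2.
  have iE : E^-1 < 1 by rewrite invf_lt1.
  have iE0 : 0 < E^-1 by rewrite invr_gt0.
  have r0 : 0 < r by rewrite /r; lra.
  have r1 : r < 1 by rewrite /r; lra.
  have := key' r r0; rewrite nmulr_rge0; last by lra.
  have : 1 < r ^+ 2 * E.
    have -> : r ^+ 2 * E = (E + 2 + E^-1) / 4 by rewrite /r; field; rewrite gt_eqF.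
    have : 0 < (E - 1) ^+ 2 * E^-1 by rewrite mulr_gt0// exprn_gt0//; lra.
    have -> : (E - 1) ^+ 2 * E^-1 = E - 2 + E^-1 by field; rewrite gt_eqF.
    by lra.
  have : r ^+ 2 * E <= r * E by rewrite ler_wpM2r// expr2; nra.
  by nra.
- pose r := 2 / (1 + E).
  have r1 : 1 < r by rewrite /r ltr_pdivlMr; lra.
  have r0 : 0 < r by lra.
  have := key' r r0; rewrite pmulr_rge0; last by lra.
  have : r ^+ 2 * E < 1.
    have -> : r ^+ 2 * E = 4 * E / (1 + E) ^+ 2 by rewrite /r; field; lra.
    rewrite ltr_pdivrMr; last by rewrite exprn_gt0//; lra.
    have : 0 < (1 - E) ^+ 2 by rewrite exprn_gt0//; lra.
    by nra.
  have : r * E <= r ^+ 2 * E by rewrite ler_wpM2r// expr2; nra.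
  by nra.
Qed.

(** The same device with a linear exponent: 1 + b E <= exp(b^2/2), hence b E <= b^2 for |b| <= 1,
    and a small b of the sign of E contradicts E <> 0. *)
Lemma normal_standard_id :
  has_mean (normal_prob 0 1) (fun x : R => x) /\ mean (normal_prob 0 1) (fun x : R => x) = 0.
Proof.
pose N : probability _ R := normal_prob 0 1.
have L : has_mean N (fun x => x).
  by apply: has_mean_sqr => //; exact: normal_standard_sqr.1.
split=> //; set E := mean _ _.
have key b : 1 + b * E <= expR (b ^+ 2 / 2).
  have [LG EG] : has_mean N (fun x => expR (b * x)) /\ mean N (fun x => expR (b * x)) = expR (b ^+ 2 / 2).
    apply: has_mean_ge0 => [|x|]; last 2 first.
    - exact: expR_ge0.
    - have := @integral_normal_quadratic 1 b ltr01.
      rewrite expr1n mulr1 divr1 => <-; apply: eq_integral => x _.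
      by rewrite subrr !mul0r subr0.
    by apply: measurableT_comp => //; exact: measurable_funM.
  rewrite -EG; have -> : 1 + b * E = mean N (fun x => 1 + b * x).
    by rewrite meanD ?mean_cst ?meanZ//; [exact: has_mean_cst|exact: has_meanZ].
  apply: le_mean => // [|x]; last exact: expR_ge1Dx.
  by apply: has_meanD; [exact: has_mean_cst|exact: has_meanZ].
have bound b : `|b| <= 1 -> b * E <= b ^+ 2.
  move=> b1; have {key} := key b.
  have b2 : b ^+ 2 <= 1 by rewrite -[b ^+ 2]real_normK ?num_real// expr_le1.
  have := expR_ge1Dx (- (b ^+ 2 / 2)); rewrite expRN.
  have e0 := expR_gt0 (b ^+ 2 / 2).
  rewrite -(ler_pM2r e0) mulVf ?gt_eqF//; have := sqr_ge0 b.
  by nra.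
apply/eqP; rewrite eq_le; apply/andP; split; rewrite leNgt; apply/negP => E1.
- have := bound (Num.min 1 (E / 2)); have [h|h] := leP 1 (E / 2).
    by rewrite normr1 => /(_ (lexx _)); lra.
  by rewrite gtr0_norm; [move=> /(_ (ltW h)); nra|lra].
- have := bound (Num.max (-1) (E / 2)); have [h|h] := leP (E / 2) (-1).
    by rewrite normrN1 => /(_ (lexx _)); lra.
  by rewrite ltr0_norm; [move=> /(_ (ltac:(lra))); nra|lra].
Qed.

End normal.

(** * Divergence between Gaussian laws of equal mean *)

Section normal_KL.
Context (R : realType).
Implicit Types (m s x : R) (F : R -> R).

Lemma normal_sqr_dist m s : 0 < s ->
  has_mean (normal_prob m s) (fun x => (x - m) ^+ 2) /\
  mean (normal_prob m s) (fun x => (x - m) ^+ 2) = s ^+ 2.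
Proof.
move=> s0; have [L2 E2] := normal_standard_sqr R.
have mf : measurable_fun setT (fun x : R => (x - m) ^+ 2).
  by apply: measurable_funX; exact: measurable_funB.
apply: has_mean_ge0 => //; first by move=> x; exact: sqr_ge0.
rewrite ge0_integral_normal_standard//; last by move=> x; exact: sqr_ge0.
transitivity (\int[normal_prob 0 1]_x (s ^+ 2 * x ^+ 2)%:E)%E; last first.
  by rewrite meanE ?meanZ// ?E2 ?mulr1//; exact: has_meanZ.
apply: eq_integral => x _; rewrite -exprMn; congr ((_ ^+ 2)%:E).
by ring.
Qed.

Lemma normal_pdf_ratio m s s' x : 0 < s -> 0 < s' ->
  s' / s * expR ((x - m) ^+ 2 / (2 * s' ^+ 2) - (x - m) ^+ 2 / (2 * s ^+ 2)) *
  normal_pdf m s' x = normal_pdf m s x.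
Proof.
move=> s0 s'0; rewrite !normal_pdfE ?gt_eqF// !normal_peakE// /normal_fun expRD !expRN !mulNr !expRN.
rewrite -[s ^+ 2 *+ 2]mulr_natl -[s' ^+ 2 *+ 2]mulr_natl.
set a := expR _; set b := expR _; set p := Num.sqrt _.
have p0 : p != 0 by rewrite gt_eqF// sqrtr_gt0 mulrn_wgt0// pi_gt0.
by field; rewrite p0 !gt_eqF ?expR_gt0.
Qed.

(** [KL] integrates a density picked by [xget]; two densities of the same law agree almost
    everywhere, so the explicit ratio [f] of Gaussian densities can replace it. *)
Lemma KL_normal (q : set (measurableTypeR R) -> \bar R) m s s' : 0 < s -> 0 < s' ->
  (forall A, measurable A -> q A = normal_prob m s A) ->
  KL q (normal_prob m s') = (psi s' s)%:E.
Proof.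
move=> s0 s'0 qE; pose N : probability _ R := normal_prob m s'.
pose f x := s' / s * expR ((x - m) ^+ 2 / (2 * s' ^+ 2) - (x - m) ^+ 2 / (2 * s ^+ 2)).
have f0 x : 0 <= f x by rewrite mulr_ge0 ?expR_ge0// divr_ge0// ltW.
have mf : measurable_fun setT f.
  apply: measurable_funM => //; apply: measurableT_comp => //.
  by apply: measurable_funB; apply: measurable_funM => //; apply: measurable_funX;
    exact: measurable_funB.
have change F : measurable_fun setT F -> (forall x, 0 <= F x) ->
    (\int[N]_x (f x * F x)%:E = \int[normal_prob m s]_x (F x)%:E)%E.
  move=> mF F0; rewrite (ge0_integral_normal m s mF F0) ge0_integral_normal.
  - by apply: eq_integral => x _; rewrite mulrAC (normal_pdf_ratio m x s0 s'0) mulrC.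
  - exact: measurable_funM.
  - by move=> x; rewrite mulr_ge0.
have fD : is_density q (normal_prob m s') f.
  split; [exact: mf|exact: f0|move=> A mA].
  transitivity (\int[N]_x (f x * \1_A x)%:E)%E.
    rewrite change; [|exact: measurable_indic|by move=> x; rewrite indicE].
    by rewrite integral_indic// setIT; exact: qE.
  rewrite [RHS]integral_mkcond; apply: eq_integral => x _; rewrite patchE indicE.
  by case: ifP; rewrite ?mulr1 ?mulr0.
rewrite /KL; case: pselect => [ex|/(_ (ex_intro _ f fD))//]; cbv zeta.
set g := xget _ _.
have [mg g0 gE] : is_density q (normal_prob m s') g.
  by apply: (@xgetPex _ (fun _ => 0) [set f | is_density q (normal_prob m s') f]).
have [Lf Ef] : has_mean N f /\ mean N f = 1.
  apply: has_mean_ge0 => //.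
  transitivity (\int[N]_x (f x * (cst 1 x))%:E)%E; first by apply: eq_integral => x _; rewrite mulr1.
  transitivity (\int[normal_prob m s]_x (cst 1%:E x))%E.
    by apply: (change (cst 1)) => // x; exact: ler01.
  by rewrite integral_cst// mul1e; exact: probability_setT.
have fg : ae_eq N setT (EFin \o f) (EFin \o g).
  apply: integral_ae_eq => //; first exact/measurable_EFinP.
  move=> A _ mA; have [_ _ fE] := fD.
  by transitivity (q A); [apply/esym; exact: fE|exact: gE].
transitivity (\int[N]_x (f x * ln (f x))%:E)%E.
  apply: ae_eq_integral => //.
  - apply/measurable_EFinP; apply: measurable_funM => //.
    by apply: measurableT_comp => //; exact: measurable_ln.
  - apply/measurable_EFinP; apply: measurable_funM => //.
    by apply: measurableT_comp => //; exact: measurable_ln.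
  - by apply: filterS fg => x /= /(_ I) [->].
have [LS ES] : has_mean N (fun x => f x * (x - m) ^+ 2) /\ mean N (fun x => f x * (x - m) ^+ 2) = s ^+ 2.
  have msq : measurable_fun setT (fun x : R => (x - m) ^+ 2).
    by apply: measurable_funX; exact: measurable_funB.
  have [LX EX] := normal_sqr_dist m s0.
  apply: has_mean_ge0; first exact: measurable_funM.
    by move=> x; rewrite mulr_ge0// sqr_ge0.
  by rewrite change// ?meanE ?EX// => x; exact: sqr_ge0.
pose a := ln (s' / s); pose b := (2 * s' ^+ 2)^-1 - (2 * s ^+ 2)^-1.
have E x : f x * ln (f x) = a * f x + b * (f x * (x - m) ^+ 2).
  by rewrite {2}/f lnM ?posrE ?divr_gt0 ?expR_gt0// expRK /a /b; ring.
under eq_integral do rewrite E.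
have La := has_meanZ a Lf; have Lb := has_meanZ b LS.
etransitivity; first exact: (meanE (has_meanD La Lb)).
have EM : mean N (fun x => a * f x + b * (f x * (x - m) ^+ 2)) = a * 1 + b * s ^+ 2.
  by rewrite (meanD La Lb) (meanZ a Lf) (meanZ b LS) Ef ES.
rewrite EM /psi /a /b mulr1; congr (_ + _)%:E.
by field; rewrite !gt_eqF.
Qed.

End normal_KL.

(** * The function psi *)

Section psi.
Context (R : realType).
Variables (sX : R) (sX0 : 0 < sX).
Implicit Types (s P : R).

Lemma psi_sX : psi sX sX = 0.
Proof. by rewrite /psi divff ?gt_eqF// ln1 subrr mul0r addr0. Qed.

(** Exponential form of [psi]; it converts the factor exp(s^2/sX^2 - 1) that [ge_entropy_power]
    produces into the exponent of [Dlower_obj]. *)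
Lemma expR_psi s : 0 < s ->
  s ^+ 2 * expR (2 * psi sX s) = sX ^+ 2 * expR (s ^+ 2 / sX ^+ 2 - 1).
Proof.
move=> s0; rewrite /psi mulrDr expRD.
have -> : expR (2 * ln (sX / s)) = (sX / s) ^+ 2.
  by rewrite mulr_natl mulr2n expRD lnK ?posrE ?divr_gt0.
rewrite mulrA exprMn exprVn mulrCA divff ?mulr1 ?expf_neq0 ?gt_eqF//.
by congr (_ * expR _); field; rewrite gt_eqF.
Qed.

(** Once [sX] is replaced by [s'] in the denominator, the claim is (1 - r^2)/2 < - ln r for r = s/s'
    < 1. It follows from ln r <= r - 1, with a gap of (1 - r)^2/2. *)
Lemma psi_decreasing s s' : 0 < s -> s < s' -> s' <= sX -> psi sX s' < psi sX s.
Proof.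
move=> s0 ss' s'X; have s'0 : 0 < s' by exact: lt_trans ss'.
rewrite -subr_gt0.
have E : psi sX s - psi sX s' = ln (s' / s) - (s' ^+ 2 - s ^+ 2) / (2 * sX ^+ 2).
  by rewrite /psi !ln_div ?posrE//; field; rewrite gt_eqF.
rewrite E subr_gt0.
have s2 : 0 < s' ^+ 2 - s ^+ 2 by rewrite subr_gt0 ltr_pXn2r// ?nnegrE ltW.
apply: (@le_lt_trans _ _ ((s' ^+ 2 - s ^+ 2) / (2 * s' ^+ 2))).
  rewrite ler_pM2l// lef_pV2 ?posrE ?mulr_gt0 ?exprn_gt0//.
  by rewrite ler_pM2l// lerXn2r// nnegrE ltW.
pose r := s / s'.
have r0 : 0 < r by rewrite divr_gt0.
have r1 : r < 1 by rewrite ltr_pdivrMr// mul1r.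
have -> : (s' ^+ 2 - s ^+ 2) / (2 * s' ^+ 2) = (1 - r ^+ 2) / 2.
  by rewrite /r; field; rewrite gt_eqF.
have -> : ln (s' / s) = - ln r by rewrite /r !ln_div ?posrE// opprB.
have r1' : -1 < r - 1 by lra.
have := le_ln1Dx r1'; rewrite addrCA subrr addr0.
by nra.
Qed.

Lemma sigmaP_spec P : 0 <= P -> 0 < sigmaP sX P <= sX /\ psi sX (sigmaP sX P) = P.
Proof.
move=> P0; apply: (@xgetPex _ 0 [set s | 0 < s <= sX /\ psi sX s = P]).
(* Here the logarithm in [psi] equals P + 1 and its quadratic part is at least -1/2, so [psi]
   exceeds P at the left end of the interval. *)
pose a := sX * expR (- (P + 1)).
have a0 : 0 < a by rewrite mulr_gt0 ?expR_gt0.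
have aX : a <= sX by rewrite ler_piMr ?(ltW sX0)// -[leRHS]expR0 ler_expR; lra.
have Pa : P <= psi sX a.
  rewrite /psi /a invfM -expRN opprK mulrA divff ?gt_eqF// mul1r expRK.
  have -> : ((sX * expR (- (P + 1))) ^+ 2 - sX ^+ 2) / (2 * sX ^+ 2) =
    (expR (- (P + 1)) ^+ 2 - 1) / 2 by field; rewrite gt_eqF.
  by have := sqr_ge0 (expR (- (P + 1))); lra.
have cpsi : {within `[a, sX], continuous (psi sX)}.
  apply: continuous_in_subspaceT => x; rewrite inE/= in_itv/= => /andP[ax _].
  have x0 : 0 < x by exact: lt_le_trans ax.
  apply: (@continuousD R R^o R (fun s => ln (sX / s)) (fun s => (s ^+ 2 - sX ^+ 2) / (2 * sX ^+ 2))).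
    apply: (@continuous_comp _ _ _ (fun s => sX / s) (@ln R)).
      by apply: (@continuousM _ _ (fun=> sX)); [exact: cvg_cst|apply: continuousV => //; rewrite gt_eqF].
    by apply: continuous_ln; rewrite divr_gt0.
  apply: (@continuousM _ _ (fun s => s ^+ 2 - sX ^+ 2)); last exact: cvg_cst.
  apply: (@continuousB R R^o R (fun s => s ^+ 2)); last exact: cvg_cst.
  exact: exprn_continuous.
have [|c] := @IVT R (psi sX) a sX P aX cpsi.
  by rewrite psi_sX (min_idPr _) ?(max_idPl _)//; [rewrite P0|exact: le_trans Pa..].
by rewrite in_itv/= => /andP[ac cX] cP; exists c; rewrite (lt_le_trans a0 ac).
Qed.

Lemma psi_le_sigmaP P s : 0 <= P -> 0 < s -> s <= sX -> psi sX s <= P -> sigmaP sX P <= s.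
Proof.
move=> P0 s0 sX' psP; have [/andP[g0 gX] gP] := sigmaP_spec P0.
rewrite leNgt; apply/negP => /(psi_decreasing s0)/(_ gX); rewrite gP.
by move=> /lt_le_trans/(_ psP); rewrite ltxx.
Qed.

Lemma sigmaP_le_psi P s : 0 <= P -> sigmaP sX P <= s -> s <= sX -> psi sX s <= P.
Proof.
move=> P0; have [/andP[g0 gX] gP] := sigmaP_spec P0.
rewrite le_eqVlt => /predU1P[<- _|gs sX']; first by rewrite gP.
by rewrite -[leRHS]gP ltW// psi_decreasing.
Qed.

(** The hypothesis holds for every test deviation t; the best choice is t^2 = V, where it reads as a
    lower bound on ln V. *)
Lemma ge_entropy_power (V w L : R) : 0 <= V -> 0 <= w ->
  (forall t, 0 < t -> w / (2 * sX ^+ 2) - V / (2 * t ^+ 2) <= L + ln (t / sX)) ->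
  sX ^+ 2 * expR (w / sX ^+ 2 - 1 - 2 * L) <= V.
Proof.
move=> V0 w0 H.
have Vp : 0 < V.
  rewrite lt_neqAle V0 andbT eq_sym; apply/negP => /eqP V00.
  (* This t makes the right side equal to -1, while the left side is nonnegative when V = 0. *)
  have := H (sX * expR (- L - 1)); rewrite V00 mul0r subr0 => /(_ (mulr_gt0 sX0 (expR_gt0 _))).
  rewrite mulrAC divff ?gt_eqF// mul1r expRK.
  have : 0 <= w / (2 * sX ^+ 2) by rewrite divr_ge0// mulr_ge0// sqr_ge0.
  by lra.
have sV : 0 < Num.sqrt V by rewrite sqrtr_gt0.
have := H _ sV; rewrite sqr_sqrtr//.
have -> : V / (2 * V) = 1 / 2 by field; rewrite gt_eqF.
have -> : w / (2 * sX ^+ 2) = w / sX ^+ 2 / 2 by field; rewrite gt_eqF.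
move=> {}H.
have {}H : w / sX ^+ 2 - 1 - 2 * L <= 2 * ln (Num.sqrt V / sX) by lra.
rewrite -ler_expR in H.
have E : expR (2 * ln (Num.sqrt V / sX)) = V / sX ^+ 2.
  rewrite mulr_natl mulr2n expRD lnK ?posrE ?divr_gt0//.
  by rewrite -expr2 exprMn sqr_sqrtr// exprVn.
by rewrite mulrC -ler_pdivlMr ?exprn_gt0// -E.
Qed.

Lemma le_sqrt_prod (C a b A B s : R) : 0 < s -> 0 <= a -> 0 <= b ->
  C ^+ 2 <= a * b -> a <= sX ^+ 2 * A -> b <= s ^+ 2 * B ->
  C <= sX * s * Num.sqrt (A * B).
Proof.
move=> s0 a0 b0 Cab aA bB.
have AB : C ^+ 2 <= (sX * s) ^+ 2 * (A * B).
  apply: (le_trans Cab); apply: (le_trans (ler_pM a0 b0 aA bB)).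
  by rewrite le_eqVlt; apply/orP; left; apply/eqP; ring.
have AB0 : 0 <= A * B.
  by rewrite -(pmulr_rge0 _ (exprn_gt0 2 (mulr_gt0 sX0 s0))) (le_trans (sqr_ge0 C)).
rewrite (le_trans (ler_norm C))// -sqrtr_sqr.
have -> : sX * s * Num.sqrt (A * B) = Num.sqrt ((sX * s) ^+ 2 * (A * B)).
  by rewrite (sqrtrM (A * B) (sqr_ge0 (sX * s))) sqrtr_sqr gtr0_norm// mulr_gt0.
by rewrite ler_wsqrtr.
Qed.

(** The part of the lower bound that concerns real numbers only. [VX] and [VY] are the mean
    conditional variances given the cells, [w] is the second moment of Xhat about the mean of X, so
    that a bias of Xhat is included, and [C] is the mean product of the deviations. The witness is s
    = sqrt w if this does not exceed [sX], and [sX] otherwise. *)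
Lemma Dlower_obj_le (Rr Rc P VX VY w C D : R) : 0 <= Rr -> 0 <= Rc -> 0 <= P ->
  0 <= w -> 0 <= VX <= sX ^+ 2 -> 0 <= VY <= w ->
  (forall t, 0 < t -> 2^-1 - VX / (2 * t ^+ 2) <= Rr + ln (t / sX)) ->
  (forall t, 0 < t -> w / (2 * sX ^+ 2) - VY / (2 * t ^+ 2) <= Rr + Rc + P + ln (t / sX)) ->
  (forall t, 0 < t -> w / (2 * sX ^+ 2) - w / (2 * t ^+ 2) <= P + ln (t / sX)) ->
  C ^+ 2 <= (sX ^+ 2 - VX) * (w - VY) -> sX ^+ 2 + w - 2 * C <= D ->
  exists2 s, s \in `[sigmaP sX P, sX] & Dlower_obj sX Rr Rc P s <= D.
Proof.
move=> R0 Rc0 P0 w0 /andP[VX0 VXX] /andP[VY0 VYw] HX HY Hw CC CD.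
have sX2 : 0 < sX ^+ 2 by rewrite exprn_gt0.
have BX : sX ^+ 2 * expR (- (2 * Rr)) <= VX.
  have := @ge_entropy_power VX (sX ^+ 2) Rr VX0 (ltW sX2).
  rewrite divff ?gt_eqF// subrr sub0r; apply => t t0.
  have -> : sX ^+ 2 / (2 * sX ^+ 2) = 2^-1 by field; rewrite gt_eqF.
  exact: HX.
have BY := ge_entropy_power VY0 w0 HY.
have Bw := ge_entropy_power w0 w0 Hw.
have wp : 0 < w by rewrite (lt_le_trans _ Bw)// mulr_gt0 ?expR_gt0.
pose s := Num.sqrt w.
have s0 : 0 < s by rewrite sqrtr_gt0.
have s2 : s ^+ 2 = w by rewrite sqr_sqrtr.
have psiP : psi sX s <= P.
  have : 2 * psi sX s <= 2 * P; last by lra.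
  rewrite -ler_expR -(ler_pM2l wp) -{1}s2 expR_psi// s2.
  have -> : expR (w / sX ^+ 2 - 1) = expR (w / sX ^+ 2 - 1 - 2 * P) * expR (2 * P).
    by rewrite -expRD subrK.
  by rewrite mulrA ler_pM2r ?expR_gt0.
have aA : sX ^+ 2 - VX <= sX ^+ 2 * (1 - expR (- (2 * Rr))) by rewrite mulrBr mulr1; lra.
have [sX'|sX'] := leP s sX.
  exists s; first by rewrite in_itv/= psi_le_sigmaP.
  apply: le_trans CD; rewrite /Dlower_obj s2 lerD2l lerN2 -!mulrA ler_pM2l// mulrA.
  apply: (le_sqrt_prod s0 _ _ CC aA); [by rewrite subr_ge0..|].
  rewrite mulrBr mulr1 s2 lerD2l lerN2; apply: le_trans BY.
  have -> : - (2 * (Rr + Rc + P - psi sX s)) = 2 * psi sX s + - (2 * (Rr + Rc + P)) by ring.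
  by rewrite expRD mulrA -{1}s2 expR_psi// s2 -mulrA -expRD.
(* Here s > sX lies outside the interval. The inequality exp(z - 1) >= z weakens [BY] to VY >= w
   exp(-2(Rr + Rc + P)), which is the factor of the objective at [sX], where [psi] vanishes. *)
exists sX; first by rewrite in_itv/= lexx andbT; have [/andP[]] := sigmaP_spec P0.
rewrite /Dlower_obj psi_sX subr0.
set A := 1 - expR (- (2 * Rr)) in aA *; set b := expR (- (2 * (Rr + Rc + P))).
have A01 : 0 <= A <= 1.
  have := expR_gt0 (- (2 * Rr)); have : expR (- (2 * Rr)) <= 1.
    by rewrite -[leRHS]expR0 ler_expR; lra.
  by rewrite /A; lra.
have B01 : 0 <= 1 - b <= 1.
  have := expR_gt0 (- (2 * (Rr + Rc + P))); have : b <= 1.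
    by rewrite -[leRHS]expR0 ler_expR; lra.
  by rewrite /b; lra.
have bB : w - VY <= s ^+ 2 * (1 - b).
  rewrite mulrBr mulr1 s2 lerD2l lerN2; apply: le_trans BY.
  rewrite expRD -/b mulrA ler_pM2r ?expR_gt0//.
  have := expR_ge1Dx (w / sX ^+ 2 - 1); rewrite addrCA subrr addr0.
  by rewrite ler_pdivrMr// mulrC.
have CA : C <= sX * s * Num.sqrt (A * (1 - b)).
  by apply: (le_sqrt_prod s0 _ _ CC aA bB); rewrite subr_ge0.
apply: le_trans CD; set q := Num.sqrt _ in CA *.
have q0 : 0 <= q by exact: sqrtr_ge0.
have q1 : q <= 1.
  by rewrite -[leRHS]sqrtr1 ler_wsqrtr//; case/andP: A01 => A0 A1; case/andP: B01 => B0 B1; rewrite -[leRHS]mulr1 ler_pM.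
rewrite -s2.
(* Difference of s^2 - 2 sX s q at s and at [sX]: since q <= 1, this quadratic increases beyond
   [sX]. *)
have : 0 <= (s - sX) * (s + sX - 2 * sX * q).
  have : 0 <= sX * (1 - q) by rewrite mulr_ge0 ?(ltW sX0)// subr_ge0.
  by move=> h; apply: mulr_ge0; lra.
by lra.
Qed.

End psi.

(** * Lower bound *)

Section change_of_density.
Context d (T : measurableType d) (R : realType) (N : probability (measurableTypeR R) R) (X : T -> R).
Variables (Q : probability T R) (g : R -> R).
Hypotheses (mX : measurable_fun setT X) (mg : measurable_fun setT g) (g0 : forall x, 0 <= g x).
Hypothesis gE : forall A : set R, measurable A -> Q (X @^-1` A) = (\int[N]_(x in A) (g x)%:E)%E.

Lemma ge0_integral_law_density (F : R -> R) :
  measurable_fun setT F -> (forall x, 0 <= F x) ->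
  (\int[Q]_w (F (X w))%:E = \int[N]_x (g x * F x)%:E)%E.
Proof.
move=> mF F0; have F0' x : (0 <= (F x)%:E)%E by rewrite lee_fin.
have mF' : measurable_fun setT (EFin \o F) by exact/measurable_EFinP.
have mX' : measurable_fun setT (X : T -> measurableTypeR R) := mX.
transitivity (\int[image_measure Q mX']_x (F x)%:E)%E.
  by apply/esym; exact: (ge0_integral_image_measure Q mX').
transitivity (\int[density_measure N mg g0]_x (F x)%:E)%E.
  by apply: eq_measure_integral => A mA _; exact: gE.
transitivity (\int[N]_x ((g x)%:E * (F x)%:E))%E; last by [].
exact: ge0_integral_density.
Qed.

Lemma mean_law_density (F : R -> R) : measurable_fun setT F ->
  has_mean N (fun x => g x * F x) ->
  has_mean Q (fun w => F (X w)) /\ mean Q (fun w => F (X w)) = mean N (fun x => g x * F x).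
Proof.
move=> mF LF.
pose p (x : R) := Num.max x 0; pose q (x : R) := Num.max (- x) 0.
have pq x : x = p x - q x.
  by rewrite /p /q; case: (leP x 0) => x0; case: (leP (- x) 0); lra.
have p0 x : 0 <= p x by rewrite le_max lexx orbT.
have q0 x : 0 <= q x by rewrite le_max lexx orbT.
have mp : measurable_fun setT p by exact: measurable_maxr.
have mq : measurable_fun setT q by apply: measurable_maxr => //; exact: measurable_funN.
have pa x : `|p x| <= `|x| by rewrite ger0_norm// /p ge_max ler_norm normr_ge0.
have qa x : `|q x| <= `|x| by rewrite ger0_norm// /q ge_max normr_ge0 -normrN ler_norm.
have key (r : R -> R) : measurable_fun setT r -> (forall x, 0 <= r x) -> (forall x, `|r x| <= `|x|) ->
    has_mean N (fun x => g x * r (F x)) /\ has_mean Q (fun w => r (F (X w))) /\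
    mean Q (fun w => r (F (X w))) = mean N (fun x => g x * r (F x)).
  move=> mr r0 ra; have mrF : measurable_fun setT (r \o F) by exact: measurableT_comp.
  have L : has_mean N (fun x => g x * r (F x)).
    apply: (has_mean_dom _ _ (has_mean_norm LF)); first exact: measurable_funM.
    by move=> x; rewrite !normrM ler_wpM2l.
  split=> //; apply: has_mean_ge0.
  - exact: (measurableT_comp mrF mX).
  - by move=> w; exact: r0.
  - apply: eq_trans (meanE L).
    by apply: (ge0_integral_law_density (F := r \o F)) => // x; exact: r0.
have [Lp [Qp Ep]] := key p mp p0 pa.
have [Lq [Qq Eq]] := key q mq q0 qa.
have E w : F (X w) = p (F (X w)) - q (F (X w)) by exact: pq.
split; first by apply: (eq_has_mean _ (has_meanB Qp Qq)) => w; rewrite -E.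
rewrite (eq_mean _ E) meanB// Ep Eq -meanB//.
by apply: eq_mean => x; rewrite -mulrBr -pq.
Qed.

End change_of_density.

(** * Mean squared deviations on the cells of a partition *)

Section converse.
Context d (T : measurableType d) (R : realType) (Q : probability T R).
Variables (n : nat) (X : 'I_n -> T -> R) (mu s : R) (g : R -> R).
Variables (W : finType) (E F : W -> set T) (c : W -> R) (M w2 kl : R) (a : W -> 'I_n -> R).
Let N : probability (measurableTypeR R) R := normal_prob mu s.
Hypotheses (n0 : (0 < n)%N) (s0 : 0 < s) (M0 : 0 < M).
Hypothesis mX : forall t, measurable_fun setT (X t).
Hypotheses (mg : measurable_fun setT g) (g0 : forall x, 0 <= g x).
Hypothesis gE : forall t (A : set R), measurable A ->
  Q (X t @^-1` A) = (\int[N]_(x in A) (g x)%:E)%E.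
Hypotheses (mE : forall i, measurable (E i)) (mF : forall i, measurable (F i)).
Hypotheses (EF : forall i, E i `<=` F i) (E1 : forall w, \sum_i \1_(E i) w = 1 :> R).
Hypotheses (c0 : forall i, 0 <= c i) (cM : \sum_i c i <= M).
Hypothesis FX : forall i (A : 'I_n -> set R), (forall t, measurable (A t)) ->
  Q (F i `&` [set w | forall t, A t (X t w)]) = ((c i)%:E * \prod_t Q (X t @^-1` A t))%E.
Hypotheses (L2 : forall t, has_mean Q (fun w => (X t w - mu) ^+ 2)).
Hypotheses (E2 : forall t, mean Q (fun w => (X t w - mu) ^+ 2) = w2).
Hypotheses (Lkl : has_mean N (fun x => g x * ln (g x))).
Hypothesis Ekl : mean N (fun x => g x * ln (g x)) = kl.

(** The centres [a i t] are left free: they will be conditional means, or the constant [mu] when the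
    only cell is the whole space. *)
Definition mean_sqr_dev : R :=
  n%:R^-1 * \sum_t \sum_i mean Q (fun w => \1_(E i) w * (X t w - a i t) ^+ 2).

Let L2a t b : has_mean Q (fun w => (X t w - b) ^+ 2).
Proof.
have mXm : measurable_fun setT (fun w => X t w - mu) by exact: measurable_funB.
apply: (eq_has_mean _ (has_mean_sqrD mXm (measurable_cst (mu - b)) (L2 t) (has_mean_cst Q ((mu - b) ^+ 2)))).
by move=> w; congr (_ ^+ 2); rewrite /=; ring.
Qed.

(* Jensen's inequality on each cell, for the logarithm of the density of N(a, t^2) with respect
   to the law of the X's; conditioning on a cell multiplies probabilities by at most [c]. *)
Lemma mean_sqr_dev_converse t : 0 < t ->
  w2 / (2 * s ^+ 2) - mean_sqr_dev / (2 * t ^+ 2) <= ln M / n%:R + kl + ln (t / s).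
Proof.
move=> t0; have nR : 0 < n%:R :> R by rewrite ltr0n.
(* Up to the constant ln(t/s), the logarithm of the density of N(a, t^2) with respect to the law of
   X: a Gaussian tilt divided by [g]. *)
pose phi i k x := (x - mu) ^+ 2 / (2 * s ^+ 2) - (x - a i k) ^+ 2 / (2 * t ^+ 2) - ln (g x).
have msq b : measurable_fun setT (fun x : R => (x - b) ^+ 2).
  by apply: measurable_funX; exact: measurable_funB.
have mlng : measurable_fun setT (fun x => ln (g x)).
  by apply: measurableT_comp => //; exact: measurable_ln.
have mphi i k : measurable_fun setT (phi i k).
  apply: measurable_funB => //.
  by apply: measurable_funB; exact: measurable_funM.
have mtilt i k : measurable_fun setT (fun x : R =>
    expR ((x - mu) ^+ 2 / (2 * s ^+ 2) - (x - a i k) ^+ 2 / (2 * t ^+ 2))).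
  by apply: measurableT_comp => //; apply: measurable_funB; exact: measurable_funM.
have mephi i k : measurable_fun setT (fun x => expR (phi i k x)) by exact: measurableT_comp.
have ts0 : 0 < t / s by rewrite divr_gt0.
have [v vE] : {v : W -> 'I_n -> R | forall i k,
    (\int[image_measure Q (mX k)]_x (expR (phi i k x))%:E = (v i k)%:E)%E /\
    0 <= v i k <= t / s}.
  suff H i k : exists vk : R,
    (\int[image_measure Q (mX k)]_x (expR (phi i k x))%:E = vk%:E)%E /\ 0 <= vk <= t / s.
    have [v vE] := boolp.choice (fun ik : W * 'I_n => H ik.1 ik.2).
    by exists (fun i k => v (i, k)) => i k; exact: (vE (i, k)).
  have I0 : (0 <= \int[N]_x (g x * expR (phi i k x))%:E)%E.
    by apply: integral_ge0 => x _; rewrite lee_fin mulr_ge0 ?expR_ge0.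
  have I1 : (\int[N]_x (g x * expR (phi i k x))%:E <= (t / s)%:E)%E.
    rewrite -(@integral_normal_tilt R mu s (a i k) t s0 t0).
    apply: ge0_le_integral => //.
    - by move=> x _; rewrite lee_fin mulr_ge0 ?expR_ge0.
    - by apply/measurable_EFinP; exact: (measurable_funM mg (mephi i k)).
    - by apply/measurable_EFinP; exact: (mtilt i k).
    - move=> x _; rewrite lee_fin /phi expRD mulrCA ler_piMr ?expR_ge0//.
      (* Where [g] vanishes, [ln] takes a default value, but the left side is 0. This is why only an
         upper bound t/s is claimed for the integral. *)
      have := g0 x; rewrite le_eqVlt => /predU1P[<-|gx]; first by rewrite mul0r.
      by rewrite expRN lnK ?posrE// divff ?gt_eqF.
  have If : (\int[N]_x (g x * expR (phi i k x))%:E)%E \is a fin_num.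
    by rewrite ge0_fin_numE// (le_lt_trans I1)// ltry.
  exists (fine (\int[N]_x (g x * expR (phi i k x))%:E)%E); split.
    rewrite fineK// ge0_integral_image_measure; last 2 first.
    - exact/measurable_EFinP.
    - by move=> x; rewrite lee_fin expR_ge0.
    exact: (ge0_integral_law_density (mX k) mg g0 (gE k) (mephi i k) (fun x => expR_ge0 _)).
  by rewrite fine_ge0//= -lee_fin fineK.
(* The coordinates factorise on [F i], not on the cell [E i]; as the integrand is positive,
   enlarging the cell to [F i] only increases its integral. *)
have Fcell i : has_mean Q (fun w => \1_(F i) w * \prod_k expR (phi i k (X k w))) /\
    mean Q (fun w => \1_(F i) w * \prod_k expR (phi i k (X k w))) <= c i * (t / s) ^+ n.
  apply: has_mean_le_fin.
  - apply: measurable_funM; first exact: measurable_indic.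
    by apply: measurable_prod => k _; exact: (measurableT_comp (mephi i k)).
  - by move=> w; rewrite mulr_ge0 ?indicE// prodr_ge0// => k _; exact: expR_ge0.
  - have <- : (\int[Q]_(w in F i) (\prod_k expR (phi i k (X k w)))%:E =
      \int[Q]_w (\1_(F i) w * \prod_k expR (phi i k (X k w)))%:E)%E.
      rewrite integral_mkcond; apply: eq_integral => w _.
      by rewrite patchE indicE; case: ifP; rewrite ?mul1r ?mul0r.
    rewrite (@ge0_integral_prod_independent _ _ _ _ _ Q _ X (fun k => image_measure Q (mX k))
      (F i) (c i) _ _ _ _ _ (fun k x => expR (phi i k x)) (v i))//.
    + rewrite lee_fin ler_wpM2l// -[n in _ ^+ n]card_ord -prodr_const.
      by apply: ler_prod => k _; have [] := vE i k.
    + by move=> k; apply: (le_lt_trans (@probability_le1 _ _ _ Q setT measurableT)); exact: ltry.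
    + by move=> A mA; exact: FX.
    + by move=> k; have [] := vE i k.
(* Logarithm of the bound on the total exponential moment. Jensen's inequality is used in its
   tangent form z <= k0 - 1 + exp(z - k0); the tangent at [k0] makes the cells add up to at most k0
   - 1 + 1. *)
pose k0 := ln M + n%:R * ln (t / s).
have ek0 : expR k0 = M * (t / s) ^+ n.
  by rewrite /k0 expRD lnK ?posrE// expRM_natl lnK ?posrE.
have LphiX i k : has_mean Q (fun w => phi i k (X k w)).
  have [Lln _] := mean_law_density (mX k) mg g0 (gE k) mlng Lkl.
  apply: has_meanB => //; apply: has_meanB.
    by apply: (eq_has_mean _ (has_meanZ (2 * s ^+ 2)^-1 (L2a k mu))) => w; rewrite mulrC.
  by apply: (eq_has_mean _ (has_meanZ (2 * t ^+ 2)^-1 (L2a k (a i k)))) => w; rewrite mulrC.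
have Ecell i : mean Q (fun w => \1_(E i) w * \sum_k phi i k (X k w)) <=
    (k0 - 1) * mean Q \1_(E i) + c i / M.
  have [LF EFi] := Fcell i.
  have LE := (mean_indic Q (mE i)).1.
  have L1 : has_mean Q (fun w => \1_(E i) w * \sum_k phi i k (X k w)).
    by apply: has_mean_indic => //; exact: has_mean_sum.
  have L3 := has_meanZ (expR (- k0)) LF.
  apply: (@le_trans _ _ (mean Q (fun w => (k0 - 1) * \1_(E i) w +
     expR (- k0) * (\1_(F i) w * \prod_k expR (phi i k (X k w)))))).
    apply: le_mean => // [|w]; first by apply: has_meanD => //; exact: has_meanZ.
    have [wE|wE] := boolP (w \in E i); last first.
      rewrite [\1_(E i) w]indicE (negbTE wE) mul0r mulr0 add0r mulr_ge0 ?expR_ge0//.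
      by rewrite mulr_ge0 ?indicE// prodr_ge0// => k _; exact: expR_ge0.
    have wF : w \in F i by rewrite inE; apply: EF; rewrite inE in wE.
    rewrite !indicE wE wF !mul1r mulr1 -expR_sum -expRD.
    by have := expR_ge1Dx (- k0 + \sum_k phi i k (X k w)); lra.
  rewrite meanD//; [|exact: has_meanZ..].
  rewrite !meanZ// lerD2l expRN ek0 mulrC ler_pdivrMr ?mulr_gt0 ?exprn_gt0//.
  by rewrite mulrA divfK ?gt_eqF.
have S1 : \sum_i mean Q \1_(E i) = 1.
  rewrite -mean_sum => [|i]; last exact: (mean_indic Q (mE i)).1.
  by rewrite (eq_mean _ (fun w => E1 w)) mean_cst.
have main : \sum_i mean Q (fun w => \1_(E i) w * \sum_k phi i k (X k w)) <= k0.
  apply: (@le_trans _ _ (\sum_i ((k0 - 1) * mean Q \1_(E i) + c i / M))).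
    by apply: ler_sum => i _; exact: Ecell.
  rewrite big_split/= -mulr_sumr S1 mulr1 -mulr_suml.
  have : (\sum_i c i) / M <= 1 by rewrite ler_pdivrMr// mul1r.
  by lra.
have mln k : mean Q (fun w => ln (g (X k w))) = kl.
  by rewrite (mean_law_density (mX k) mg g0 (gE k) mlng Lkl).2.
have lhs : \sum_i mean Q (fun w => \1_(E i) w * \sum_k phi i k (X k w)) =
    n%:R * (w2 / (2 * s ^+ 2) - mean_sqr_dev / (2 * t ^+ 2) - kl).
  transitivity (\sum_k (w2 / (2 * s ^+ 2) -
    (\sum_i mean Q (fun w => \1_(E i) w * (X k w - a i k) ^+ 2)) / (2 * t ^+ 2) - kl)).
    transitivity (\sum_i \sum_k mean Q (fun w => \1_(E i) w * phi i k (X k w))).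
      apply: eq_bigr => i _; rewrite -mean_sum => [|k]; last exact: has_mean_indic.
      by apply: eq_mean => w; rewrite mulr_sumr.
    rewrite exchange_big; apply: eq_bigr => k _ /=.
    have Lu := has_meanZ (2 * s ^+ 2)^-1 (L2a k mu).
    have Lln := (mean_law_density (mX k) mg g0 (gE k) mlng Lkl).1.
    have Lul := has_meanB Lu Lln.
    have Ld i := has_meanZ (2 * t ^+ 2)^-1 (has_mean_indic (mE i) (L2a k (a i k))).
    transitivity (\sum_i (mean Q (fun w => \1_(E i) w *
        ((2 * s ^+ 2)^-1 * (X k w - mu) ^+ 2 - ln (g (X k w)))) -
        mean Q (fun w => (2 * t ^+ 2)^-1 * (\1_(E i) w * (X k w - a i k) ^+ 2)))).
      apply: eq_bigr => i _; rewrite -meanB//; last exact: has_mean_indic.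
      by apply: eq_mean => w; rewrite /phi; ring.
    rewrite sumrB -mean_sum => [|i]; last exact: has_mean_indic.
    have -> : mean Q (fun w => \sum_i \1_(E i) w *
        ((2 * s ^+ 2)^-1 * (X k w - mu) ^+ 2 - ln (g (X k w)))) = w2 / (2 * s ^+ 2) - kl.
      rewrite (@eq_mean _ _ _ Q _ (fun w => (2 * s ^+ 2)^-1 * (X k w - mu) ^+ 2 - ln (g (X k w))));
        last by move=> w; rewrite -mulr_suml E1 mul1r.
      by rewrite meanB// meanZ// E2 mln mulrC.
    rewrite (eq_bigr (fun i => (2 * t ^+ 2)^-1 * mean Q (fun w => \1_(E i) w * (X k w - a i k) ^+ 2)));
      last by move=> i _; rewrite meanZ//; exact: has_mean_indic.
    by rewrite -mulr_sumr; ring.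
  rewrite !sumrB !sumr_const !card_ord -mulr_suml /mean_sqr_dev.
  rewrite !mulrBr; congr (_ - _ - _); [by rewrite (mulr_natl _ n)| |by rewrite (mulr_natl _ n)].
  field; apply/andP; split; rewrite gt_eqF//.
move: main; rewrite lhs /k0 -ler_pdivlMl// mulrDr mulKf ?gt_eqF// [_^-1 * _]mulrC.
by lra.
Qed.

End converse.

(** * From a code to the objective of the lower bound *)

Section lower_bound.
Context (R : realType) (mu sX Rr Rc P D : R).
Hypotheses (sX0 : 0 < sX) (R0 : 0 <= Rr) (Rc0 : 0 <= Rc) (P0 : 0 <= P).
Let N : probability (measurableTypeR R) R := normal_prob mu sX.

Lemma KL_le_density (q : set (measurableTypeR R) -> \bar R) (k : R) :
  (KL q N <= k%:E)%E -> exists g : R -> R, [/\ is_density q N g,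
    has_mean N (fun x => g x * ln (g x)) & mean N (fun x => g x * ln (g x)) <= k].
Proof.
rewrite /KL; case: pselect => [ex|_]; last by rewrite leye_eq.
cbv zeta; set g := xget _ _ => KLk.
have gD : is_density q N g by apply: (@xgetPex _ (fun _ => 0) [set f | is_density q N f]).
exists g; have [mg g0 _] := gD.
have [||//|LK EK] := @has_mean_ge_le _ _ _ N (fun x => g x * ln (g x)) (-1) k.
- by apply: measurable_funM => //; apply: measurableT_comp => //; exact: measurable_ln.
(* From ln(1/g) <= 1/g - 1 follows g ln g >= g - 1 >= -1. *)
- move=> x; have := g0 x; rewrite le_eqVlt => /predU1P[<-|gx]; first by rewrite mul0r; lra.
  have gV0 : 0 < (g x)^-1 by rewrite invr_gt0.
  have : ln (g x)^-1 <= (g x)^-1 - 1.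
    have := @le_ln1Dx R ((g x)^-1 - 1); rewrite addrCA subrr addr0; apply; lra.
  rewrite lnV ?posrE// -(ler_pM2l gx) mulrBr divff ?gt_eqF// mulr1.
  by lra.
- by split.
Qed.

Variables (n a b : nat) (d : measure_display) (T : measurableType d) (Q : probability T R).
Variables (X Y : 'I_n -> T -> R) (J : T -> 'I_a) (K : T -> 'I_b).

Let cyl (t : 'I_n) (A : set R) (t' : 'I_n) : set R := if t' == t then A else setT.

Let cylE (Z : 'I_n -> T -> R) t A : [set w | forall t', cyl t A t' (Z t' w)] = Z t @^-1` A.
Proof.
apply/seteqP; split=> w /= H; first by have := H t; rewrite /cyl eqxx.
by move=> t'; rewrite /cyl; case: eqP => [->|].
Qed.

Let mcyl t A t' : measurable A -> measurable (cyl t A t').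
Proof. by move=> mA; rewrite /cyl; case: ifP. Qed.

Hypotheses (n0 : (0 < n)%N) (b0 : (0 < b)%N).
Hypotheses (lna : ln a%:R / n%:R <= Rr) (lnb : ln b%:R / n%:R <= Rc).
Hypotheses (mX : forall t, measurable_fun setT (X t)) (mY : forall t, measurable_fun setT (Y t)).
Hypotheses (mJ : forall j, measurable (J @^-1` [set j])).
Hypotheses (mK : forall k, measurable (K @^-1` [set k])).
Hypothesis Xlaw : forall A : 'I_n -> set R, (forall t, measurable (A t)) ->
  Q [set w | forall t, A t (X t w)] = (\prod_(t < n) normal_prob mu sX (A t))%E.
Hypothesis KX : forall (k : 'I_b) (A : 'I_n -> set R), (forall t, measurable (A t)) ->
  Q ([set w | K w = k] `&` [set w | forall t, A t (X t w)]) =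
  ((b%:R)^-1%:E * Q [set w | forall t, A t (X t w)])%E.
Hypothesis XJKY : forall (j : 'I_a) (k : 'I_b) (A B : 'I_n -> set R),
  (forall t, measurable (A t)) -> (forall t, measurable (B t)) ->
  (Q ([set w | forall t, A t (X t w)] `&` [set w | J w = j /\ K w = k]
      `&` [set w | forall t, B t (Y t w)]) * Q [set w | J w = j /\ K w = k])%E =
  (Q ([set w | forall t, A t (X t w)] `&` [set w | J w = j /\ K w = k]) *
   Q ([set w | J w = j /\ K w = k] `&` [set w | forall t, B t (Y t w)]))%E.
Hypothesis Ylaw : forall B : 'I_n -> set R, (forall t, measurable (B t)) ->
  Q [set w | forall t, B t (Y t w)] = (\prod_(t < n) Q (Y t @^-1` B t))%E.
Hypothesis Yid : forall (t t' : 'I_n) (B : set R), measurable B ->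
  Q (Y t @^-1` B) = Q (Y t' @^-1` B).
Hypothesis XYD :
  ((n%:R)^-1%:E * \sum_(t < n) \int[Q]_w ((X t w - Y t w) ^+ 2)%:E <= D%:E)%E.
Hypothesis YP : ((n%:R)^-1%:E * \sum_(t < n) KL (law Q (Y t)) (normal_prob mu sX) <= P%:E)%E.

Let nR : 0 < n%:R :> R. Proof. by rewrite ltr0n. Qed.

Let Xmarg t A : measurable A -> Q (X t @^-1` A) = N A.
Proof.
move=> mA; rewrite -cylE Xlaw; last by move=> t'; exact: mcyl.
rewrite (bigD1 t)//= {1}/cyl eqxx big1 ?mule1// => i /negbTE it.
by rewrite /cyl it; exact: (@probability_setT _ _ _ N).
Qed.

Let x t w := X t w - mu.
Let y t w := Y t w - mu.

Let mx t : measurable_fun setT (x t). Proof. exact: measurable_funB. Qed.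
Let my t : measurable_fun setT (y t). Proof. exact: measurable_funB. Qed.

Let m1 : measurable_fun setT (cst 1 : R -> R). Proof. exact: measurable_cst. Qed.

Let ge01 (r : R) : 0 <= (cst 1 : R -> R) r. Proof. exact: ler01. Qed.

Let one_law t (A : set R) : measurable A -> Q (X t @^-1` A) = (\int[N]_(x in A) (cst 1 x)%:E)%E.
Proof.
move=> mA; rewrite Xmarg// (_ : (fun x => _) = cst 1%E)//.
by rewrite integral_cst// mul1e.
Qed.

Let x2 t : has_mean Q (fun w => x t w ^+ 2) /\ mean Q (fun w => x t w ^+ 2) = sX ^+ 2.
Proof.
have [L E] := normal_sqr_dist mu sX0.
have m2 : measurable_fun setT (fun r : R => (r - mu) ^+ 2).
  by apply: measurable_funX; exact: measurable_funB.
have L' : has_mean N (fun r => cst 1 r * (r - mu) ^+ 2).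
  by apply: (eq_has_mean _ L) => r; rewrite mul1r.
have [LX EX] := mean_law_density (mX t) m1 ge01 (one_law t) m2 L'.
split=> //; apply: (eq_trans EX); rewrite -E; apply: eq_mean => r.
by rewrite mul1r.
Qed.

Let XY2 t : has_mean Q (fun w => (X t w - Y t w) ^+ 2).
Proof.
have [|||L _] := @has_mean_le_fin _ _ _ Q (fun w => (X t w - Y t w) ^+ 2) (n%:R * D).
- by apply: measurable_funX; exact: measurable_funB.
- by move=> w; exact: sqr_ge0.
- have I0 t' : (0 <= \int[Q]_w ((X t' w - Y t' w) ^+ 2)%:E)%E.
    by apply: integral_ge0 => w _; rewrite lee_fin sqr_ge0.
  move: XYD; rewrite lee_pdivrMl// -EFinM; apply: le_trans.
  by rewrite (bigD1 t)//= leeDl// sume_ge0.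
- by [].
Qed.

Let y2 t : has_mean Q (fun w => y t w ^+ 2).
Proof.
have mXY : measurable_fun setT (fun w => - (X t w - Y t w)).
  by apply: measurable_funN; exact: measurable_funB.
have LXY : has_mean Q (fun w => (- (X t w - Y t w)) ^+ 2).
  by apply: (eq_has_mean _ (XY2 t)) => w; rewrite sqrrN.
apply: (eq_has_mean _ (has_mean_sqrD (mx t) mXY (x2 t).1 LXY)) => w.
by congr (_ ^+ 2); rewrite /x /y; ring.
Qed.

(** Since the divergences average to at most P, one coordinate has divergence at most P. The laws of
    the coordinates coincide, so its density serves them all. *)
Let exg : exists g : R -> R, [/\ measurable_fun setT g, (forall r, 0 <= g r),
  (forall t (A : set R), measurable A -> Q (Y t @^-1` A) = (\int[N]_(r in A) (g r)%:E)%E),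
  has_mean N (fun r => g r * ln (g r)) & mean N (fun r => g r * ln (g r)) <= P].
Proof.
have [t Pt] : exists t, (KL (law Q (Y t)) N <= P%:E)%E.
  apply/not_existsP => H.
  have {}H t : (P%:E < KL (law Q (Y t)) N)%E by rewrite ltNge; apply/negP; exact: H.
  move: YP; rewrite lee_pdivrMl// -EFinM leNgt => /negP; apply.
  have -> : (n%:R * P)%:E = (\sum_(t < n) P%:E)%E.
    by rewrite sumEFin sumr_const card_ord mulr_natl.
  pose t0 := Ordinal n0.
  rewrite (bigD1 t0)//= [ltRHS](bigD1 t0)//=.
  apply: lte_leD => //; first by rewrite sumEFin.
  by apply: lee_sum => t _; exact: ltW.
have [g [[mg g0 gE] LK EK]] := KL_le_density Pt.
exists g; split=> // t' A mA; rewrite (Yid t' t mA).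
exact: gE.
Qed.

(** A probability space has a point, and J sends it into ['I_a]. *)
Let a0 : (0 < a)%N.
Proof.
have [w _] : [set: T] !=set0.
  apply/set0P/eqP => T0; have := probability_setT Q; rewrite T0 measure0.
  by move/eqP; rewrite eq_sym onee_eq0.
by case: (J w) => m; exact: leq_ltn_trans.
Qed.

Let cell (jk : 'I_a * 'I_b) : set T := [set w | J w = jk.1 /\ K w = jk.2].

Let mcell i : measurable (cell i).
Proof. exact: (measurableI _ _ (mJ i.1) (mK i.2)). Qed.

Let sum_cell w : \sum_i \1_(cell i) w = 1 :> R.
Proof.
rewrite (bigD1 (J w, K w))//= indicE mem_set//= big1 ?addr0// => -[j k] jk.
rewrite indicE memNset//= => -[/= Jj Kk]; move: jk.
by rewrite Jj Kk eqxx.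
Qed.

Let p i : R := mean Q \1_(cell i).

Let p0 i : 0 <= p i. Proof. by apply: mean_ge0 => w; rewrite indicE. Qed.

(** Conditional mean given the cell. On a null cell the division returns 0, which is harmless
    because [cm] only enters the sums multiplied by [p i]. *)
Let cm (z : 'I_n -> T -> R) i t := mean Q (fun w => \1_(cell i) w * z t w) / p i.

Let cmE (z : 'I_n -> T -> R) i t : measurable_fun setT (z t) ->
  mean Q (fun w => \1_(cell i) w * z t w) = p i * cm z i t.
Proof.
move=> mz; have [pi0|pi0] := eqVneq (p i) 0.
  by rewrite pi0 mul0r (mean_indic_eq0 (mcell i) mz pi0).
by rewrite /cm mulrC divfK.
Qed.

Let dev (z : 'I_n -> T -> R) i t : measurable_fun setT (z t) -> has_mean Q (fun w => z t w ^+ 2) ->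
  mean Q (fun w => \1_(cell i) w * (z t w - cm z i t) ^+ 2) =
  mean Q (fun w => \1_(cell i) w * z t w ^+ 2) - p i * cm z i t ^+ 2.
Proof.
move=> mz z2; have z1 := has_mean_sqr mz z2.
have L0 := (mean_indic Q (mcell i)).1.
have L1 := has_mean_indic (mcell i) z1; have L2 := has_mean_indic (mcell i) z2.
rewrite (@eq_mean _ _ _ Q _ (fun w => (\1_(cell i) w * z t w ^+ 2 -
  (2 * cm z i t) * (\1_(cell i) w * z t w)) + cm z i t ^+ 2 * \1_(cell i) w)); last first.
  by move=> w; ring.
have LZ1 := has_meanZ (2 * cm z i t) L1; have LZ0 := has_meanZ (cm z i t ^+ 2) L0.
have LB := has_meanB L2 LZ1.
rewrite meanD// meanB// !meanZ// cmE// -/(p i).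
by ring.
Qed.

Let sum_mean_cell f : has_mean Q f -> \sum_i mean Q (fun w => \1_(cell i) w * f w) = mean Q f.
Proof.
move=> Lf; rewrite -mean_sum => [|i]; last exact: has_mean_indic.
by apply: eq_mean => w; rewrite -mulr_suml sum_cell mul1r.
Qed.

Let V (z : 'I_n -> T -> R) := n%:R^-1 * \sum_t \sum_i
  mean Q (fun w => \1_(cell i) w * (z t w - cm z i t) ^+ 2).

Let VE (z : 'I_n -> T -> R) m2 : (forall t, measurable_fun setT (z t)) ->
  (forall t, has_mean Q (fun w => z t w ^+ 2)) ->
  (forall t, mean Q (fun w => z t w ^+ 2) = m2) ->
  m2 - V z = n%:R^-1 * \sum_t \sum_i p i * cm z i t ^+ 2.
Proof.
move=> mz z2 zE; rewrite /V.
rewrite (eq_bigr (fun t => m2 - \sum_i p i * cm z i t ^+ 2)) => [|t _].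
  rewrite sumrB sumr_const card_ord -[m2 *+ n]mulr_natl mulrBr mulKf ?gt_eqF//.
  by rewrite subKr.
rewrite (eq_bigr (fun i => mean Q (fun w => \1_(cell i) w * z t w ^+ 2) - p i * cm z i t ^+ 2)).
  by rewrite sumrB sum_mean_cell// zE.
by move=> i _; exact: dev.
Qed.

Let V0 z : 0 <= V z.
Proof.
rewrite mulr_ge0 ?invr_ge0// sumr_ge0// => t _; rewrite sumr_ge0// => i _.
by apply: mean_ge0 => w; rewrite mulr_ge0 ?sqr_ge0// indicE.
Qed.

Let xy_cell i t : mean Q (fun w => \1_(cell i) w * (x t w * y t w)) = p i * (cm x i t * cm y i t).
Proof.
have mxy : measurable_fun setT (fun w => x t w * y t w) by exact: measurable_funM.
have [pi0|pi0] := eqVneq (p i) 0.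
  by rewrite (mean_indic_eq0 (mcell i) mxy pi0) pi0 mul0r.
apply: (mulfI pi0); rewrite {1}/p mean_mul_conditional_independent//.
- by rewrite !cmE//; ring.
- move=> A B mA mB.
  have mshift C : measurable C -> measurable ((fun r : R => r - mu) @^-1` C).
    have mf : measurable_fun setT (fun r : R => r - mu) by exact: measurable_funB.
    by move=> mC; rewrite -[X in measurable X]setTI; exact: mf.
  have := XJKY i.1 i.2 (fun t' => @mcyl t _ t' (mshift _ mA)) (fun t' => @mcyl t _ t' (mshift _ mB)).
  by rewrite !cylE.
- exact: (x2 t).1.
Qed.

Lemma code_Dlower_obj :
  exists2 s, s \in `[sigmaP sX P, sX] & Dlower_obj sX Rr Rc P s <= D.
Proof.
have [g [mg g0 gE LK EK]] := exg.
pose t0 := Ordinal n0; pose w2 := mean Q (fun w => y t0 w ^+ 2).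
have y2E t : mean Q (fun w => y t w ^+ 2) = w2.
  have m2 : measurable_fun setT (fun r : R => (r - mu) ^+ 2).
    by apply: measurable_funX; exact: measurable_funB.
  have key t' : has_mean N (fun r => g r * (r - mu) ^+ 2) /\
      mean N (fun r => g r * (r - mu) ^+ 2) = mean Q (fun w => y t' w ^+ 2).
    apply: has_mean_ge0.
    - exact: (measurable_funM mg m2).
    - by move=> r; rewrite mulr_ge0// sqr_ge0.
    - rewrite -meanE//.
      by apply/esym; apply: (ge0_integral_law_density (mY t') mg g0 (gE t') m2) => r; exact: sqr_ge0.
  by rewrite -(key t).2 (key t0).2.
have w20 : 0 <= w2 by apply: mean_ge0 => w; exact: sqr_ge0.
have aR : 0 < a%:R :> R by rewrite ltr0n.
have bR : 0 < b%:R :> R by rewrite ltr0n.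
have N1 : has_mean N (fun r => cst 1 r * ln (cst 1 r)).
  by apply: (eq_has_mean _ (has_mean_cst N 0)) => r; rewrite /= ln1 mulr0.
have N1E : mean N (fun r => cst 1 r * ln (cst 1 r)) = 0.
  by rewrite -[RHS](mean_cst N 0); apply: eq_mean => r; rewrite /= ln1 mulr0.
(* The seed is independent of X^n, so the cell is enlarged to {K = k}, of weight 1/b; the a * b
   cells then add up to [a]. The density is 1 and its divergence 0. *)
have conX t : 0 < t -> 2^-1 - V x / (2 * t ^+ 2) <= Rr + ln (t / sX).
  move=> tp.
  have := @mean_sqr_dev_converse _ _ _ Q n X mu sX (cst 1) _ cell (fun i => [set w | K w = i.2])
    (fun=> b%:R^-1) a%:R (sX ^+ 2) 0 (fun i t => mu + cm x i t) n0 sX0 aR mX m1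
    ge01 one_law mcell (fun i => mK i.2) (fun i w => @proj2 _ _) sum_cell.
  have -> : mean_sqr_dev Q X cell (fun i t => mu + cm x i t) = V x.
    rewrite /mean_sqr_dev /V; congr (_ * _); apply: eq_bigr => k _; apply: eq_bigr => i _.
    by apply: eq_mean => w; rewrite /x; congr (_ * _ ^+ 2); ring.
  have -> : sX ^+ 2 / (2 * sX ^+ 2) = 2^-1 by field; rewrite gt_eqF.
  move=> H; apply: le_trans (H _ _ _ (fun t => (x2 t).1) (fun t => (x2 t).2) N1 N1E t tp) _.
  - by move=> i; rewrite invr_ge0 ltW.
  - by rewrite sumr_const card_prod !card_ord -[_ *+ (a * b)]mulr_natl natrM mulfK ?gt_eqF.
  - move=> i A mA; rewrite KX// Xlaw//; congr (_ * _)%E; apply: eq_bigr => k _.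
    by rewrite Xmarg.
  - by rewrite addr0 lerD2r.
(* The seed may depend on Xhat^n, so every cell is enlarged to the whole space with weight 1, and
   the total is a * b. *)
have conY t : 0 < t -> w2 / (2 * sX ^+ 2) - V y / (2 * t ^+ 2) <= Rr + Rc + P + ln (t / sX).
  move=> tp.
  have abR : 0 < (a%:R * b%:R) :> R by rewrite mulr_gt0.
  have := @mean_sqr_dev_converse _ _ _ Q n Y mu sX g _ cell (fun i => setT)
    (fun=> 1) (a%:R * b%:R) w2 _ (fun i t => mu + cm y i t) n0 sX0 abR mY mg
    g0 gE mcell (fun=> measurableT) (fun i => @subsetT _ _) sum_cell.
  have -> : mean_sqr_dev Q Y cell (fun i t => mu + cm y i t) = V y.
    rewrite /mean_sqr_dev /V; congr (_ * _); apply: eq_bigr => k _; apply: eq_bigr => i _.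
    by apply: eq_mean => w; rewrite /y; congr (_ * _ ^+ 2); ring.
  move=> H; apply: le_trans (H _ _ _ _ y2 y2E LK erefl t tp) _ => //.
  - by rewrite sumr_const card_prod !card_ord natrM.
  - by move=> i A mA; rewrite setTI Ylaw// mul1e.
  - by rewrite lnM ?posrE// mulrDl lerD2r lerD// lerD.
(* A single cell with centre [mu]: the divergence alone restricts the second moment of Xhat. *)
have conw t : 0 < t -> w2 / (2 * sX ^+ 2) - w2 / (2 * t ^+ 2) <= P + ln (t / sX).
  move=> tp.
  have := @mean_sqr_dev_converse _ _ _ Q n Y mu sX g unit (fun=> setT) (fun=> setT)
    (fun=> 1) 1 w2 _ (fun i t => mu) n0 sX0 ltr01 mY mg
    g0 gE (fun=> measurableT) (fun=> measurableT) (fun i => @subsetT _ _).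
  have -> : mean_sqr_dev Q Y (fun=> setT) (fun (i : unit) t => mu) = w2.
    rewrite /mean_sqr_dev (eq_bigr (fun=> w2)) => [|k _].
      by rewrite sumr_const card_ord -[w2 *+ n]mulr_natl mulKf ?gt_eqF.
    rewrite (big_pred1 tt) => [|[]//]; rewrite -(y2E k); apply: eq_mean => w.
    by rewrite indicT mul1r.
  move=> H; apply: le_trans (H _ _ _ _ _ y2 y2E LK erefl t tp) _ => //.
  - by move=> w; rewrite (big_pred1 tt) => [|[]//]; rewrite indicT.
  - by rewrite (big_pred1 tt) => [|[]//].
  - by move=> i A mA; rewrite setTI Ylaw// mul1e.
  - by rewrite ln1 mul0r add0r lerD2r.
have VX := VE mx (fun t => (x2 t).1) (fun t => (x2 t).2).
have VY := VE my y2 y2E.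
have sum0 (z : 'I_n -> T -> R) : 0 <= n%:R^-1 * \sum_t \sum_i p i * cm z i t ^+ 2.
  rewrite mulr_ge0 ?invr_ge0// sumr_ge0// => t _; rewrite sumr_ge0// => i _.
  by rewrite mulr_ge0 ?sqr_ge0.
pose C := n%:R^-1 * \sum_t mean Q (fun w => x t w * y t w).
have xy1 t : has_mean Q (fun w => x t w * y t w).
  by apply: has_mean_mul => //; exact: (x2 t).1.
have CE : C = n%:R^-1 * \sum_t \sum_i p i * (cm x i t * cm y i t).
  congr (_ * _); apply: eq_bigr => t _; rewrite -sum_mean_cell//.
  by apply: eq_bigr => i _; rewrite xy_cell.
apply: (@Dlower_obj_le R sX sX0 Rr Rc P (V x) (V y) w2 C D) => //.
- by rewrite V0 -subr_ge0 VX sum0.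
- by rewrite V0 -subr_ge0 VY sum0.
(* One Cauchy-Schwarz inequality over pairs of a coordinate and a cell, applied to the conditional
   means. *)
- rewrite VX VY CE exprMn [leRHS]mulrACA -[n%:R^-1 * n%:R^-1]expr2 ler_pM2l ?exprn_gt0 ?invr_gt0//.
  rewrite !pair_big/=.
  exact: (Cauchy_Schwarz_sum (fun ti : 'I_n * ('I_a * 'I_b) => cm x ti.2 ti.1)
    (fun ti => cm y ti.2 ti.1) (fun ti => p0 ti.2)).
- have : n%:R^-1 * \sum_t mean Q (fun w => (X t w - Y t w) ^+ 2) <= D.
    rewrite -lee_fin; move: XYD; rewrite EFinM -sumEFin.
    by under [X in _ -> (_ * X <= _)%E]eq_bigr do rewrite -meanE//.
  rewrite (eq_bigr (fun t => (sX ^+ 2 + w2) - 2 * mean Q (fun w => x t w * y t w))).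
    rewrite sumrB sumr_const card_ord -[(sX ^+ 2 + w2) *+ n]mulr_natl mulrBr mulKf ?gt_eqF//.
    by rewrite -mulr_sumr mulrCA.
  move=> t _; rewrite -(x2 t).2 -(y2E t) -meanD//; last exact: (x2 t).1.
  rewrite -meanZ// -meanB; last 2 first.
  - by apply: has_meanD => //; exact: (x2 t).1.
  - exact: has_meanZ.
  by apply: eq_mean => w; rewrite /x /y; ring.
Qed.

End lower_bound.

Lemma Dlower_le_RDP (R : realType) (mu sX Rr Rc P : R) :
  0 < sX -> 0 <= Rr -> 0 <= Rc -> 0 <= P ->
  (Dlower sX Rr Rc P <= RDP mu sX Rr Rc P)%E.
Proof.
move=> sX0 R0 Rc0 P0; apply: le_ereal_inf_tmp => _ [D [n [a [b [d [T [Q [X [Y [J [K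
  [[n0 b0 lna lnb] [[mX mY mJ mK] [Xlaw [KX [XJKY [Ylaw [Yid [XYD YP]]]]]]]]]]]]]]]]]] <-].
have [s sI sD] := @code_Dlower_obj R mu sX Rr Rc P D sX0 R0 Rc0 P0 n a b d T Q X Y J K
  n0 b0 lna lnb mX mY mJ mK Xlaw KX XJKY Ylaw Yid XYD YP.
apply: ge_ereal_inf; exists (Dlower_obj sX Rr Rc P s)%:E; last by rewrite lee_fin.
by exists s.
Qed.

(** * Soft covering *)

(** Iterated binary products, so the sample space is part of the conclusion. With no copies any
    probability space will do, and U itself is taken. *)
Lemma exists_independent_copies d (U : measurableType d) (R : realType)
    (P : probability U R) (N : nat) :
  exists d' (T : measurableType d') (Q : probability T R) (X : 'I_N -> T -> U),
    (forall i, measurable_fun setT (X i)) /\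
    forall A : 'I_N -> set U, (forall i, measurable (A i)) ->
      Q [set w | forall i, A i (X i w)] = (\prod_i P (A i))%E.
Proof.
elim: N => [|N [d' [T [Q [X [mX XE]]]]]].
  exists d, U, P, (fun=> id); split=> [[]//|A _].
  rewrite big_ord0 (_ : [set _ | _] = setT) ?probability_setT//.
  by apply/seteqP; split=> // w _ [].
pose X' (i : 'I_N.+1) (w : T * U) : U := if unlift ord0 i is Some j then X j w.1 else w.2.
exists _, (T * U)%type, (Q \x P)%E, X'; split=> [i|A mA].
  rewrite /X'; case: (unlift ord0 i) => [j|]; last exact: measurable_snd.
  exact: (measurableT_comp (mX j) measurable_fst).
have -> : [set w | forall i, A i (X' i w)] =
    [set w | forall j, A (lift ord0 j) (X j w)] `*` A ord0.
  apply/seteqP; split=> [w Aw|w [/= Aw A0] i].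
    split=> /= [j|]; first by have := Aw (lift ord0 j); rewrite /X' liftK.
    by have := Aw ord0; rewrite /X' unlift_none.
  by rewrite /X'; case: unliftP => [j ->|->].
have mS := @measurable_cylinder _ _ _ _ _ X (fun j => A (lift ord0 j)) mX (fun j => mA _).
transitivity (Q [set w | forall j, A (lift ord0 j) (X j w)] * P (A ord0))%E.
  exact: product_measure1E.
by rewrite (XE (fun j => A (lift ord0 j)))// big_ord_recl muleC.
Qed.

Lemma mean_same_law d d' (Om : measurableType d) (C : measurableType d') (R : realType)
    (P : probability Om R) (PC : probability C R) (V : C -> Om) (h : Om -> R) :
  measurable_fun setT V -> (forall A, measurable A -> PC (V @^-1` A) = P A) ->
  measurable_fun setT h -> (forall u, 0 <= h u) -> has_mean P h ->
  has_mean PC (fun c => h (V c)) /\ mean PC (fun c => h (V c)) = mean P h.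
Proof.
move=> mV Vlaw mh h0 Lh; apply: has_mean_ge0.
- exact: (measurableT_comp mh mV).
- by move=> c; exact: h0.
- rewrite -meanE//.
  transitivity (\int[image_measure PC mV]_u (h u)%:E)%E.
    apply/esym; apply: (ge0_integral_image_measure PC mV); first exact/measurable_EFinP.
    by move=> u; rewrite lee_fin.
  by apply: eq_measure_integral => A mA _; exact: Vlaw.
Qed.

Section soft_covering.
Context d d' (Om : measurableType d) (C : measurableType d') (R : realType).
Variables (P : probability Om R) (PC : probability C R) (J : finType) (U : J -> C -> Om).
Hypothesis mU : forall j, measurable_fun setT (U j).
Hypothesis Ulaw : forall j A, measurable A -> PC (U j @^-1` A) = P A.
Hypothesis Upair : forall i j, i != j -> forall A B, measurable A -> measurable B ->
  PC (U i @^-1` A `&` U j @^-1` B) = (P A * P B)%E.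
Hypothesis J0 : (0 < #|J|)%N.

Let N : R := #|J|%:R.

Let N0 : 0 < N. Proof. by rewrite ltr0n. Qed.

Let mean_U (h : Om -> R) j : measurable_fun setT h -> (forall u, 0 <= h u) -> has_mean P h ->
  has_mean PC (fun c => h (U j c)) /\ mean PC (fun c => h (U j c)) = mean P h.
Proof. exact: mean_same_law (mU j) (Ulaw j). Qed.

Let mean_UU (h : Om -> R) i j : i != j -> measurable_fun setT h -> (forall u, 0 <= h u) ->
  has_mean P h ->
  has_mean PC (fun c => h (U i c) * h (U j c)) /\
  mean PC (fun c => h (U i c) * h (U j c)) = mean P h ^+ 2.
Proof.
move=> ij mh h0 Lh; apply: has_mean_ge0.
- by apply: measurable_funM; [exact: (measurableT_comp mh (mU i))|exact: (measurableT_comp mh (mU j))].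
- by move=> c; rewrite mulr_ge0.
have := @ge0_integral_prod_independent _ _ _ _ _ PC bool (fun b => if b then U i else U j)
  (fun=> P) setT 1 measurableT _ ler01 _ _ (fun=> h) (fun=> mean P h) (fun=> mh) (fun=> h0)
  (fun=> meanE Lh).
move=> H; apply: (@eq_trans _ _ (1 * \prod_(b : bool) mean P h)%:E); last first.
  by rewrite big_bool/= mul1r expr2.
rewrite -H.
- by apply: eq_integral => c _; rewrite big_bool.
- by case.
- by move=> _; apply: (le_lt_trans (@probability_le1 _ _ _ P setT measurableT)); exact: ltry.
- move=> A mA; rewrite setTI mul1e big_bool/= -(Upair ij)//; congr (PC _).
  by apply/seteqP; split=> [c Ac|c [A1 A2] []//]; split; [exact: (Ac true)|exact: (Ac false)].
Qed.

(** Truncate h at M. Pairwise independence bounds the variance of the average of the bounded part by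
    M/N, which |z| <= eta/2 + z^2/(2 eta) turns into a bound on the mean deviation. The rest is
    estimated in L1, twice: for the average and for its mean. *)
Lemma soft_covering_pointwise (h : Om -> R) (M eta : R) : measurable_fun setT h ->
  (forall u, 0 <= h u) -> has_mean P h -> mean P h = 1 -> 0 <= M -> 0 < eta ->
  has_mean PC (fun c => `|N^-1 * \sum_j h (U j c) - 1|) /\
  mean PC (fun c => `|N^-1 * \sum_j h (U j c) - 1|) <=
  eta / 2 + M / (2 * eta * N) + 2 * mean P (fun u => h u * \1_[set u | M < h u] u).
Proof.
move=> mh h0 Lh Eh M0 eta0.
pose h2 u := h u * \1_[set u | M < h u] u; pose h1 u := h u - h2 u.
have mB : measurable [set u | M < h u].
  rewrite (_ : [set _ | _] = h @^-1` `]M, +oo[%classic).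
    by rewrite -[X in measurable X]setTI; exact: mh.
  by apply/seteqP; split=> u /=; rewrite in_itv/= andbT.
have mh2 : measurable_fun setT h2 by apply: measurable_funM => //; exact: measurable_indic.
have mh1 : measurable_fun setT h1 by exact: measurable_funB.
have h20 u : 0 <= h2 u by rewrite mulr_ge0// indicE.
have h1P u : 0 <= h1 u <= M.
  rewrite /h1 /h2 indicE; have [uM|uM] := boolP (u \in [set u | M < h u]).
    by rewrite mulr1 subrr lexx.
  rewrite mulr0 subr0 h0/= leNgt; apply/negP => Mu.
  by move/negP: uM; apply; rewrite inE.
have h10 u : 0 <= h1 u by case/andP: (h1P u).
have h1h u : h1 u <= h u by rewrite /h1 gerBl.
have h2h u : h2 u <= h u by rewrite -subr_ge0 h10.
have L1 : has_mean P h1 by apply: (has_mean_dom mh1 _ Lh) => u; rewrite ger0_norm.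
have L2 : has_mean P h2 by apply: (has_mean_dom mh2 _ Lh) => u; rewrite ger0_norm.
have L11 : has_mean P (fun u => h1 u * h1 u).
  apply: (has_mean_dom _ _ (has_meanZ M L1)); first exact: measurable_funM.
  by move=> u; rewrite ger0_norm ?mulr_ge0// ler_wpM2r//; case/andP: (h1P u).
set m1 := mean P h1; set m2 := mean P h2.
have m10 : 0 <= m1 by exact: mean_ge0.
have m20 : 0 <= m2 by exact: mean_ge0.
have m12 : m1 + m2 = 1.
  by rewrite -meanD// -Eh; apply: eq_mean => u; rewrite /h1 subrK.
have m11 : mean P (fun u => h1 u * h1 u) <= M * m1.
  rewrite -meanZ//; apply: le_mean => //; first exact: has_meanZ.
  by move=> u; rewrite ler_wpM2r//; case/andP: (h1P u).
pose S (k : Om -> R) c := N^-1 * \sum_j k (U j c).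
have SL (k : Om -> R) : measurable_fun setT k -> (forall u, 0 <= k u) -> has_mean P k ->
    has_mean PC (S k) /\ mean PC (S k) = mean P k.
  move=> mk k0 Lk; have LU j := (mean_U j mk k0 Lk).1.
  have LS : has_mean PC (fun c => \sum_j k (U j c)) by exact: has_mean_sum.
  split; first exact: has_meanZ.
  rewrite meanZ// mean_sum// (eq_bigr (fun=> mean P k)) => [|j _]; last exact: (mean_U j mk k0 Lk).2.
  by rewrite sumr_const -[_ *+ _]mulr_natl mulKf ?gt_eqF.
have [LS1 ES1] := SL h1 mh1 h10 L1; have [LS2 ES2] := SL h2 mh2 h20 L2.
have [LS ES] := SL h mh h0 Lh.
have L1U j := (mean_U j mh1 h10 L1).1.
have Lp i j : has_mean PC (fun c => h1 (U i c) * h1 (U j c)).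
  have [->|ij] := eqVneq i j; last exact: (mean_UU ij mh1 h10 L1).1.
  by apply: (mean_U j _ _ L11).1 => //; [exact: measurable_funM|move=> u; rewrite mulr_ge0].
have S1sq c : S h1 c ^+ 2 = (N^-1 ^+ 2) * \sum_i \sum_j h1 (U i c) * h1 (U j c).
  rewrite /S exprMn; congr (_ * _); rewrite expr2 big_distrl/=; apply: eq_bigr => i _.
  by rewrite big_distrr.
have Lpp : has_mean PC (fun c => \sum_i \sum_j h1 (U i c) * h1 (U j c)).
  by apply: has_mean_sum => i; exact: has_mean_sum.
have LS1sq : has_mean PC (fun c => S h1 c ^+ 2).
  by apply: (eq_has_mean _ (has_meanZ (N^-1 ^+ 2) Lpp)) => c; rewrite S1sq.
have ES1sq : mean PC (fun c => S h1 c ^+ 2) <= m1 ^+ 2 + M / N.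
  rewrite (eq_mean _ S1sq) meanZ// mean_sum => [|i]; last exact: has_mean_sum.
  have row i : mean PC (fun c => \sum_j h1 (U i c) * h1 (U j c)) <= N * m1 ^+ 2 + M.
    rewrite mean_sum// (bigD1 i)//= addrC; apply: lerD.
      rewrite (eq_bigr (fun=> m1 ^+ 2)) => [|j ji].
        rewrite sumr_const -[_ *+ _]mulr_natl ler_wpM2r ?sqr_ge0// ler_nat.
        exact: max_card.
      by apply: (mean_UU _ mh1 h10 L1).2; rewrite eq_sym.
    have [] := @mean_U (fun u => h1 u * h1 u) i.
    - exact: measurable_funM.
    - by move=> u; rewrite mulr_ge0.
    - exact: L11.
    - by move=> _ ->; apply: (le_trans m11); rewrite ler_piMr//; lra.
  apply: (@le_trans _ _ (N^-1 ^+ 2 * \sum_(i : J) (N * m1 ^+ 2 + M))).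
    by rewrite ler_wpM2l ?sqr_ge0//; apply: ler_sum => i _.
  rewrite sumr_const -[_ *+ #|_|]mulr_natl -/N.
  by rewrite le_eqVlt; apply/orP; left; apply/eqP; field; rewrite gt_eqF.
have LB : has_mean PC (fun c => S h1 c ^+ 2 - 2 * m1 * S h1 c + m1 ^+ 2).
  apply: has_meanD; last exact: has_mean_cst.
  by apply: has_meanB => //; exact: has_meanZ.
have EB : mean PC (fun c => S h1 c ^+ 2 - 2 * m1 * S h1 c + m1 ^+ 2) <= M / N.
  have Lc := has_mean_cst PC (m1 ^+ 2); have LZ := has_meanZ (2 * m1) LS1.
  have LBB := has_meanB LS1sq LZ.
  rewrite meanD// meanB// meanZ// mean_cst ES1 -/m1.
  by move: ES1sq; set a := mean _ _; set z := M / N; nra.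
split.
  apply: has_mean_norm; apply: has_meanB => //; exact: has_mean_cst.
pose G c := (eta / 2 + (2 * eta)^-1 * (S h1 c ^+ 2 - 2 * m1 * S h1 c + m1 ^+ 2)) + (S h2 c + m2).
have LG1 : has_mean PC (fun c => eta / 2 + (2 * eta)^-1 * (S h1 c ^+ 2 - 2 * m1 * S h1 c + m1 ^+ 2)).
  by apply: has_meanD; [exact: has_mean_cst|exact: has_meanZ].
have LG2 : has_mean PC (fun c => S h2 c + m2) by apply: has_meanD => //; exact: has_mean_cst.
apply: (@le_trans _ _ (mean PC G)).
  apply: le_mean.
  - by apply: has_mean_norm; apply: has_meanB => //; exact: has_mean_cst.
  - exact: has_meanD.
  move=> c; rewrite -/(S h c).
  have -> : S h c - 1 = (S h1 c - m1) + (S h2 c - m2).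
    rewrite addrACA -opprD m12; congr (_ - _).
    by rewrite /S -mulrDr -big_split/=; congr (_ * _); apply: eq_bigr => j _; rewrite /h1 subrK.
  have S20 : 0 <= S h2 c by apply: mulr_ge0; [rewrite invr_ge0 ltW|apply: sumr_ge0].
  apply: (le_trans (ler_normD _ _)); apply: lerD.
    have -> : S h1 c ^+ 2 - 2 * m1 * S h1 c + m1 ^+ 2 = `|S h1 c - m1| ^+ 2.
      by rewrite real_normK ?num_real//; ring.
    set z := `|_|; have : 0 <= (2 * eta)^-1 * (z - eta) ^+ 2.
      by rewrite mulr_ge0 ?sqr_ge0// invr_ge0; lra.
    have -> : (2 * eta)^-1 * (z - eta) ^+ 2 = (2 * eta)^-1 * z ^+ 2 + eta / 2 - z.
      by field; rewrite gt_eqF.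
    by lra.
  by rewrite (le_trans (ler_normB _ _))// !ger0_norm.
have -> : mean PC G = eta / 2 + (2 * eta)^-1 *
    mean PC (fun c => S h1 c ^+ 2 - 2 * m1 * S h1 c + m1 ^+ 2) + (m2 + m2).
  rewrite (meanD LG1 LG2) (meanD (has_mean_cst PC (eta / 2)) (has_meanZ (2 * eta)^-1 LB)).
  by rewrite (meanZ (2 * eta)^-1 LB) (meanD LS2 (has_mean_cst PC m2)) !mean_cst ES2.
have -> : M / (2 * eta * N) = (2 * eta)^-1 * (M / N) by field; rewrite !gt_eqF.
apply: lerD; last by change (m2 + m2 <= 2 * m2); lra.
by rewrite lerD2l ler_pM2l// invr_gt0; lra.
Qed.

Variable L : Om * Om -> R.
Hypotheses (mL : measurable_fun setT L) (L0 : forall z, 0 <= L z).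
Hypothesis L1 : forall x, (\int[P]_u (L (x, u))%:E = 1)%E.

Let mLx x : measurable_fun setT (fun u => L (x, u)).
Proof. exact: (measurableT_comp mL (pair1_measurable x)). Qed.

Let mcovering (y : Om -> R) : measurable_fun setT y ->
  measurable_fun setT (fun z : C * Om => y z.2 * `|N^-1 * \sum_j L (z.2, U j z.1) - 1|).
Proof.
move=> my; apply: measurable_funM; first exact: (measurableT_comp my measurable_snd).
apply: measurableT_comp => //; apply: measurable_funB => //; apply: measurable_funM => //.
apply: measurable_sum => j; apply: (measurableT_comp mL).
apply/measurable_fun_pairP; split; first exact: measurable_snd.
exact: (measurableT_comp (mU j) measurable_fst).
Qed.

Lemma measurable_covering_error (y : Om -> R) : measurable_fun setT y -> (forall x, 0 <= y x) ->
  measurable_fun setT (fun c => \int[P]_x (y x * `|N^-1 * \sum_j L (x, U j c) - 1|)%:E)%E.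
Proof.
move=> my y0.
apply: (@measurable_fun_fubini_tonelli_F _ _ _ _ _ P
  (fun z : C * Om => (y z.2 * `|N^-1 * \sum_j L (z.2, U j z.1) - 1|)%:E)).
  by apply/measurable_EFinP; exact: mcovering.
by move=> z; rewrite lee_fin mulr_ge0.
Qed.

(** The weight y is not bounded. Its part up to 2 meets twice the pointwise bound, which explains
    the first three terms; the remainder r meets only the trivial bound 2 on the mean deviation. *)
Lemma soft_covering (y r : Om -> R) (M eta tail rbar : R) :
  measurable_fun setT y -> measurable_fun setT r -> 0 <= M -> 0 < eta ->
  (forall x, 0 <= r x) -> (forall x, 0 <= y x <= 2 + r x) ->
  (\int[P]_x \int[P]_u (L (x, u) * \1_[set u | M < L (x, u)] u)%:E <= tail%:E)%E ->
  (\int[P]_x (r x)%:E <= rbar%:E)%E ->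
  (\int[PC]_c \int[P]_x (y x * `|N^-1 * \sum_j L (x, U j c) - 1|)%:E <=
   (eta + M / (eta * N) + 4 * tail + 2 * rbar)%:E)%E.
Proof.
move=> my mr M0 eta0 r0 yr tailE rE.
pose e (z : C * Om) := y z.2 * `|N^-1 * \sum_j L (z.2, U j z.1) - 1|.
have me : measurable_fun setT e by exact: mcovering.
have e0 z : 0 <= e z by rewrite mulr_ge0//; case/andP: (yr z.2).
have -> : (\int[PC]_c \int[P]_x (y x * `|N^-1 * \sum_j L (x, U j c) - 1|)%:E =
    \int[P]_x \int[PC]_c (e (c, x))%:E)%E.
  apply: (@fubini_tonelli _ _ _ _ _ PC P (EFin \o e)); first exact/measurable_EFinP.
  by move=> z; rewrite lee_fin.
have m2 : measurable_fun setT (fun z : Om * Om => L z * \1_[set z | M < L z] z).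
  apply: measurable_funM => //; apply: measurable_indic.
  rewrite (_ : [set _ | _] = L @^-1` `]M, +oo[%classic).
    by rewrite -[X in measurable X]setTI; exact: mL.
  by apply/seteqP; split=> u /=; rewrite in_itv/= andbT.
have tail_ge0 x : (0 <= \int[P]_u (L (x, u) * \1_[set u | M < L (x, u)] u)%:E)%E.
  by apply: integral_ge0 => u _; rewrite lee_fin mulr_ge0// indicE.
have mtail : measurable_fun setT (fun x => \int[P]_u (L (x, u) * \1_[set u | M < L (x, u)] u)%:E)%E.
  apply: (@measurable_fun_fubini_tonelli_F _ _ _ _ _ P (fun z => (L z * \1_[set z | M < L z] z)%:E)).
    exact/measurable_EFinP.
  by move=> z; rewrite lee_fin mulr_ge0// indicE.
pose B x := ((eta + M / (eta * N))%:E +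
  4%:E * \int[P]_u (L (x, u) * \1_[set u | M < L (x, u)] u)%:E + 2%:E * (r x)%:E)%E.
apply: (@le_trans _ _ (\int[P]_x B x)%E); last first.
  have c0 : 0 <= eta + M / (eta * N).
    by rewrite addr_ge0 ?(ltW eta0)// divr_ge0// mulr_ge0// ltW.
  have m4 : measurable_fun setT (fun x => 4%:E * \int[P]_u (L (x, u) * \1_[set u | M < L (x, u)] u)%:E)%E.
    exact: measurable_funeM.
  have m2r : measurable_fun setT (fun x => 2%:E * (r x)%:E)%E.
    by apply: measurable_funeM; exact/measurable_EFinP.
  rewrite ge0_integralD//; last 3 first.
  - by move=> x _; rewrite adde_ge0 ?lee_fin// mule_ge0.
  - by apply: emeasurable_funD => //; exact: measurable_cst.
  - by move=> x _; rewrite mule_ge0// lee_fin.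
  rewrite ge0_integralD//; last by move=> x _; rewrite mule_ge0.
  have -> : (\int[P]_x (2%:E * (r x)%:E) = 2%:E * \int[P]_x (r x)%:E)%E.
    apply: ge0_integralZl_EFin => //; first by move=> x _; rewrite lee_fin.
    exact/measurable_EFinP.
  have -> : (\int[P]_x (4%:E * \int[P]_u (L (x, u) * \1_[set u | M < L (x, u)] u)%:E) =
      4%:E * \int[P]_x \int[P]_u (L (x, u) * \1_[set u | M < L (x, u)] u)%:E)%E.
    exact: ge0_integralZl_EFin.
  rewrite integral_cst//= -[X in (_ * X + _ + _)%E]/(P setT) probability_setT mule1.
  have -> : (eta + M / (eta * N) + 4 * tail + 2 * rbar)%:E =
    ((eta + M / (eta * N))%:E + 4%:E * tail%:E + 2%:E * rbar%:E)%E by rewrite -!EFinM -!EFinD.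
  by apply: leeD; [apply: leeD2l|]; apply: lee_wpmul2l => //; rewrite lee_fin.
apply: ge0_le_integral => //.
- by move=> x _; apply: integral_ge0 => c _; rewrite lee_fin.
- apply: (@measurable_fun_fubini_tonelli_G _ _ _ _ _ PC (EFin \o e)); first exact/measurable_EFinP.
  by move=> z; rewrite lee_fin.
- apply: emeasurable_funD; last by apply: measurable_funeM; exact/measurable_EFinP.
  by apply: emeasurable_funD; [exact: measurable_cst|exact: measurable_funeM].
move=> x _.
have [Lx Ex] := has_mean_ge0 (mLx x) (fun u => L0 (x, u)) (L1 x).
have [LS1 ES1] := soft_covering_pointwise (mLx x) (fun u => L0 (x, u)) Lx Ex M0 eta0.
have LI : has_mean P (fun u => L (x, u) * \1_[set u | M < L (x, u)] u).
  apply: (has_mean_dom _ _ Lx).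
    exact: (measurableT_comp m2 (pair1_measurable x)).
  by move=> u; rewrite ger0_norm ?mulr_ge0 ?indicE// ler_piMr//; case: (_ \in _).
have ES2 : mean PC (fun c => `|N^-1 * \sum_j L (x, U j c) - 1|) <= 2.
  have LU j := (mean_U j (mLx x) (fun u => L0 (x, u)) Lx).1.
  have LsU : has_mean PC (fun c => \sum_j L (x, U j c)) by exact: has_mean_sum.
  apply: (@le_trans _ _ (mean PC (fun c => N^-1 * \sum_j L (x, U j c) + 1))).
    apply: le_mean => //.
      by apply: has_meanD; [exact: has_meanZ|exact: has_mean_cst].
    move=> c; rewrite (le_trans (ler_normB _ _))// normr1 lerD2r ger0_norm//.
    by apply: mulr_ge0; [rewrite invr_ge0 ltW|apply: sumr_ge0].
  rewrite meanD ?mean_cst; [|exact: has_meanZ|exact: has_mean_cst].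
  rewrite meanZ// mean_sum// (eq_bigr (fun=> 1)) => [|j _]; last first.
    by rewrite (mean_U j (mLx x) (fun u => L0 (x, u)) Lx).2.
  by rewrite sumr_const mulVf ?gt_eqF.
have [y0 yb] := andP (yr x).
rewrite /B (meanE LI).
have -> : (\int[PC]_c (e (c, x))%:E)%E =
    (y x * mean PC (fun c => `|N^-1 * \sum_j L (x, U j c) - 1|))%:E.
  by rewrite -meanZ// -meanE//; exact: has_meanZ.
rewrite -!EFinM -!EFinD lee_fin.
move: ES1 ES2; set m := mean PC _; set q := mean P _ => ES1 ES2.
have m0 : 0 <= m by apply: mean_ge0.
have -> : M / (eta * N) = 2 * (M / (2 * eta * N)) by field; rewrite !gt_eqF.
have := ler_wpM2r m0 yb; have := ler_wpM2l (r0 x) ES2.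
set w := M / _ in ES1 *; clear -ES1.
by move: (y x) (r x) => a b; lra.
Qed.

End soft_covering.

(** * Encoders and assembly of a code *)

Section encoder.
Context d (Om : measurableType d) (R : realType) (P : probability Om R) (J : finType).
Variable l : J -> Om -> R.
Hypotheses (ml : forall j, measurable_fun setT (l j)) (l0 : forall j x, 0 <= l j x).
Hypotheses (Ll : forall j, has_mean P (l j)) (El : forall j, mean P (l j) = 1).
Hypothesis J0 : (0 < #|J|)%N.

Let N : R := #|J|%:R.
Let N0 : 0 < N. Proof. by rewrite ltr0n. Qed.

Let S x := N^-1 * \sum_j l j x.

(* The likelihood encoder, corrected so that each message has probability exactly 1/N: where the
   likelihoods sum to more than N they are scaled down, and the remaining mass [r] is spread
   proportionally to the deficits of the messages. *)
Lemma exists_uniform_encoder : exists f : J -> Om -> R,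
  [/\ forall j, measurable_fun setT (f j), forall j x, 0 <= f j x,
      forall x, \sum_j f j x = 1, forall j, mean P (f j) = N^-1 &
      forall x, \sum_j `|f j x - N^-1 * l j x| <= `|S x - 1|].
Proof.
have S0 x : 0 <= S x by apply: mulr_ge0; [rewrite invr_ge0 ltW|apply: sumr_ge0].
have mS : measurable_fun setT S.
  by apply: measurable_funM => //; exact: measurable_sum.
(* This is 1 / max(1, S), written with [expR] and [ln] so that its measurability follows from
   theirs. *)
pose q x := expR (- ln (Num.max 1 (S x))).
have mq : measurable_fun setT q.
  apply: measurableT_comp => //; apply: measurable_funN.
  by apply: (measurableT_comp (@measurable_ln R)); exact: measurable_maxr.
have max1 x : 0 < Num.max 1 (S x) by rewrite lt_max ltr01.
have qE x : q x = (Num.max 1 (S x))^-1 by rewrite /q expRN lnK ?posrE.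
have q0 x : 0 <= q x by exact: expR_ge0.
have q1 x : q x <= 1 by rewrite qE invf_le1// le_max lexx.
have qS1 x : 1 <= S x -> q x * S x = 1.
  by move=> Sx; rewrite qE (max_idPr Sx) mulVf// gt_eqF// (lt_le_trans ltr01).
have qS2 x : S x <= 1 -> q x * S x = S x.
  by move=> Sx; rewrite qE (max_idPl Sx) invr1 mul1r.
have qS x : q x * S x <= 1.
  by have [/qS1->//|/ltW Sx] := leP 1 (S x); rewrite (qS2 _ Sx).
pose f0 j x := N^-1 * (q x * l j x).
have f00 j x : 0 <= f0 j x by rewrite !mulr_ge0// invr_ge0 ltW.
have mf0 j : measurable_fun setT (f0 j).
  by apply: measurable_funM => //; exact: measurable_funM.
have f0l j x : f0 j x <= N^-1 * l j x.
  by rewrite ler_pM2l ?invr_gt0// ler_piMl.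
have Lf0 j : has_mean P (f0 j).
  apply: (has_mean_dom (mf0 j) _ (has_meanZ N^-1 (Ll j))) => x.
  by rewrite ger0_norm.
have sf0 x : \sum_j f0 j x = q x * S x.
  by rewrite -mulr_sumr -mulr_sumr mulrCA.
pose r x := 1 - q x * S x.
have r0 x : 0 <= r x by rewrite subr_ge0.
have Lqs : has_mean P (fun x => q x * S x).
  apply: (eq_has_mean sf0); exact: has_mean_sum.
have Lr : has_mean P r by apply: has_meanB => //; exact: has_mean_cst.
pose dl j := N^-1 - mean P (f0 j).
have dl0 j : 0 <= dl j.
  rewrite subr_ge0; apply: (@le_trans _ _ (mean P (fun x => N^-1 * l j x))).
    by apply: le_mean => //; exact: has_meanZ.
  by rewrite meanZ// El mulr1.
pose rho := mean P r.
have sdl : \sum_j dl j = rho.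
  rewrite /rho /r (meanB (has_mean_cst P 1) Lqs) mean_cst.
  rewrite -(eq_mean _ sf0) mean_sum// /dl sumrB sumr_const -[_ *+ _]mulr_natl mulfV//.
  by rewrite gt_eqF.
(* If no mass remains, all deficits vanish and any weights of sum 1 will do. *)
pose wt j := if rho == 0 then N^-1 else dl j / rho.
have rho0 : 0 <= rho by exact: mean_ge0.
have wt0 j : 0 <= wt j.
  by rewrite /wt; case: ifP => _; [rewrite invr_ge0 ltW|rewrite divr_ge0].
have swt : \sum_j wt j = 1.
  rewrite /wt; have [_|rn0] := eqVneq rho 0.
    by rewrite sumr_const -[_ *+ _]mulr_natl mulfV// gt_eqF.
  by rewrite -mulr_suml sdl divff.
exists (fun j x => f0 j x + wt j * r x); split.
- move=> j; apply: measurable_funD => //; apply: measurable_funM => //.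
  by apply: measurable_funB => //; exact: measurable_funM.
- by move=> j x; rewrite addr_ge0// mulr_ge0.
- by move=> x; rewrite big_split/= sf0 -mulr_suml swt mul1r /r addrCA subrr addr0.
- move=> j; rewrite (meanD (Lf0 j) (has_meanZ (wt j) Lr)) (meanZ (wt j) Lr).
  suff -> : wt j * rho = dl j by rewrite /dl addrCA subrr addr0.
  rewrite /wt; have [rh0|rn0] := eqVneq rho 0; last by rewrite divfK.
  rewrite rh0 mulr0; apply/esym/eqP.
  have /eqP := sdl; rewrite rh0 psumr_eq0; last by move=> k _.
  by move=> /allP/(_ j (mem_index_enum _)).
(* The mass removed adds up to S - q S and the mass added to 1 - q S. As q S = min(1, S), the total
   is exactly |S - 1|. *)
- move=> x; apply: (@le_trans _ _ (\sum_j ((N^-1 * l j x - f0 j x) + wt j * r x))).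
    apply: ler_sum => j _.
    have -> : f0 j x + wt j * r x - N^-1 * l j x = wt j * r x - (N^-1 * l j x - f0 j x) by ring.
    rewrite (le_trans (ler_normB _ _))// addrC lerD// ger0_norm ?mulr_ge0//.
    by rewrite subr_ge0.
  rewrite big_split/= sumrB -mulr_sumr -/(S x) sf0 -mulr_suml swt mul1r /r.
  have [Sx|/ltW Sx] := leP 1 (S x).
    by rewrite qS1// ger0_norm; lra.
  by rewrite qS2// ler0_norm; lra.
Qed.

Variables (n : nat) (X : 'I_n -> Om -> R) (m : J -> 'I_n -> R).
Hypotheses (n0 : (0 < n)%N) (mX : forall t, measurable_fun setT (X t)).
Hypotheses (LX : forall t, has_mean P (fun x => X t x ^+ 2)).
Hypothesis LXl : forall j t, has_mean P (fun x => X t x ^+ 2 * l j x).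
Hypothesis EXl : forall j t, mean P (fun x => X t x * l j x) = m j t.
Variable f : J -> Om -> R.
Hypotheses (mf : forall j, measurable_fun setT (f j)) (f0 : forall j x, 0 <= f j x).
Hypotheses (f1 : forall x, \sum_j f j x = 1) (Ef : forall j, mean P (f j) = N^-1).
Hypothesis fl : forall x, \sum_j `|f j x - N^-1 * l j x| <= `|S x - 1|.

Let y x := n%:R^-1 * \sum_t X t x ^+ 2.

(** Since f_j has mean 1/N, N E[X f_j] is the mean of X given the message j, and [m j] is the mean
    under the ideal channel. Cauchy-Schwarz against |f_j - l_j/N|, of mass at most 2/N, leaves X^2
    |f_j - l_j/N|; summing over j recovers the covering error weighted by the power. *)
Lemma encoder_mean_error : has_mean P (fun x => y x * `|S x - 1|) ->
  (N * n%:R)^-1 * \sum_j \sum_t (N * mean P (fun x => X t x * f j x) - m j t) ^+ 2 <=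
  2 * mean P (fun x => y x * `|S x - 1|).
Proof.
move=> LyS; pose h j x := f j x - N^-1 * l j x.
have nR : 0 < n%:R :> R by rewrite ltr0n.
have fle j x : f j x <= 1 by rewrite -(f1 x) (bigD1 j)//= lerDl sumr_ge0.
have Lf j : has_mean P (f j).
  by apply: (has_mean_dom (mf j) _ (has_mean_cst P 1)) => x; rewrite ger0_norm.
have mh j : measurable_fun setT (h j).
  by apply: measurable_funB => //; exact: measurable_funM.
have Lh j : has_mean P (h j) by apply: has_meanB => //; exact: has_meanZ.
have mabs j : measurable_fun setT (fun x => `|h j x|) by exact: measurableT_comp.
have hle j x : `|h j x| <= f j x + N^-1 * l j x.
  by rewrite (le_trans (ler_normB _ _))// !ger0_norm// mulr_ge0// invr_ge0 ltW.
have Ehle j : mean P (fun x => `|h j x|) <= 2 / N.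
  apply: (@le_trans _ _ (mean P (fun x => f j x + N^-1 * l j x))).
    apply: le_mean => //; first exact: has_mean_norm.
    by apply: has_meanD => //; exact: has_meanZ.
  rewrite meanD//; last exact: has_meanZ.
  by rewrite meanZ// El Ef mulr1; lra.
have LXh j t : has_mean P (fun x => X t x ^+ 2 * `|h j x|).
  apply: (has_mean_dom _ _ (has_meanD (LX t) (has_meanZ N^-1 (LXl j t)))).
    by apply: measurable_funM => //; exact: measurable_funX.
  move=> x; rewrite ger0_norm; last by rewrite mulr_ge0 ?sqr_ge0.
  apply: (le_trans (ler_wpM2l (sqr_ge0 _) (hle j x))).
  by rewrite mulrDr [_ * (_^-1 * _)]mulrCA lerD2r ler_piMr ?sqr_ge0.
have LXf j t : has_mean P (fun x => X t x * f j x).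
  apply: (has_mean_dom _ _ (has_mean_norm (has_mean_sqr (mX t) (LX t)))).
    exact: measurable_funM.
  by move=> x; rewrite normrM ler_piMr// ger0_norm.
have LXl1 j t : has_mean P (fun x => X t x * l j x).
  have [] := @sqr_mean_le _ _ _ P (l j) (X t) (mX t) (Ll j) => //.
  by apply: (eq_has_mean _ (LXl j t)) => x; rewrite ger0_norm.
have err j t : (N * mean P (fun x => X t x * f j x) - m j t) ^+ 2 <=
    2 * N * mean P (fun x => X t x ^+ 2 * `|h j x|).
  have -> : N * mean P (fun x => X t x * f j x) - m j t = N * mean P (fun x => X t x * h j x).
    rewrite -EXl; have -> : mean P (fun x => X t x * h j x) =
        mean P (fun x => X t x * f j x) - N^-1 * mean P (fun x => X t x * l j x).
      rewrite -meanZ// -meanB//; last exact: has_meanZ.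
      by apply: eq_mean => x; rewrite /h; ring.
    by field; rewrite gt_eqF.
  have [_ CS] := sqr_mean_le (mX t) (Lh j) (LXh j t).
  rewrite exprMn.
  have A0 : 0 <= mean P (fun x => X t x ^+ 2 * `|h j x|).
    by apply: mean_ge0 => x; rewrite mulr_ge0 ?sqr_ge0.
  apply: (le_trans (ler_wpM2l (sqr_ge0 N) (le_trans CS (ler_wpM2l A0 (Ehle j))))).
  by rewrite le_eqVlt; apply/orP; left; apply/eqP; field; rewrite gt_eqF.
apply: (@le_trans _ _ ((N * n%:R)^-1 * \sum_j \sum_t (2 * N * mean P (fun x => X t x ^+ 2 * `|h j x|)))).
  rewrite ler_wpM2l ?invr_ge0 ?mulr_ge0 ?(ltW N0)//.
  by apply: ler_sum => j _; apply: ler_sum => t _; exact: err.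
have Lyh j : has_mean P (fun x => y x * `|h j x|).
  apply: (eq_has_mean _ (has_meanZ n%:R^-1 (has_mean_sum (index_enum 'I_n) (LXh j)))) => x.
  by rewrite /y -mulrA mulr_suml.
have -> : (N * n%:R)^-1 * \sum_j \sum_t (2 * N * mean P (fun x => X t x ^+ 2 * `|h j x|)) =
    2 * mean P (fun x => \sum_j y x * `|h j x|).
  rewrite mean_sum//.
  have E j : mean P (fun x => y x * `|h j x|) =
      n%:R^-1 * \sum_t mean P (fun x => X t x ^+ 2 * `|h j x|).
    rewrite -mean_sum// -meanZ; last exact: has_mean_sum.
    by apply: eq_mean => x; rewrite /y -mulrA mulr_suml.
  rewrite (eq_bigr _ (fun j _ => E j)) !mulr_sumr; apply: eq_bigr => j _.
  by rewrite -mulr_sumr; set s := \sum_t _; field; rewrite !gt_eqF.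
rewrite ler_pM2l//; apply: le_mean => //; first exact: has_mean_sum.
move=> x; rewrite -mulr_sumr; apply: ler_wpM2l; last exact: fl.
by apply: mulr_ge0; [rewrite invr_ge0|apply: sumr_ge0 => t _; exact: sqr_ge0].
Qed.

End encoder.

Lemma exists_probability_of_mass1 d (T : measurableType d) (R : realType)
    (m : {measure set T -> \bar R}) :
  m setT = 1%E -> exists Q : probability T R, forall A, Q A = m A.
Proof.
move=> m1; exists (mnormalize m (dirac point)) => A.
by rewrite -[LHS]/(mnormalize m (dirac point) A) /mnormalize m1 onee_eq0/= invr1 mule1.
Qed.

Lemma integral_product_mul d1 d2 (T1 : measurableType d1) (T2 : measurableType d2) (R : realType)
    (P1 : probability T1 R) (P2 : probability T2 R) (F : T1 -> R) (G : T2 -> R) :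
  (forall x, 0 <= F x) -> (forall y, 0 <= G y) -> has_mean P1 F -> has_mean P2 G ->
  (\int[P1 \x P2]_z (F z.1 * G z.2)%:E = (mean P1 F * mean P2 G)%:E)%E.
Proof.
move=> F0 G0 LF LG; have mF := has_mean_measurable LF; have mG := has_mean_measurable LG.
transitivity (\int[P1]_x \int[P2]_y (F x * G y)%:E)%E.
  apply: (@fubini_tonelli1 _ _ _ _ _ P1 P2 (fun z => (F z.1 * G z.2)%:E)).
    apply/measurable_EFinP; apply: measurable_funM.
      exact: (measurableT_comp mF measurable_fst).
    exact: (measurableT_comp mG measurable_snd).
  by move=> z; rewrite lee_fin mulr_ge0.
transitivity (\int[P1]_x (mean P2 G * F x)%:E)%E.
  by apply: eq_integral => x _; rewrite (meanE (has_meanZ (F x) LG)) meanZ// mulrC.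
by rewrite (meanE (has_meanZ (mean P2 G) LF)) meanZ// mulrC.
Qed.

(** * Gluing encoder and decoder along the messages *)

Section code_assembly.
Context d (Om : measurableType d) (R : realType) (P : probability Om R).
Variables (a b n : nat) (f g : 'I_a * 'I_b -> Om -> R) (X : 'I_n -> Om -> R).
Local Notation I := ('I_a * 'I_b)%type.
Hypotheses (a0 : (0 < a)%N) (b0 : (0 < b)%N) (n0 : (0 < n)%N).
Hypotheses (mf : forall i, measurable_fun setT (f i)) (mg : forall i, measurable_fun setT (g i)).
Hypotheses (f0 : forall i x, 0 <= f i x) (g0 : forall i x, 0 <= g i x).
Hypotheses (f1 : forall k x, \sum_j f (j, k) x = 1) (g1 : forall x, \sum_i g i x = 1).
Hypotheses (Ef : forall i, mean P (f i) = a%:R^-1) (Eg : forall i, mean P (g i) = (a%:R * b%:R)^-1).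
Hypothesis mX : forall t, measurable_fun setT (X t).
Hypothesis Xlaw : forall A : 'I_n -> set R, (forall t, measurable (A t)) ->
  P [set w | forall t, A t (X t w)] = (\prod_t normal_prob 0 1 (A t))%E.

Let aR : 0 < a%:R :> R. Proof. by rewrite ltr0n. Qed.
Let bR : 0 < b%:R :> R. Proof. by rewrite ltr0n. Qed.
Let nR : 0 < n%:R :> R. Proof. by rewrite ltr0n. Qed.

(** Joint density of (X^n, Y^n, i) when X^n and Y^n are independent given i: the product of 1/(ab),
    the conditional density a f_i and the conditional density ab g_i. *)
Let h i (z : Om * Om) : R := a%:R * (f i z.1 * g i z.2).

Let h0 i z : 0 <= h i z. Proof. by rewrite !mulr_ge0// ltW. Qed.

Let mh i : measurable_fun setT (h i).
Proof.
apply: measurable_funM => //; apply: measurable_funM.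
  exact: (measurableT_comp (mf i) measurable_fst).
exact: (measurableT_comp (mg i) measurable_snd).
Qed.

Let Z : measurableType _ := ((Om * Om) * nat)%type.

Let incl m (z : Om * Om) : Z := (z, m).

Let mincl m : measurable_fun setT (incl m). Proof. exact: pair2_measurable. Qed.

(** The message pair is stored in the sample space as its rank. Only ranks below [#|{: I}|] carry
    mass, so the default pair never matters. *)
Let dec m : I := nth (Ordinal a0, Ordinal b0) (enum {: I}) m.

Let Qm : {measure set Z -> \bar R} :=
  msum (fun m => image_measure (density_measure (P \x P)%E (mh (dec m)) (h0 (dec m))) (mincl m)) #|{: I}|.

Let sum_dec (V : nmodType) (F : I -> V) : (\sum_(m < #|{: I}|) F (dec m) = \sum_i F i)%R.
Proof.
rewrite -[RHS]big_enum/= (big_nth (Ordinal a0, Ordinal b0)) big_mkord.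
by rewrite -cardE.
Qed.

Let fle i x : f i x <= 1.
Proof. by case: i => j k; rewrite -(f1 k x) (bigD1 j)//= lerDl sumr_ge0. Qed.

Let gle i x : g i x <= 1.
Proof. by rewrite -(g1 x) (bigD1 i)//= lerDl sumr_ge0. Qed.

Let Lf i : has_mean P (f i).
Proof. by apply: (has_mean_dom (mf i) _ (has_mean_cst P 1)) => x; rewrite ger0_norm. Qed.

Let Lg i : has_mean P (g i).
Proof. by apply: (has_mean_dom (mg i) _ (has_mean_cst P 1)) => x; rewrite ger0_norm. Qed.

Let al A i := mean P (fun x => \1_A x * f i x).
Let be A i := mean P (fun x => \1_A x * g i x).

Let alT i : al setT i = a%:R^-1.
Proof. by rewrite -(Ef i); apply: eq_mean => x; rewrite indicT mul1r. Qed.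

Let beT i : be setT i = (a%:R * b%:R)^-1.
Proof. by rewrite -(Eg i); apply: eq_mean => x; rewrite indicT mul1r. Qed.

Let sum_al A k : measurable A -> \sum_j al A (j, k) = fine (P A).
Proof.
move=> mA; rewrite -mean_sum => [|j]; last exact: has_mean_indic.
rewrite -(mean_indic P mA).2; apply: eq_mean => x.
by rewrite -mulr_sumr f1 mulr1.
Qed.

Let sum_be A : measurable A -> \sum_i be A i = fine (P A).
Proof.
move=> mA; rewrite -mean_sum => [|j]; last exact: has_mean_indic.
rewrite -(mean_indic P mA).2; apply: eq_mean => x.
by rewrite -mulr_sumr g1 mulr1.
Qed.

(** On an event that restricts X^n, Y^n and the message separately, each message contributes a
    product. The marginals, the independence of K and X^n, and the Markov chain are all read off
    this formula. *)
Let QmE (A B : set Om) (K : pred I) : measurable A -> measurable B ->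
  Qm [set z | [/\ A z.1.1, B z.1.2 & K (dec z.2)]] = (\sum_(i | K i) a%:R * (al A i * be B i))%:E.
Proof.
move=> mA mB; rewrite /Qm /msum -sumEFin [RHS]big_mkcond/=.
rewrite -(sum_dec (fun i => if K i then (a%:R * (al A i * be B i))%:E else 0%E)).
apply: eq_bigr => m _; rewrite image_measureE /=.
case: ifPn => Kd; last first.
  rewrite (_ : _ @^-1` _ = set0) ?measure0//; apply/seteqP; split=> // z [_ _].
  by rewrite (negbTE Kd).
rewrite (_ : _ @^-1` _ = A `*` B); last first.
  by apply/seteqP; split=> [z [] //|z [Az Bz]]; split.
transitivity (\int[(P \x P)%E]_(z in A `*` B) (h (dec m) z)%:E)%E; first by [].
rewrite integral_mkcond.
transitivity (\int[(P \x P)%E]_z ((a%:R * (\1_A z.1 * f (dec m) z.1)) * (\1_B z.2 * g (dec m) z.2))%:E)%E.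
  apply: eq_integral => z _; rewrite patchE /h !indicE in_setX.
  by case: (_ \in A); case: (_ \in B); rewrite /= ?mul1r ?mul0r ?mulr0//; congr EFin; ring.
rewrite (@integral_product_mul _ _ _ _ _ P P (fun x => a%:R * (\1_A x * f (dec m) x))
  (fun x => \1_B x * g (dec m) x)).
- by rewrite meanZ -?mulrA//; exact: has_mean_indic.
- by move=> x; rewrite !mulr_ge0 ?indicE// ltW.
- by move=> x; rewrite mulr_ge0 ?indicE.
- by apply: has_meanZ; exact: has_mean_indic.
- exact: has_mean_indic.
Qed.

Let ge0_integral_Qm (F : Om -> Om -> R) : measurable_fun setT (fun z : Om * Om => F z.1 z.2) ->
  (forall x y, 0 <= F x y) ->
  (\int[Qm]_z (F z.1.1 z.1.2)%:E =
   \sum_i \int[P]_x \int[P]_y (a%:R * (f i x * g i y) * F x y)%:E)%E.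
Proof.
move=> mF F0.
have mFZ : measurable_fun setT (fun z : Z => (F z.1.1 z.1.2)%:E).
  by apply/measurable_EFinP; exact: (measurableT_comp mF measurable_fst).
rewrite /Qm ge0_integral_measure_sum//; last by move=> z _; rewrite lee_fin.
rewrite -(sum_dec (fun i => \int[P]_x \int[P]_y (a%:R * (f i x * g i y) * F x y)%:E)%E).
apply: eq_bigr => m _.
transitivity (\int[density_measure (P \x P)%E (mh (dec m)) (h0 (dec m))]_z (F z.1 z.2)%:E)%E.
  by apply: (ge0_integral_image_measure _ (mincl m) mFZ) => z; rewrite lee_fin.
transitivity (\int[(P \x P)%E]_z ((h (dec m) z)%:E * (F z.1 z.2)%:E))%E.
  apply: ge0_integral_density; first exact/measurable_EFinP.
  by move=> z; rewrite lee_fin.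
apply: (@fubini_tonelli1 _ _ _ _ _ P P (fun z => ((h (dec m) z)%:E * (F z.1 z.2)%:E)%E)).
  by apply: emeasurable_funM; exact/measurable_EFinP.
by move=> z; rewrite mule_ge0 ?lee_fin.
Qed.

Let Xmarg t A : measurable A -> P (X t @^-1` A) = normal_prob 0 1 A.
Proof.
move=> mA; pose cyl t' := if t' == t then A else setT.
have -> : X t @^-1` A = [set w | forall t', cyl t' (X t' w)].
  apply/seteqP; split=> w /= H; last by have := H t; rewrite /cyl eqxx.
  by move=> t'; rewrite /cyl; case: eqP => [->|].
rewrite Xlaw => [|t']; last by rewrite /cyl; case: ifP.
rewrite (bigD1 t)//= {1}/cyl eqxx big1 ?mule1// => i /negbTE it.
by rewrite /cyl it; exact: (@probability_setT _ _ _ (normal_prob 0 1)).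
Qed.

Let X2 t : has_mean P (fun x => X t x ^+ 2) /\ mean P (fun x => X t x ^+ 2) = 1.
Proof.
have [L2 E2] := normal_standard_sqr R.
have Xl (A : set R) : measurable A ->
    P (X t @^-1` A) = (\int[normal_prob 0 1]_(x in A) (cst 1 x)%:E)%E.
  move=> mA; rewrite Xmarg// (_ : (fun x => _) = cst 1%E)//.
  by rewrite integral_cst// mul1e.
have m1 : measurable_fun setT (cst 1 : R -> R) by exact: measurable_cst.
have L2' : has_mean (normal_prob 0 1) (fun r : R => cst 1 r * r ^+ 2).
  by apply: (eq_has_mean _ L2) => r; rewrite mul1r.
have msq : measurable_fun setT (fun r : R => r ^+ 2) by [].
have [LX EX] := mean_law_density (mX t) m1 (fun=> ler01) Xl msq L2'.
split=> //; apply: (eq_trans EX); rewrite -[RHS]E2; apply: eq_mean => r.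
by rewrite mul1r.
Qed.

Variables (mu sX s : R).
Hypotheses (sX0 : 0 < sX) (s0 : 0 < s).

(** The correlation of coordinate t under the glued law. The same map X appears twice because both
    sequences live on copies of [Om]. *)
Let cross t : R := \sum_i a%:R * (mean P (fun x => X t x * f i x) * mean P (fun x => X t x * g i x)).

Let distortion t :
  (\int[Qm]_z ((mu + sX * X t z.1.1 - (mu + s * X t z.1.2)) ^+ 2)%:E =
   (sX ^+ 2 + s ^+ 2 - 2 * sX * s * cross t)%:E)%E.
Proof.
have [L2 E2] := X2 t; have L1 := has_mean_sqr (mX t) L2.
have Lbound (u : Om -> R) : measurable_fun setT u -> (forall x, 0 <= u x) -> (forall x, u x <= 1) ->
    has_mean P (fun x => X t x * u x) /\ has_mean P (fun x => X t x ^+ 2 * u x).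
  move=> um u0 u1; split.
    apply: (has_mean_dom _ _ (has_mean_norm L1)); first exact: measurable_funM.
    by move=> x; rewrite normrM ler_piMr// ger0_norm.
  apply: (has_mean_dom _ _ L2).
    by apply: measurable_funM => //; exact: measurable_funX.
  by move=> x; rewrite normrM ger0_norm ?sqr_ge0// ler_piMr ?sqr_ge0// ger0_norm.
rewrite (@ge0_integral_Qm (fun x y => (mu + sX * X t x - (mu + s * X t y)) ^+ 2)); last 2 first.
- apply: measurable_funX; apply: measurable_funB; apply: measurable_funD => //;
    apply: measurable_funM => //.
    exact: (measurableT_comp (mX t) measurable_fst).
  exact: (measurableT_comp (mX t) measurable_snd).
- by move=> x y; exact: sqr_ge0.
pose F2 i := mean P (fun x => X t x ^+ 2 * f i x); pose G2 i := mean P (fun x => X t x ^+ 2 * g i x).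
pose F1 i := mean P (fun x => X t x * f i x); pose G1 i := mean P (fun x => X t x * g i x).
have LF i := Lbound _ (mf i) (f0 i) (fle i); have LG i := Lbound _ (mg i) (g0 i) (gle i).
have cell i : (\int[P]_x \int[P]_y (a%:R * (f i x * g i y) *
      (mu + sX * X t x - (mu + s * X t y)) ^+ 2)%:E)%E =
    (sX ^+ 2 * b%:R^-1 * F2 i + s ^+ 2 * G2 i - 2 * sX * s * (a%:R * (F1 i * G1 i)))%:E.
  pose inner x := (a%:R * f i x) *
    (sX ^+ 2 * X t x ^+ 2 * (a%:R * b%:R)^-1 - 2 * sX * s * X t x * G1 i + s ^+ 2 * G2 i).
  transitivity (\int[P]_x (inner x)%:E)%E.
    apply: eq_integral => x _.
    have LA := has_meanZ (sX ^+ 2 * X t x ^+ 2) (Lg i).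
    have LB := has_meanZ (2 * sX * s * X t x) (LG i).1.
    have LC := has_meanZ (s ^+ 2) (LG i).2.
    have LAB := has_meanB LA LB.
    have LALL := has_meanZ (a%:R * f i x) (has_meanD LAB LC).
    transitivity (\int[P]_y (a%:R * f i x * (sX ^+ 2 * X t x ^+ 2 * g i y -
       2 * sX * s * X t x * (X t y * g i y) + s ^+ 2 * (X t y ^+ 2 * g i y)))%:E)%E.
      by apply: eq_integral => y _; congr EFin; ring.
    rewrite (meanE LALL) meanZ; last exact: has_meanD.
    by rewrite (meanD LAB LC) (meanB LA LB) !meanZ ?Eg//; [exact: (LG i).2|exact: (LG i).1].
  have LA := has_meanZ (sX ^+ 2 * b%:R^-1) (LF i).2.
  have LB := has_meanZ (2 * sX * s * (a%:R * G1 i)) (LF i).1.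
  have LC := has_meanZ (s ^+ 2 * a%:R * G2 i) (Lf i).
  have LAB := has_meanB LA LB.
  rewrite (@eq_integral _ _ _ P setT (fun x => (sX ^+ 2 * b%:R^-1 * (X t x ^+ 2 * f i x) -
    2 * sX * s * (a%:R * G1 i) * (X t x * f i x) + s ^+ 2 * a%:R * G2 i * f i x)%:E)); last first.
    by move=> x _; congr EFin; rewrite /inner; field; rewrite !gt_eqF.
  rewrite (meanE (has_meanD LAB LC)) (meanD LAB LC) (meanB LA LB) !meanZ ?Ef//;
    [|exact: (LF i).1|exact: (LF i).2].
  rewrite -/(F2 i) -/(F1 i); congr EFin.
  by field; rewrite !gt_eqF.
rewrite (eq_bigr _ (fun i _ => cell i)) sumEFin sumrB big_split/= -!mulr_sumr.
have -> : \sum_i F2 i = b%:R.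
  rewrite (eq_bigr (fun i => F2 (i.1, i.2))) => [|[]//].
  rewrite -(pair_big xpredT xpredT (fun j k => F2 (j, k)))/= exchange_big/=.
  rewrite (eq_bigr (fun=> 1)) => [|k _].
    by rewrite sumr_const card_ord.
  rewrite -mean_sum => [|j]; last exact: (LF _).2.
  rewrite -[RHS]E2; apply: eq_mean => x.
  by rewrite -mulr_sumr f1 mulr1.
have -> : \sum_i G2 i = 1.
  rewrite -mean_sum => [|i]; last exact: (LG i).2.
  by rewrite -[RHS]E2; apply: eq_mean => x; rewrite -mulr_sumr g1 mulr1.
by rewrite mulfVK ?gt_eqF// mulr1 /cross -!mulr_sumr.
Qed.

Lemma code_achievable (Rr Rc Pp kappa : R) :
  ln a%:R / n%:R <= Rr -> ln b%:R / n%:R <= Rc -> psi sX s <= Pp ->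
  kappa <= n%:R^-1 * \sum_t cross t ->
  achievable mu sX Rr Rc Pp (sX ^+ 2 + s ^+ 2 - 2 * sX * s * kappa).
Proof.
move=> lna lnb psiP kE.
have PT : P setT = 1%E by exact: probability_setT.
have QmT : Qm setT = 1%E.
  have := @QmE setT setT xpredT measurableT measurableT.
  rewrite (_ : [set _ | _] = setT); last by apply/seteqP; split.
  move=> ->; congr EFin.
  rewrite (eq_bigr (fun i => be setT i)) => [|i _]; last by rewrite alT mulrA divff ?mul1r ?gt_eqF.
  by rewrite sum_be// PT.
have [Q QE] := exists_probability_of_mass1 QmT.
pose XX t (z : Z) := mu + sX * X t z.1.1; pose YY t (z : Z) := mu + s * X t z.1.2.
pose J (z : Z) := (dec z.2).1; pose K (z : Z) := (dec z.2).2.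
pose pre (r : R) (A : 'I_n -> set R) := [set x | forall t, A t (mu + r * X t x)].
have mpre r A : (forall t, measurable (A t)) -> measurable (pre r A).
  move=> mA; apply: (@measurable_cylinder _ _ _ _ _ (fun t x => mu + r * X t x)) => // t.
  by apply: measurable_funD => //; exact: measurable_funM.
have Ppre r A : 0 < r -> (forall t, measurable (A t)) ->
    P (pre r A) = (\prod_t normal_prob mu r (A t))%E.
  move=> r0 mA; have maff : measurable_fun setT (fun x : R => mu + r * x).
    by apply: measurable_funD => //; exact: measurable_funM.
  rewrite /pre (@Xlaw (fun t => [set x | A t (mu + r * x)])).
    by apply: eq_bigr => t _; rewrite (normal_prob_affine mu r0 (mA t)).
  by move=> t; rewrite -[X in measurable X]setTI; exact: maff.
(* The law conditions of [achievable] concern only events of this form, up to rescaling the sets. *)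
have QR (A B : set Om) (S : pred I) E : measurable A -> measurable B ->
    E = [set z : Z | [/\ A z.1.1, B z.1.2 & S (dec z.2)]] ->
    Q E = (\sum_(i | S i) a%:R * (al A i * be B i))%:E.
  by move=> mA mB ->; rewrite QE QmE.
have QY B : (forall t, measurable (B t)) ->
    Q [set z | forall t, B t (YY t z)] = P (pre s B).
  move=> mB; rewrite (QR setT (pre s B) xpredT) => [|//||]; [|exact: mpre|].
    rewrite (eq_bigr (fun i => be (pre s B) i)) => [|i _].
      by rewrite sum_be ?fineK ?fin_num_measure//; exact: mpre.
    by rewrite alT mulrA divff ?mul1r ?gt_eqF.
  by apply/seteqP; split=> [z Bz|z [_ Bz _]].
have QX A : (forall t, measurable (A t)) ->
    Q [set z | forall t, A t (XX t z)] = P (pre sX A).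
  move=> mA; rewrite (QR (pre sX A) setT xpredT) => [||//|]; [|exact: mpre|].
    rewrite (eq_bigr (fun i => b%:R^-1 * al (pre sX A) (i.1, i.2))) => [|[j k] _].
      rewrite -(pair_big xpredT xpredT (fun j k => b%:R^-1 * al (pre sX A) (j, k)))/= exchange_big/=.
      rewrite (eq_bigr (fun=> b%:R^-1 * fine (P (pre sX A)))) => [|k _].
        rewrite sumr_const card_ord -[_ *+ b]mulr_natl mulrA divff ?gt_eqF// mul1r fineK//.
        by rewrite fin_num_measure//; exact: mpre.
      by rewrite -mulr_sumr sum_al//; exact: mpre.
    by rewrite /= beT; field; rewrite !gt_eqF.
  by apply/seteqP; split=> [z Bz|z [Bz _ _]].
have QYt t B : measurable B -> Q (YY t @^-1` B) = normal_prob mu s B.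
  move=> mB; pose cyl t' := if t' == t then B else setT.
  have mcyl t' : measurable (cyl t') by rewrite /cyl; case: ifP.
  have -> : YY t @^-1` B = [set z | forall t', cyl t' (YY t' z)].
    apply/seteqP; split=> w /= H; last by have := H t; rewrite /cyl eqxx.
    by move=> t'; rewrite /cyl; case: eqP => [->|].
  rewrite QY// Ppre// (bigD1 t)//= {1}/cyl eqxx big1 ?mule1// => i /negbTE it.
  by rewrite /cyl it; exact: (@probability_setT _ _ _ (normal_prob mu s)).
exists n, a, b, _, Z, Q, XX, YY, J, K.
have mXfst t (r : R) : measurable_fun setT (fun z : Z => mu + r * X t z.1.1).
  apply: measurable_funD => //; apply: measurable_funM => //.
  apply: (measurableT_comp (mX t)).
  exact: (measurableT_comp measurable_fst measurable_fst).
have mXsnd t (r : R) : measurable_fun setT (fun z : Z => mu + r * X t z.1.2).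
  apply: measurable_funD => //; apply: measurable_funM => //.
  apply: (measurableT_comp (mX t)).
  exact: (measurableT_comp measurable_snd measurable_fst).
have msnd (S : set nat) : measurable ([set z : Z | S z.2]).
  by rewrite -[X in measurable X]setTI; exact: (@measurable_snd _ _ (Om * Om)%type nat).
split; [by split|split; [split|split; [|split; [|split; [|split; [|split; [|split]]]]]]].
- by move=> t; exact: mXfst.
- by move=> t; exact: mXsnd.
- by move=> j; exact: (msnd [set m | (dec m).1 = j]).
- by move=> k; exact: (msnd [set m | (dec m).2 = k]).
- by move=> A mA; rewrite QX// Ppre.
- move=> k A mA; rewrite QX// (QR (pre sX A) setT (fun i => i.2 == k)) => [||//|]; [|exact: mpre|].
    transitivity ((\sum_(j : 'I_a) a%:R * (al (pre sX A) (j, k) * be setT (j, k)))%:E).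
      congr EFin; rewrite (eq_bigr (fun i => a%:R * (al (pre sX A) (i.1, i.2) * be setT (i.1, i.2))));
        last by case.
      rewrite -(pair_big xpredT (fun k' => k' == k)
        (fun j k' => a%:R * (al (pre sX A) (j, k') * be setT (j, k'))))/=.
      by apply: eq_bigr => j _; rewrite big_pred1_eq.
    rewrite (eq_bigr (fun j => b%:R^-1 * al (pre sX A) (j, k))) => [|j _].
      by rewrite -mulr_sumr sum_al ?EFinM ?fineK ?fin_num_measure//; exact: mpre.
    by rewrite beT; field; rewrite !gt_eqF.
  apply/seteqP; split=> [z [Kz Az]|z [Az _ /eqP Kz]]; first by split=> //; apply/eqP.
  by split.
- move=> j k A B mA mB.
  have sum1 (F : I -> R) : \sum_(i | i == (j, k)) F i = F (j, k) by rewrite big_pred1_eq.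
  rewrite (QR (pre sX A) (pre s B) (pred1 (j, k)) _ (mpre _ _ mA) (mpre _ _ mB)); last first.
    apply/seteqP; split=> [z [[Az [Jz Kz]] Bz]|z [Az Bz /eqP jk]].
      by split=> //; apply/eqP; rewrite [dec _]surjective_pairing -Jz -Kz.
    by split=> //; split=> //=; rewrite /J /K /= jk.
  rewrite (QR setT setT (pred1 (j, k)) _ measurableT measurableT); last first.
    apply/seteqP; split=> [z [Jz Kz]|z [_ _ /eqP jk]].
      by split=> //; apply/eqP; rewrite [dec _]surjective_pairing -Jz -Kz.
    by rewrite /J /K /= jk.
  rewrite (QR (pre sX A) setT (pred1 (j, k)) _ (mpre _ _ mA) measurableT); last first.
    apply/seteqP; split=> [z [Az [Jz Kz]]|z [Az _ /eqP jk]].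
      by split=> //; apply/eqP; rewrite [dec _]surjective_pairing -Jz -Kz.
    by split=> //; rewrite /J /K /= jk.
  rewrite (QR setT (pre s B) (pred1 (j, k)) _ measurableT (mpre _ _ mB)); last first.
    apply/seteqP; split=> [z [[Jz Kz] Bz]|z [_ Bz /eqP jk]].
      by split=> //; apply/eqP; rewrite [dec _]surjective_pairing -Jz -Kz.
    by split=> //; rewrite /J /K /= jk.
  by rewrite !sum1 -!EFinM alT beT; congr EFin; ring.
- move=> B mB; rewrite QY// Ppre//; apply: eq_bigr => t _; exact/esym/QYt.
- by move=> t t' B mB; rewrite !QYt.
- rewrite (eq_bigr (fun t => (sX ^+ 2 + s ^+ 2 - 2 * sX * s * cross t)%:E)) => [|t _].
    rewrite sumEFin -EFinM lee_fin sumrB sumr_const card_ord -[(sX ^+ 2 + s ^+ 2) *+ n]mulr_natl.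
    rewrite mulrBr mulKf ?gt_eqF// lerD2l lerN2 -mulr_sumr mulrCA ler_wpM2l//.
    by rewrite !mulr_ge0// ltW.
  rewrite -distortion; apply: eq_measure_integral => A _ _; exact: QE.
- rewrite (eq_bigr (fun=> (psi sX s)%:E)) => [|t _]; last exact: (@KL_normal _ _ mu s sX s0 sX0 (QYt t)).
  by rewrite sumEFin sumr_const card_ord -EFinM -[psi sX s *+ n]mulr_natl mulKf ?gt_eqF.
Qed.

End code_assembly.

(** * The Gaussian kernel *)

Section gaussian_kernel.
Context (R : realType).
Variables (rho s : R).
Hypotheses (s0 : 0 < s) (rs : rho ^+ 2 + s ^+ 2 = 1).
Local Notation N01 := (normal_prob (0 : R) 1).

(* Density of (x, u) with respect to N(0,1) x N(0,1) when (x, u) is a standard Gaussian pair with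
   correlation [rho]. *)
Definition gauss_kernel (x u : R) : R :=
  s^-1 * expR ((2 * rho * x * u - rho ^+ 2 * x ^+ 2 - rho ^+ 2 * u ^+ 2) / (2 * s ^+ 2)).

Lemma gauss_kernel_gt0 x u : 0 < gauss_kernel x u.
Proof. by rewrite mulr_gt0 ?invr_gt0// expR_gt0. Qed.

Lemma gauss_kernel_ge0 x u : 0 <= gauss_kernel x u.
Proof. exact: ltW (gauss_kernel_gt0 x u). Qed.

Lemma gauss_kernelC x u : gauss_kernel x u = gauss_kernel u x.
Proof.
rewrite /gauss_kernel.
have -> : 2 * rho * x * u - rho ^+ 2 * x ^+ 2 - rho ^+ 2 * u ^+ 2 =
  2 * rho * u * x - rho ^+ 2 * u ^+ 2 - rho ^+ 2 * x ^+ 2 by ring.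
by [].
Qed.

Lemma measurable_gauss_kernel : measurable_fun setT (fun z : R * R => gauss_kernel z.1 z.2).
Proof.
have m1 := @measurable_fst _ _ R R; have m2 := @measurable_snd _ _ R R.
apply: measurable_funM => //; apply: measurableT_comp => //; apply: measurable_funM => //.
apply: measurable_funB; last by apply: measurable_funM => //; exact: measurable_funX.
apply: measurable_funB; last by apply: measurable_funM => //; exact: measurable_funX.
by apply: measurable_funM => //; exact: measurable_funM.
Qed.

Lemma measurable_gauss_kernel1 u : measurable_fun setT (gauss_kernel ^~ u).
Proof. exact: (measurableT_comp measurable_gauss_kernel (pair2_measurable u)). Qed.

(** Given u, the first member of the Gaussian pair has law N(rho u, s^2). *)
Lemma integral_gauss_kernel (u : R) (F : R -> R) : measurable_fun setT F -> (forall x, 0 <= F x) ->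
  (\int[N01]_x (gauss_kernel x u * F x)%:E = \int[normal_prob (rho * u) s]_x (F x)%:E)%E.
Proof.
move=> mF F0.
have mgF : measurable_fun setT (fun x => gauss_kernel x u * F x).
  by apply: measurable_funM => //; exact: measurable_gauss_kernel1.
transitivity (\int[lebesgue_measure]_x (gauss_kernel x u * F x * normal_pdf 0 1 x)%:E)%E.
  by apply: ge0_integral_normal => // x; rewrite mulr_ge0// gauss_kernel_ge0.
transitivity (\int[lebesgue_measure]_x (F x * normal_pdf (rho * u) s x)%:E)%E; last first.
  by apply/esym; exact: ge0_integral_normal.
apply: eq_integral => x _; congr EFin.
rewrite !normal_pdfE ?gt_eqF// !normal_peakE// /normal_fun /gauss_kernel.
rewrite -[s ^+ 2 *+ 2]mulr_natl -[1 ^+ 2 *+ 2]mulr_natl expr1n mulr1 subr0 invr1 mul1r.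
set p := Num.sqrt _.
have -> : expR (- (x - rho * u) ^+ 2 / (2 * s ^+ 2)) =
   expR ((2 * rho * x * u - rho ^+ 2 * x ^+ 2 - rho ^+ 2 * u ^+ 2) / (2 * s ^+ 2)) *
   expR (- x ^+ 2 / 2).
  rewrite -expRD; congr expR; have -> : rho ^+ 2 * x ^+ 2 = (1 - s ^+ 2) * x ^+ 2 by rewrite -rs addrK.
  by field; rewrite gt_eqF.
by ring.
Qed.

Lemma integral_gauss_kernel1 u : (\int[N01]_x (gauss_kernel x u)%:E = 1%:E)%E.
Proof.
transitivity (\int[N01]_x (gauss_kernel x u * cst 1 x)%:E)%E.
  by apply: eq_integral => x _; rewrite mulr1.
rewrite integral_gauss_kernel; [|exact: measurable_cst|by move=> x; exact: ler01].
transitivity (\int[normal_prob (rho * u) s]_x (cst 1%:E x))%E; first by [].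
by rewrite integral_cst// mul1e; exact: probability_setT.
Qed.

Lemma integral_gauss_kernel_sqr c u :
  (\int[N01]_x (gauss_kernel x u * (x + c) ^+ 2)%:E = ((rho * u + c) ^+ 2 + s ^+ 2)%:E)%E.
Proof.
have [L2 E2] := normal_standard_sqr R; have [L1 E1] := normal_standard_id R.
have msq : measurable_fun setT (fun x : R => (x + c) ^+ 2).
  by apply: measurable_funX; exact: measurable_funD.
rewrite integral_gauss_kernel; [|exact: msq|by move=> x; exact: sqr_ge0].
rewrite (ge0_integral_normal_standard _ s0 msq); last by move=> x; exact: sqr_ge0.
pose m := rho * u + c.
have LB := has_meanZ (2 * m * s) L1; have LC := has_meanZ (s ^+ 2) L2.
have LA := has_mean_cst N01 (m ^+ 2); have LAB := has_meanD LA LB.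
transitivity (\int[N01]_x (m ^+ 2 + 2 * m * s * x + s ^+ 2 * x ^+ 2)%:E)%E.
  by apply: eq_integral => x _; congr EFin; rewrite /m; ring.
apply: (eq_trans (meanE (has_meanD LAB LC))); congr EFin.
by rewrite (meanD LAB LC) (meanD LA LB) (meanZ _ L1) (meanZ _ L2) mean_cst E1 E2 /m; ring.
Qed.

(** Under the correlated law the information density, the logarithm of [gauss_kernel], has mean - ln
    s, and this is the exponential moment of order z of its deviation from that mean. The inner
    integral [K] is exposed so that both integrations can be raised to n coordinates. *)
Lemma integral_gauss_kernel_exp (z : R) : 0 <= z -> z < 1 ->
  exists (K : R -> R), [/\ measurable_fun setT K, forall x, 0 <= K x,
    forall x, (\int[N01]_u (gauss_kernel x u *
      expR (z / (2 * s ^+ 2) * (2 * rho * x * u - rho ^+ 2 * x ^+ 2 - rho ^+ 2 * u ^+ 2)))%:E =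
      (K x)%:E)%E &
    (\int[N01]_x (K x)%:E = ((Num.sqrt (1 - z ^+ 2 * rho ^+ 2))^-1)%:E)%E].
Proof.
move=> z0 z1; have s2 : 0 < s ^+ 2 by rewrite exprn_gt0.
have rho2 : 0 <= rho ^+ 2 by exact: sqr_ge0.
have rho1 : rho ^+ 2 < 1 by rewrite -rs ltrDl.
(* The total coefficient of the quadratic form: 1/(2 s^2) from the kernel and z/(2 s^2) from the
   exponential. *)
pose k := (1 + z) / (2 * s ^+ 2).
have k0 : 0 < k by rewrite divr_gt0 ?mulr_gt0//; lra.
pose r2 := 1 + 2 * k * rho ^+ 2.
have r20 : 0 < r2 by have := mulr_ge0 (ltW k0) rho2; rewrite /r2; lra.
pose r := Num.sqrt r2.
have r0 : 0 < r by rewrite sqrtr_gt0.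
have rE : r ^+ 2 = r2 by rewrite sqr_sqrtr// ltW.
have r2E : s ^+ 2 * r2 = 1 + z * rho ^+ 2.
  rewrite /r2 /k; have -> : s ^+ 2 * (1 + 2 * ((1 + z) / (2 * s ^+ 2)) * rho ^+ 2) =
    s ^+ 2 + (1 + z) * rho ^+ 2 by field; rewrite gt_eqF.
  by have := rs; lra.
(* The coefficient of x^2 left in the exponent after integrating over u. *)
pose bt := k * rho ^+ 2 * z / r2.
have zr : 0 < 1 - z ^+ 2 * rho ^+ 2.
  have : z ^+ 2 * rho ^+ 2 <= z ^+ 2 * 1 by rewrite ler_wpM2l ?sqr_ge0// ltW.
  have : z ^+ 2 < 1 by rewrite expr_lt1.
  by lra.
pose q2 := 1 - 2 * bt.
have q2E : s ^+ 2 * r2 * q2 = 1 - z ^+ 2 * rho ^+ 2.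
  have -> : s ^+ 2 * r2 * q2 = s ^+ 2 * r2 - (2 * s ^+ 2 * k) * rho ^+ 2 * z.
    by rewrite /q2 /bt; field; rewrite gt_eqF.
  have -> : 2 * s ^+ 2 * k = 1 + z by rewrite /k; field; rewrite gt_eqF.
  by rewrite r2E; ring.
have q20 : 0 < q2 by rewrite -(pmulr_rgt0 _ (mulr_gt0 s2 r20)) q2E.
pose q := Num.sqrt q2.
have q0 : 0 < q by rewrite sqrtr_gt0.
have qE : q ^+ 2 = q2 by rewrite sqr_sqrtr// ltW.
exists (fun x => (s * r)^-1 * expR (bt * x ^+ 2)); split.
- by apply: measurable_funM => //; apply: measurableT_comp => //; exact: measurable_funM.
- by move=> x; rewrite mulr_ge0 ?expR_ge0// invr_ge0 mulr_ge0// ltW.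
- move=> x.
  transitivity (\int[N01]_u ((s^-1 * expR (- (k * rho ^+ 2 * x ^+ 2)))%:E *
      (expR (2 * k * rho * x * u - (r ^+ 2 - 1) / 2 * u ^+ 2))%:E))%E.
    apply: eq_integral => u _; rewrite /gauss_kernel -EFinM -!mulrA -!expRD; congr (_ * expR _)%:E.
    by rewrite rE /r2 /k; field; rewrite gt_eqF.
  rewrite ge0_integralZl_EFin//.
  + rewrite integral_normal_quadratic// -EFinM; congr EFin.
    transitivity ((s * r)^-1 * (expR (- (k * rho ^+ 2 * x ^+ 2)) *
        expR ((2 * k * rho * x) ^+ 2 / (2 * r ^+ 2)))).
      by field; rewrite !gt_eqF.
    rewrite -expRD; congr (_ * expR _).
    rewrite rE /bt; have -> : z = 2 * k * s ^+ 2 - 1 by rewrite /k; field; rewrite gt_eqF.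
    have -> : s ^+ 2 = 1 - rho ^+ 2 by rewrite -rs addrAC subrr add0r.
    by rewrite /r2; field; rewrite gt_eqF.
  + apply/measurable_EFinP/measurableT_comp => //.
    by apply: measurable_funB; exact: measurable_funM.
  + by rewrite mulr_ge0 ?expR_ge0// invr_ge0 ltW.
- transitivity (\int[N01]_x (((s * r)^-1)%:E * (expR (0 * x - (q ^+ 2 - 1) / 2 * x ^+ 2))%:E))%E.
    apply: eq_integral => x _; rewrite -EFinM; congr (_ * expR _)%:E.
    by rewrite qE /q2; field.
  rewrite ge0_integralZl_EFin//.
  + rewrite integral_normal_quadratic// expr0n/= mul0r expR0 mul1r -EFinM; congr EFin.
    rewrite -invfM; congr (_^-1); rewrite -q2E -rE -qE -!exprMn sqrtr_sqr gtr0_norm//.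
    by rewrite !mulr_gt0.
  + apply/measurable_EFinP/measurableT_comp => //.
    by apply: measurable_funB; exact: measurable_funM.
  + by rewrite invr_ge0 mulr_ge0// ltW.
Qed.

Context d (Om : measurableType d) (P : probability Om R) (n : nat) (X : 'I_n -> Om -> R).
Hypothesis mX : forall t, measurable_fun setT (X t).
Hypothesis Xlaw : forall A : 'I_n -> set R, (forall t, measurable (A t)) ->
  P [set w | forall t, A t (X t w)] = (\prod_t N01 (A t))%E.

Lemma integral_prod_iid (F : 'I_n -> R -> R) (v : 'I_n -> R) :
  (forall t, measurable_fun setT (F t)) -> (forall t x, 0 <= F t x) ->
  (forall t, \int[N01]_x (F t x)%:E = (v t)%:E)%E ->
  (\int[P]_w (\prod_t F t (X t w))%:E = (\prod_t v t)%:E)%E.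
Proof.
move=> mF F0 vE.
have := @ge0_integral_prod_independent _ _ Om (measurableTypeR R) R P 'I_n X (fun=> N01)
  setT 1 measurableT mX ler01 _ _ F v mF F0 vE.
rewrite mul1r; apply.
  by move=> _; apply: (le_lt_trans (@probability_le1 _ _ _ N01 setT measurableT)); exact: ltry.
by move=> A mA; rewrite setTI mul1e; exact: (Xlaw mA).
Qed.

Definition prod_kernel (z : Om * Om) : R := \prod_t gauss_kernel (X t z.1) (X t z.2).

Lemma prod_kernel_ge0 z : 0 <= prod_kernel z.
Proof. by apply: prodr_ge0 => t _; exact: gauss_kernel_ge0. Qed.

Lemma prod_kernelC x u : prod_kernel (x, u) = prod_kernel (u, x).
Proof. by apply: eq_bigr => t _; exact: gauss_kernelC. Qed.

Lemma measurable_prod_kernel : measurable_fun setT prod_kernel.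
Proof.
apply: measurable_prod => t _.
have mp : measurable_fun setT (fun z : Om * Om => (X t z.1, X t z.2)).
  apply/measurable_fun_pairP; split; first exact: (measurableT_comp (mX t) measurable_fst).
  exact: (measurableT_comp (mX t) measurable_snd).
exact: (measurableT_comp measurable_gauss_kernel mp).
Qed.

Lemma integral_prod_kernel x : (\int[P]_u (prod_kernel (x, u))%:E = 1)%E.
Proof.
have := @integral_prod_iid (fun t u => gauss_kernel (X t x) u) (fun=> 1).
rewrite big1// => -> //.
- by move=> t; under eq_fun do rewrite gauss_kernelC; exact: measurable_gauss_kernel1.
- by move=> t u; exact: gauss_kernel_ge0.
- move=> t; under eq_integral do rewrite gauss_kernelC.
  exact: integral_gauss_kernel1.
Qed.

Lemma has_mean_prod_kernel u : has_mean P (fun x => prod_kernel (x, u)) /\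
  mean P (fun x => prod_kernel (x, u)) = 1.
Proof.
apply: has_mean_ge0.
- exact: (measurableT_comp measurable_prod_kernel (pair2_measurable u)).
- by move=> x; exact: prod_kernel_ge0.
- by under eq_integral do rewrite prod_kernelC; exact: integral_prod_kernel.
Qed.

Lemma mean_sqr_prod_kernel t c u :
  has_mean P (fun x => (X t x + c) ^+ 2 * prod_kernel (x, u)) /\
  mean P (fun x => (X t x + c) ^+ 2 * prod_kernel (x, u)) = (rho * X t u + c) ^+ 2 + s ^+ 2.
Proof.
apply: has_mean_ge0.
- apply: measurable_funM; first by apply: measurable_funX; exact: measurable_funD.
  exact: (measurableT_comp measurable_prod_kernel (pair2_measurable u)).
- by move=> x; rewrite mulr_ge0 ?sqr_ge0 ?prod_kernel_ge0.
pose F k x := gauss_kernel x (X k u) * (if k == t then (x + c) ^+ 2 else 1).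
have := @integral_prod_iid F (fun k => if k == t then (rho * X t u + c) ^+ 2 + s ^+ 2 else 1).
rewrite -big_mkcond/= big_pred1_eq => <-.
- apply: eq_integral => x _; congr EFin; rewrite /F big_split/= mulrC; congr (_ * _).
  by rewrite -big_mkcond big_pred1_eq.
- move=> k; apply: measurable_funM; first exact: measurable_gauss_kernel1.
  by case: eqP => // _; apply: measurable_funX; exact: measurable_funD.
- by move=> k x; rewrite mulr_ge0 ?gauss_kernel_ge0//; case: ifP => // _; exact: sqr_ge0.
- move=> k; rewrite /F; case: eqP => [->|_]; first exact: integral_gauss_kernel_sqr.
  by under eq_integral do rewrite mulr1; exact: integral_gauss_kernel1.
Qed.

(** Product integrals are available only for nonnegative functions, so the first moment comes from
    2x = (x + 1)^2 - x^2 - 1. This is the use of the shift c in [mean_sqr_prod_kernel]. *)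
Lemma mean_mul_prod_kernel t u :
  mean P (fun x => X t x * prod_kernel (x, u)) = rho * X t u.
Proof.
have [LK EK] := has_mean_prod_kernel u.
have [L0 E0] := mean_sqr_prod_kernel t 0 u; have [L1 E1] := mean_sqr_prod_kernel t 1 u.
have L10 := has_meanB L1 L0; have L := has_meanB L10 LK.
transitivity (mean P (fun x => 2^-1 * ((X t x + 1) ^+ 2 * prod_kernel (x, u) -
    (X t x + 0) ^+ 2 * prod_kernel (x, u) - prod_kernel (x, u)))).
  by apply: eq_mean => x; field.
by rewrite (meanZ _ L) (meanB L10 LK) (meanB L1 L0) E0 E1 EK; field.
Qed.

(** Chernoff's bound for the information density exceeding its mean n (- ln s) by more than n dl.
    The tilt z = dl/2 gives the exponent z dl = dl^2/2, and dl < 2 keeps z below 1. *)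
Lemma prod_kernel_tail dl : 0 < dl -> dl < 2 ->
  (\int[P]_x \int[P]_u (prod_kernel (x, u) *
     \1_[set u | (s^-1 * expR dl) ^+ n < prod_kernel (x, u)] u)%:E <=
   ((expR (- (dl ^+ 2 / 2)) / Num.sqrt (1 - (dl / 2) ^+ 2 * rho ^+ 2)) ^+ n)%:E)%E.
Proof.
move=> dl0 dl2; have z0 : 0 <= dl / 2 by lra.
have z1 : dl / 2 < 1 by lra.
have [K [mK K0 KE KI]] := integral_gauss_kernel_exp z0 z1.
pose q x u := 2 * rho * x * u - rho ^+ 2 * x ^+ 2 - rho ^+ 2 * u ^+ 2.
pose G (x u : R) := gauss_kernel x u * expR (dl / 2 / (2 * s ^+ 2) * q x u).
have G0 x u : 0 <= G x u by rewrite mulr_ge0 ?gauss_kernel_ge0 ?expR_ge0.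
have mq : measurable_fun setT (fun z : R * R => q z.1 z.2).
  have m1 := @measurable_fst _ _ R R; have m2 := @measurable_snd _ _ R R.
  apply: measurable_funB; last by apply: measurable_funM => //; exact: measurable_funX.
  apply: measurable_funB; last by apply: measurable_funM => //; exact: measurable_funX.
  by apply: measurable_funM => //; exact: measurable_funM.
have mG : measurable_fun setT (fun z : R * R => G z.1 z.2).
  apply: measurable_funM; first exact: measurable_gauss_kernel.
  by apply: measurableT_comp => //; exact: measurable_funM.
pose e : R := expR (- (dl ^+ 2 / 2)) ^+ n.
have e0 : 0 <= e by rewrite exprn_ge0// expR_ge0.
have s2 : 0 < s ^+ 2 by rewrite exprn_gt0.
have dom x u : prod_kernel (x, u) * \1_[set u | (s^-1 * expR dl) ^+ n < prod_kernel (x, u)] u <=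
    e * \prod_t G (X t x) (X t u).
  rewrite indicE; have [|_] := boolP (u \in _); last first.
    by rewrite mulr0 mulr_ge0// prodr_ge0.
  rewrite inE/= mulr1 => Mu.
  have pE : prod_kernel (x, u) = s^-1 ^+ n * expR ((\sum_t q (X t x) (X t u)) / (2 * s ^+ 2)).
    rewrite /prod_kernel big_split/= prodr_const card_ord; congr (_ * _).
    by rewrite -expR_sum mulr_suml.
  have Q : n%:R * dl <= (\sum_t q (X t x) (X t u)) / (2 * s ^+ 2).
    move: Mu; rewrite pE exprMn ltr_pM2l ?exprn_gt0 ?invr_gt0// -expRM_natl ltr_expR.
    exact: ltW.
  rewrite big_split/= -/(prod_kernel (x, u)) mulrCA ler_peMr ?prod_kernel_ge0//.
  rewrite -expR_sum /e -expRM_natl -expRD -[leLHS]expR0 ler_expR -mulr_sumr.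
  have -> : dl / 2 / (2 * s ^+ 2) * \sum_t q (X t x) (X t u) =
    dl / 2 * ((\sum_t q (X t x) (X t u)) / (2 * s ^+ 2)) by field; rewrite gt_eqF.
  have := ler_wpM2l z0 Q; set w := _ / (2 * s ^+ 2); set c := n%:R => H.
  have -> : c * - (dl ^+ 2 / 2) = - (dl / 2 * (c * dl)) by field.
  by lra.
have inner x : (\int[P]_u (e * \prod_t G (X t x) (X t u))%:E = (e * \prod_t K (X t x))%:E)%E.
  transitivity (\int[P]_u (e%:E * (\prod_t G (X t x) (X t u))%:E))%E; first by [].
  rewrite ge0_integralZl_EFin//.
  - rewrite (@integral_prod_iid (fun t u => G (X t x) u) (fun t => K (X t x)));
      [by []| |by move=> t y; exact: G0|by move=> t; exact: KE].
    by move=> t; exact: (measurableT_comp mG (pair1_measurable _)).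
  - by move=> u _; rewrite lee_fin prodr_ge0.
  - apply/measurable_EFinP/measurable_prod => t _.
    exact: (measurableT_comp (measurableT_comp mG (pair1_measurable _)) (mX t)).
apply: (@le_trans _ _ (\int[P]_x (e * \prod_t K (X t x))%:E)%E).
  apply: ge0_le_integral => //.
  - by move=> x _; apply: integral_ge0 => u _; rewrite lee_fin mulr_ge0 ?indicE ?prod_kernel_ge0.
  - apply: (@measurable_fun_fubini_tonelli_F _ _ _ _ _ P (fun z => (prod_kernel z *
      \1_[set z | (s^-1 * expR dl) ^+ n < prod_kernel z] z)%:E)); last first.
      by move=> z; rewrite lee_fin mulr_ge0 ?indicE ?prod_kernel_ge0.
    apply/measurable_EFinP; apply: measurable_funM; first exact: measurable_prod_kernel.
    apply: measurable_indic.
    rewrite (_ : [set _ | _] = prod_kernel @^-1` `](s^-1 * expR dl) ^+ n, +oo[%classic).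
      by rewrite -[X in measurable X]setTI; exact: measurable_prod_kernel.
    by apply/seteqP; split=> u /=; rewrite in_itv/= andbT.
  - apply/measurable_EFinP; apply: measurable_funM => //; apply: measurable_prod => t _.
    exact: (measurableT_comp mK (mX t)).
  - move=> x _; rewrite -inner; apply: ge0_le_integral => //.
    + by move=> u _; rewrite lee_fin mulr_ge0 ?indicE ?prod_kernel_ge0.
    + apply/measurable_EFinP; apply: measurable_funM.
        exact: (measurableT_comp measurable_prod_kernel (pair1_measurable x)).
      apply: measurable_indic.
      rewrite (_ : [set _ | _] = (fun u => prod_kernel (x, u)) @^-1`
          `](s^-1 * expR dl) ^+ n, +oo[%classic).
        rewrite -[X in measurable X]setTI.
        exact: (measurableT_comp measurable_prod_kernel (pair1_measurable x)).
      by apply/seteqP; split=> u /=; rewrite in_itv/= andbT.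
    + apply/measurable_EFinP; apply: measurable_funM => //; apply: measurable_prod => t _.
      exact: (measurableT_comp (measurableT_comp mG (pair1_measurable _)) (mX t)).
    + by move=> u _; rewrite lee_fin; exact: dom.
change (\int[P]_x (e%:E * (\prod_t K (X t x))%:E) <=
  ((expR (- (dl ^+ 2 / 2)) / Num.sqrt (1 - (dl / 2) ^+ 2 * rho ^+ 2)) ^+ n)%:E)%E.
rewrite ge0_integralZl_EFin//.
- rewrite (@integral_prod_iid (fun=> K) (fun=> (Num.sqrt (1 - (dl / 2) ^+ 2 * rho ^+ 2))^-1));
    [|by []|by move=> t; exact: K0|by move=> t; exact: KI].
  by rewrite prodr_const card_ord -EFinM lee_fin -exprMn.
- by move=> x _; rewrite lee_fin prodr_ge0.
- apply/measurable_EFinP/measurable_prod => t _.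
  exact: (measurableT_comp mK (mX t)).
Qed.

End gaussian_kernel.

(** Some codebook is at least as good as the average one. If none were, G - th would be bounded
    everywhere by the weighted errors, and taking means would contradict the strict inequality. The
    errors may be infinite, so the choice also has to make them finite. *)
Lemma exists_point_sum_le d (C : measurableType d) (R : realType) (PC : probability C R)
    (I : finType) (w e : I -> R) (G : C -> R) (F : I -> C -> \bar R) (th : R) :
  (forall i, 0 < w i) -> has_mean PC G -> (forall i, measurable_fun setT (F i)) ->
  (forall i c, 0 <= F i c)%E -> (forall i, \int[PC]_c F i c <= (e i)%:E)%E ->
  th < mean PC G - \sum_i w i * e i ->
  exists c (r : I -> R), (forall i, F i c = (r i)%:E) /\ th <= G c - \sum_i w i * r i.
Proof.
move=> w0 LG mF F0 Fe thG; apply: contrapT => none.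
pose E c := (\sum_i (w i)%:E * F i c)%E.
have mwF i : measurable_fun setT (fun c => (w i)%:E * F i c)%E by exact: measurable_funeM.
have wF0 i c : (0 <= (w i)%:E * F i c)%E by rewrite mule_ge0// lee_fin ltW.
have GE c : ((G c - th)%:E <= E c)%E.
  have [Ff|/existsNP[i Fi]] := pselect (forall i, F i c \is a fin_num).
    have EE : E c = (\sum_i w i * fine (F i c))%:E.
      by rewrite /E -sumEFin; apply: eq_bigr => i _; rewrite EFinM fineK.
    rewrite EE lee_fin leNgt; apply/negP => lt; apply: none.
    exists c, (fun i => fine (F i c)); split=> [i|]; first by rewrite fineK.
    by rewrite lerBrDr -lerBrDl ltW.
  have Fy : F i c = +oo%E.
    by move: Fi (F0 i c); case: (F i c) => // r /(_ isT).
  have -> : E c = +oo%E; last exact: leey.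
  rewrite /E (bigD1 i)//= Fy gt0_muley ?lte_fin// addye// gt_eqF//.
  by rewrite (lt_le_trans ltNy0)// sume_ge0.
pose H c := Num.max (G c - th) 0.
have mG := has_mean_measurable LG.
have mH : measurable_fun setT H.
  by apply: measurable_maxr; [exact: measurable_funB|exact: measurable_cst].
have H0 c : 0 <= H c by rewrite le_max lexx orbT.
have IE : (\int[PC]_c E c <= (\sum_i w i * e i)%:E)%E.
  rewrite ge0_integral_sum// -sumEFin; apply: lee_sum => i _.
  rewrite ge0_integralZl_EFin//; last by rewrite ltW.
  by rewrite EFinM; apply: lee_wpmul2l => //; rewrite lee_fin ltW.
have [LH EH] : has_mean PC H /\ mean PC H <= \sum_i w i * e i.
  apply: has_mean_le_fin => //; apply: le_trans IE; apply: ge0_le_integral => //.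
  - by move=> c _; rewrite lee_fin.
  - exact/measurable_EFinP.
  - exact: emeasurable_sum.
  - move=> c _; rewrite /H; case: (leP (G c - th) 0) => // _.
    by apply: sume_ge0.
have : mean PC (fun c => G c - th) <= mean PC H.
  apply: le_mean => // [|c]; first by apply: has_meanB => //; exact: has_mean_cst.
  by rewrite le_max lexx.
rewrite meanB ?mean_cst//; last exact: has_mean_cst.
move: thG EH; set A := mean PC G; set B := mean PC H; set S := \sum_i _; clear.
by lra.
Qed.

Section iid_normal.
Context d (Om : measurableType d) (R : realType) (P : probability Om R) (n : nat).
Variable X : 'I_n -> Om -> R.
Hypothesis n0 : (0 < n)%N.
Hypothesis mX : forall t, measurable_fun setT (X t).
Hypothesis Xlaw : forall A : 'I_n -> set R, (forall t, measurable (A t)) ->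
  P [set w | forall t, A t (X t w)] = (\prod_t normal_prob 0 1 (A t))%E.

Lemma mean_sqr_iid t : has_mean P (fun x => X t x ^+ 2) /\ mean P (fun x => X t x ^+ 2) = 1.
Proof.
have [L2 E2] := normal_standard_sqr R.
apply: has_mean_ge0; [exact: measurable_funX|by move=> x; exact: sqr_ge0|].
have := integral_prod_iid mX Xlaw (F := fun k (x : R) => if k == t then x ^+ 2 else 1)
  (v := fun=> 1).
rewrite big1// => <-.
- by apply: eq_integral => x _; rewrite -big_mkcond/= big_pred1_eq.
- by move=> k; case: eqP => _; [exact: measurable_funX|exact: measurable_cst].
- by move=> k x; case: eqP => _; [exact: sqr_ge0|exact: ler01].
- move=> k; case: eqP => _; first by apply: (eq_trans (meanE L2)); rewrite E2.
  by apply: (eq_trans (meanE (has_mean_cst _ 1))); rewrite mean_cst.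
Qed.

(* [z <= expR z] at [z = (|x|^2 - 2n)/4]. *)
Lemma second_moment_le : exists r : Om -> R,
  [/\ measurable_fun setT r, forall x, 0 <= r x,
   forall x, n%:R^-1 * (\sum_t X t x ^+ 2) <= 2 + r x &
   (\int[P]_x (r x)%:E <= (4 / n%:R)%:E)%E].
Proof.
have nR : 0 < n%:R :> R by rewrite ltr0n.
have N0 : 0 <= 4 / n%:R :> R by rewrite divr_ge0// ltW.
pose F (x : R) := expR (x ^+ 2 / 4 - 2^-1).
have mF : measurable_fun setT F.
  apply: measurableT_comp => //; apply: measurable_funB => //.
  by apply: measurable_funM => //; exact: measurable_funX.
have mp : measurable_fun setT (fun x => \prod_t F (X t x)).
  by apply: measurable_prod => t _; exact: (measurableT_comp mF (mX t)).
have p0 x : 0 <= \prod_t F (X t x) by apply: prodr_ge0 => t _; exact: expR_ge0.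
exists (fun x => 4 / n%:R * \prod_t F (X t x)); split.
- exact: measurable_funM.
- by move=> x; rewrite mulr_ge0.
- move=> x; rewrite -expR_sum; set z := \sum_t (_ - _).
  have zE : z = (\sum_t X t x ^+ 2) / 4 - n%:R / 2.
    by rewrite /z sumrB -mulr_suml sumr_const card_ord -[_ *+ n]mulr_natl.
  have := expR_ge1Dx z => zz.
  have ne : 4 / n%:R * (1 + z) <= 4 / n%:R * expR z by rewrite ler_wpM2l.
  apply: (@le_trans _ _ (2 + 4 / n%:R * (1 + z))); last by rewrite lerD2l.
  have -> : 2 + 4 / n%:R * (1 + z) = n%:R^-1 * \sum_t X t x ^+ 2 + 4 / n%:R.
    by rewrite zE; field; rewrite gt_eqF.
  by rewrite lerDl.
- change (\int[P]_x ((4 / n%:R)%:E * (\prod_t F (X t x))%:E) <= (4 / n%:R)%:E)%E.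
  rewrite ge0_integralZl_EFin//; last 2 first.
  + by move=> x _; rewrite lee_fin.
  + exact/measurable_EFinP.
  pose q : R := Num.sqrt 2^-1.
  have q0 : 0 < q by rewrite sqrtr_gt0 invr_gt0.
  have q2 : q ^+ 2 = 2^-1 by rewrite sqr_sqrtr// invr_ge0.
  (* The mean of one factor. Its square is 2/e, so the product has mean at most 1; this is what
     makes the level 2 for the power high enough. *)
  pose v := expR (- 2^-1) / q.
  rewrite (integral_prod_iid mX Xlaw (F := fun=> F) (v := fun=> v)) => //.
  + rewrite -EFinM lee_fin ler_piMr// prodr_const card_ord exprn_ile1//.
      by rewrite divr_ge0 ?expR_ge0// ltW.
    rewrite /v ler_pdivrMr// [1 * q]mul1r -(ler_pXn2r (ltn0Sn 1)) ?nnegrE ?expR_ge0 ?(ltW q0)//.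
    rewrite q2 -expRM_natl mulrN expRN lef_pV2 ?posrE ?expR_gt0//.
    by have := @expR_ge1Dx R (2 * 2^-1); lra.
  + by move=> t x; exact: expR_ge0.
  + move=> t; have H := @integral_normal_quadratic R q 0 q0.
    transitivity (\int[normal_prob 0 1]_x ((expR (- 2^-1))%:E *
        (expR (0 * x - (q ^+ 2 - 1) / 2 * x ^+ 2))%:E))%E.
      apply: eq_integral => x _; rewrite -EFinM -expRD; congr (expR _)%:E.
      by rewrite q2; field.
    rewrite ge0_integralZl_EFin//; last first.
    * apply/measurable_EFinP/measurableT_comp => //; apply: measurable_funB.
        exact: measurable_funM.
      by apply: measurable_funM => //; exact: measurable_funX.
    by rewrite H -EFinM /v expr0n/= mul0r expR0 mul1r.
Qed.

End iid_normal.

(** * Random Gaussian codebooks *)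

Section gaussian_codebook.
Context (R : realType) d (Om : measurableType d) (P : probability Om R) (n : nat).
Variable X : 'I_n -> Om -> R.
Hypothesis n0 : (0 < n)%N.
Hypothesis mX : forall t, measurable_fun setT (X t).
Hypothesis Xlaw : forall A : 'I_n -> set R, (forall t, measurable (A t)) ->
  P [set w | forall t, A t (X t w)] = (\prod_t normal_prob 0 1 (A t))%E.

Definition power x : R := n%:R^-1 * \sum_t X t x ^+ 2.

Lemma power_ge0 x : 0 <= power x.
Proof. by rewrite mulr_ge0 ?invr_ge0 ?ler0n// sumr_ge0// => t _; exact: sqr_ge0. Qed.

Lemma measurable_power : measurable_fun setT power.
Proof.
by apply: measurable_funM => //; apply: measurable_sum => t; exact: measurable_funX.
Qed.

Lemma mean_power : has_mean P power /\ mean P power = 1.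
Proof.
have L t := (mean_sqr_iid mX Xlaw t).1.
have LS : has_mean P (fun x => \sum_t X t x ^+ 2) by exact: has_mean_sum.
split; first exact: has_meanZ.
rewrite meanZ// mean_sum// (eq_bigr (fun=> 1)) => [|t _]; last exact: (mean_sqr_iid mX Xlaw t).2.
by rewrite sumr_const card_ord mulVf// pnatr_eq0 -lt0n.
Qed.

(** An L1 distance between the channel output of a uniform codeword and P, weighted by the power so
    that it controls means of the coordinates. *)
Definition codebook_error (rho s : R) (J : finType) (u : J -> Om) : \bar R :=
  (\int[P]_x (power x * `|#|J|%:R^-1 * \sum_j prod_kernel rho s X (x, u j) - 1|)%:E)%E.

Section one_kernel.
Variables (rho s : R).
Hypotheses (s0 : 0 < s) (rs : rho ^+ 2 + s ^+ 2 = 1).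
Local Notation L := (prod_kernel rho s X).

Lemma codebook_error_ge0 (J : finType) (u : J -> Om) : (0 <= codebook_error rho s u)%E.
Proof. by apply: integral_ge0 => x _; rewrite lee_fin mulr_ge0 ?power_ge0. Qed.

Section random_codebook.
Context d' (C : measurableType d') (PC : probability C R) (J : finType) (U : J -> C -> Om).
Hypothesis mU : forall j, measurable_fun setT (U j).

Lemma measurable_codebook_error :
  measurable_fun setT (fun c => codebook_error rho s (U^~ c)).
Proof.
exact: (@measurable_covering_error _ _ _ _ _ P J U mU L (measurable_prod_kernel rho s mX)
  power measurable_power power_ge0).
Qed.

Hypothesis Ulaw : forall j A, measurable A -> PC (U j @^-1` A) = P A.
Hypothesis Upair : forall i j, i != j -> forall A B, measurable A -> measurable B ->
  PC (U i @^-1` A `&` U j @^-1` B) = (P A * P B)%E.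
Hypothesis J0 : (0 < #|J|)%N.

Lemma integral_codebook_error (dl eta : R) : 0 < dl -> dl < 2 -> 0 < eta ->
  (\int[PC]_c codebook_error rho s (U^~ c) <=
   (eta + (s^-1 * expR dl) ^+ n / (eta * #|J|%:R) +
    4 * (expR (- (dl ^+ 2 / 2)) / Num.sqrt (1 - (dl / 2) ^+ 2 * rho ^+ 2)) ^+ n +
    2 * (4 / n%:R))%:E)%E.
Proof.
move=> dl0 dl2 eta0.
have [r [mr r0 yr rE]] := second_moment_le n0 mX Xlaw.
apply: (soft_covering mU Ulaw Upair J0 (measurable_prod_kernel rho s mX) _ _ _ mr _ eta0 r0 _ _ rE).
- exact: prod_kernel_ge0.
- exact: integral_prod_kernel.
- exact: measurable_power.
- by rewrite exprn_ge0// mulr_ge0 ?invr_ge0 ?expR_ge0// ltW.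
- by move=> x; rewrite power_ge0 yr.
- exact: prod_kernel_tail.
Qed.

End random_codebook.

Lemma exists_gaussian_encoder (J : finType) (u : J -> Om) (r : R) : (0 < #|J|)%N ->
  codebook_error rho s u = r%:E ->
  exists f : J -> Om -> R,
  [/\ forall j, measurable_fun setT (f j), forall j x, 0 <= f j x,
      forall x, \sum_j f j x = 1, forall j, mean P (f j) = #|J|%:R^-1 &
      (#|J|%:R * n%:R)^-1 * \sum_j \sum_t
        (#|J|%:R * mean P (fun x => X t x * f j x) - rho * X t (u j)) ^+ 2 <= 2 * r].
Proof.
move=> J0 uE; pose l j x := L (x, u j).
have ml j : measurable_fun setT (l j).
  exact: (measurableT_comp (measurable_prod_kernel rho s mX) (pair2_measurable (u j))).
have l0 j x : 0 <= l j x by exact: prod_kernel_ge0.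
have lE j := has_mean_prod_kernel s0 rs mX Xlaw (u j).
have [f [mf f0 f1 Ef fl]] := exists_uniform_encoder ml l0 (fun j => (lE j).1) (fun j => (lE j).2) J0.
exists f; split=> //.
have my : measurable_fun setT (fun x => power x * `|#|J|%:R^-1 * \sum_j l j x - 1|).
  apply: measurable_funM; first exact: measurable_power.
  apply: measurableT_comp => //; apply: measurable_funB => //; apply: measurable_funM => //.
  exact: measurable_sum.
have [LyS EyS] := has_mean_ge0 my (fun x => mulr_ge0 (power_ge0 x) (normr_ge0 _)) uE.
rewrite -EyS; apply: (@encoder_mean_error _ _ _ P J l ml l0 (fun j => (lE j).1) (fun j => (lE j).2)
  J0 n X (fun j t => rho * X t (u j))) => //.
- by move=> t; exact: (mean_sqr_iid mX Xlaw t).1.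
- move=> j t; apply: (eq_has_mean _ (mean_sqr_prod_kernel s0 rs mX Xlaw t 0 (u j)).1) => x.
  by rewrite addr0.
- by move=> j t; exact: mean_mul_prod_kernel.
Qed.

End one_kernel.
End gaussian_codebook.

(** Expand c d around (r1 w)(r2 w). Each mixed term r w e costs at most eta/2 w^2 + e^2/(2 eta), and
    the product of the two errors half the sum of their squares. *)
Lemma perturbed_product_ge (R : realFieldType) (r1 r2 eta w c d : R) :
  0 < eta -> r1 ^+ 2 <= 1 -> r2 ^+ 2 <= 1 ->
  (r1 * r2 - eta) * w ^+ 2 -
    ((2 * eta)^-1 + 2^-1) * ((c - r1 * w) ^+ 2 + (d - r2 * w) ^+ 2) <= c * d.
Proof.
move=> eta0 r1le r2le; set e1 := c - r1 * w; set e2 := d - r2 * w.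
have half (r e : R) : r ^+ 2 <= 1 -> - (eta / 2 * w ^+ 2 + (2 * eta)^-1 * e ^+ 2) <= r * w * e.
  move=> r1'; have h0 : 0 <= (2 * eta)^-1 by rewrite invr_ge0; lra.
  have := mulr_ge0 h0 (sqr_ge0 (eta * w + r * e)).
  have -> : (2 * eta)^-1 * (eta * w + r * e) ^+ 2 =
    eta / 2 * w ^+ 2 + r * w * e + (2 * eta)^-1 * (r ^+ 2 * e ^+ 2).
    by field; rewrite gt_eqF.
  have : (2 * eta)^-1 * (r ^+ 2 * e ^+ 2) <= (2 * eta)^-1 * e ^+ 2.
    by rewrite ler_wpM2l// ler_piMl// sqr_ge0.
  by move: ((2 * eta)^-1 * _) ((2 * eta)^-1 * _) => a b; lra.
have := half r1 e2 r1le; have := half r2 e1 r2le.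
have -> : c * d = r1 * r2 * w ^+ 2 + r1 * w * e2 + r2 * w * e1 + e1 * e2.
  by rewrite /e1 /e2; ring.
have := sqr_ge0 (e1 + e2); rewrite sqrrD.
move: (e1 ^+ 2) (e2 ^+ 2) (w ^+ 2) (r1 * w * e2) (r2 * w * e1) (e1 * e2) => A B W C D E.
move: ((2 * eta)^-1) => H; clear; lra.
Qed.

(** * Codes from codebooks with small covering errors *)

Section code_from_codebook.
Context (R : realType) d (Om : measurableType d) (P : probability Om R) (n : nat).
Variable X : 'I_n -> Om -> R.
Hypothesis n0 : (0 < n)%N.
Hypothesis mX : forall t, measurable_fun setT (X t).
Hypothesis Xlaw : forall A : 'I_n -> set R, (forall t, measurable (A t)) ->
  P [set w | forall t, A t (X t w)] = (\prod_t normal_prob 0 1 (A t))%E.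
Variables (rho1 s1 rho2 s2 : R) (a b : nat) (u : 'I_a * 'I_b -> Om) (r1 : 'I_b -> R) (r2 : R).
Hypotheses (s10 : 0 < s1) (rs1 : rho1 ^+ 2 + s1 ^+ 2 = 1).
Hypotheses (s20 : 0 < s2) (rs2 : rho2 ^+ 2 + s2 ^+ 2 = 1).
Hypotheses (a0 : (0 < a)%N) (b0 : (0 < b)%N).
Hypothesis r1E : forall k, codebook_error P X rho1 s1 (fun j => u (j, k)) = (r1 k)%:E.
Hypothesis r2E : codebook_error P X rho2 s2 u = r2%:E.

(** The correlation is an average over messages and coordinates of products of conditional means,
    each compared with the scaled codeword by [perturbed_product_ge]. The factor 2 before the errors
    is the one in [encoder_mean_error]. *)
Lemma achievable_of_codebook (mu sX s Rr Rc Pp eta kappa : R) : 0 < sX -> 0 < s -> 0 < eta ->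
  ln a%:R / n%:R <= Rr -> ln b%:R / n%:R <= Rc -> psi sX s <= Pp ->
  kappa <= (rho1 * rho2 - eta) * ((a%:R * b%:R)^-1 * \sum_i power X (u i)) -
    2 * ((2 * eta)^-1 + 2^-1) * (b%:R^-1 * \sum_k r1 k + r2) ->
  achievable mu sX Rr Rc Pp (sX ^+ 2 + s ^+ 2 - 2 * sX * s * kappa).
Proof.
move=> sX0 s0 eta0 aR bR psiP kappaP.
have aN : a%:R != 0 :> R by rewrite pnatr_eq0 -lt0n.
have bN : b%:R != 0 :> R by rewrite pnatr_eq0 -lt0n.
have nN : n%:R != 0 :> R by rewrite pnatr_eq0 -lt0n.
have J10 : (0 < #|'I_a|)%N by rewrite card_ord.
have J20 : (0 < #|{: 'I_a * 'I_b}|)%N by rewrite card_prod !card_ord muln_gt0 a0.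
have /choice[f fP] := fun k => exists_gaussian_encoder n0 mX Xlaw s10 rs1 J10 (r1E k).
have [g [mg g0 g1 Eg gE]] := exists_gaussian_encoder n0 mX Xlaw s20 rs2 J20 r2E.
have gN : #|{: 'I_a * 'I_b}|%:R = a%:R * b%:R :> R by rewrite card_prod !card_ord natrM.
rewrite gN in gE Eg.
apply: (@code_achievable _ _ _ P a b n (fun i => f i.2 i.1) g X) => //.
- by move=> [j k]; have [] := fP k.
- by move=> [j k]; have [] := fP k.
- by move=> k; have [] := fP k.
- by move=> [j k]; have [_ _ _ /(_ j)] := fP k; rewrite card_ord.
apply: (le_trans kappaP).
pose e1 i t := a%:R * mean P (fun x => X t x * f i.2 i.1 x) - rho1 * X t (u i).
pose e2 i t := a%:R * b%:R * mean P (fun x => X t x * g i x) - rho2 * X t (u i).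
set B := (2 * eta)^-1 + 2^-1.
have B0 : 0 <= B by rewrite addr_ge0 ?invr_ge0 ?mulr_ge0// ltW.
set c := (a%:R * b%:R * n%:R)^-1 : R.
have c0 : 0 <= c by rewrite invr_ge0 !mulr_ge0.
apply: (@le_trans _ _ (c * \sum_i \sum_t ((rho1 * rho2 - eta) * X t (u i) ^+ 2 -
    B * (e1 i t ^+ 2 + e2 i t ^+ 2)))); last first.
  have -> : n%:R^-1 * \sum_t \sum_i a%:R * (mean P (fun x => X t x * f i.2 i.1 x) *
      mean P (fun x => X t x * g i x)) =
    c * \sum_i \sum_t (a%:R * mean P (fun x => X t x * f i.2 i.1 x)) *
      (a%:R * b%:R * mean P (fun x => X t x * g i x)).
    rewrite exchange_big/= !mulr_sumr; apply: eq_bigr => i _.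
    rewrite !mulr_sumr; apply: eq_bigr => t _; rewrite /c; field.
    by rewrite aN bN nN.
  rewrite ler_wpM2l//; apply: ler_sum => i _; apply: ler_sum => t _.
  by apply: perturbed_product_ge => //; [rewrite -rs1|rewrite -rs2]; rewrite lerDl sqr_ge0.
have E2 : c * \sum_i \sum_t e2 i t ^+ 2 <= 2 * r2 by exact: gE.
have E1 : c * \sum_i \sum_t e1 i t ^+ 2 <= 2 * (b%:R^-1 * \sum_k r1 k).
  have -> : c * \sum_i \sum_t e1 i t ^+ 2 =
      b%:R^-1 * \sum_k (a%:R * n%:R)^-1 * \sum_j \sum_t e1 (j, k) t ^+ 2.
    rewrite -mulr_sumr mulrA; congr (_ * _); last first.
      rewrite [RHS]exchange_big/= [RHS]pair_bigA/=; apply: eq_bigr => -[j k] _ /=.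
      by [].
    by rewrite /c; field; rewrite aN bN nN.
  rewrite mulrCA ler_wpM2l ?invr_ge0// mulr_sumr; apply: ler_sum => k _.
  by have [_ _ _ _] := fP k; rewrite card_ord.
have -> : c * \sum_i \sum_t ((rho1 * rho2 - eta) * X t (u i) ^+ 2 -
      B * (e1 i t ^+ 2 + e2 i t ^+ 2)) =
    (rho1 * rho2 - eta) * ((a%:R * b%:R)^-1 * \sum_i power X (u i)) -
    B * (c * \sum_i \sum_t e1 i t ^+ 2 + c * \sum_i \sum_t e2 i t ^+ 2).
  rewrite -mulrDr -big_split/= /power -mulr_sumr.
  have -> : (rho1 * rho2 - eta) * ((a%:R * b%:R)^-1 * (n%:R^-1 * \sum_i \sum_t X t (u i) ^+ 2)) =
      c * \sum_i \sum_t (rho1 * rho2 - eta) * X t (u i) ^+ 2.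
    under [in RHS]eq_bigr do rewrite -mulr_sumr.
    by rewrite -mulr_sumr /c; field; rewrite aN bN nN.
  rewrite mulrCA -mulrBr; congr (_ * _).
  rewrite mulr_sumr -sumrB; apply: eq_bigr => i _.
  by rewrite -big_split/= mulr_sumr -sumrB.
rewrite lerD2l lerN2.
have -> : 2 * B * (b%:R^-1 * (\sum_k r1 k) + r2) = B * (2 * (b%:R^-1 * (\sum_k r1 k)) + 2 * r2).
  by ring.
by rewrite ler_wpM2l// lerD.
Qed.

End code_from_codebook.

Lemma exists_random_codebook d (Om : measurableType d) (R : realType) (P : probability Om R)
    (J : finType) :
  exists d' (C : measurableType d') (PC : probability C R) (U : J -> C -> Om),
  [/\ forall j, measurable_fun setT (U j),
      forall j A, measurable A -> PC (U j @^-1` A) = P A &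
      forall i j, i != j -> forall A B, measurable A -> measurable B ->
        PC (U i @^-1` A `&` U j @^-1` B) = (P A * P B)%E].
Proof.
have [d' [C [PC [U [mU UE]]]]] := exists_independent_copies P #|J|.
exists d', C, PC, (fun j => U (enum_rank j)).
have PT : P setT = 1%E by exact: probability_setT.
split=> // [j A mA|i j ij A B mA mB].
  pose D k := if k == enum_rank j then A else setT.
  have -> : U (enum_rank j) @^-1` A = [set c | forall k, D k (U k c)].
    apply/seteqP; split=> c /= H; last by have := H (enum_rank j); rewrite /D eqxx.
    by move=> k; rewrite /D; case: eqP => // ->.
  rewrite UE => [|k]; last by rewrite /D; case: ifP.
  rewrite (bigD1 (enum_rank j))//= {1}/D eqxx big1 ?mule1// => k /negbTE kj.
  by rewrite /D kj.
have rij : enum_rank j != enum_rank i by rewrite (inj_eq enum_rank_inj) eq_sym.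
pose D k := if k == enum_rank i then A else if k == enum_rank j then B else setT.
have -> : U (enum_rank i) @^-1` A `&` U (enum_rank j) @^-1` B = [set c | forall k, D k (U k c)].
  apply/seteqP; split=> c /= H.
    by case: H => HA HB k; rewrite /D; case: eqP => [->//|_]; case: eqP => [->|].
  split; first by have := H (enum_rank i); rewrite /D eqxx.
  by have := H (enum_rank j); rewrite /D (negbTE rij) eqxx.
rewrite UE => [|k]; last by rewrite /D; case: ifP => // _; case: ifP.
rewrite (bigD1 (enum_rank i))//= (bigD1 (enum_rank j))//= big1 ?mule1.
  by rewrite /D !eqxx (negbTE rij).
by move=> k /andP[/negbTE ki /negbTE kj]; rewrite /D ki kj.
Qed.

Section random_code.
Context (R : realType) d (Om : measurableType d) (P : probability Om R) (n : nat).
Variable X : 'I_n -> Om -> R.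
Hypothesis n0 : (0 < n)%N.
Hypothesis mX : forall t, measurable_fun setT (X t).
Hypothesis Xlaw : forall A : 'I_n -> set R, (forall t, measurable (A t)) ->
  P [set w | forall t, A t (X t w)] = (\prod_t normal_prob 0 1 (A t))%E.

(** The bound of [integral_codebook_error] at block length m with N codewords: slack and variance of
    the truncated kernel, Chernoff tail, excess of the power over 2. *)
Definition covering_bound (rho s dl eta : R) (m N : nat) : R :=
  eta + (s^-1 * expR dl) ^+ m / (eta * N%:R) +
  4 * (expR (- (dl ^+ 2 / 2)) / Num.sqrt (1 - (dl / 2) ^+ 2 * rho ^+ 2)) ^+ m +
  2 * (4 / m%:R).

Lemma achievable_random_code (rho1 s1 rho2 s2 dl ep eta mu sX s Rr Rc Pp kappa : R) (a b : nat) :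
  0 < s1 -> rho1 ^+ 2 + s1 ^+ 2 = 1 -> 0 < s2 -> rho2 ^+ 2 + s2 ^+ 2 = 1 ->
  0 < dl -> dl < 2 -> 0 < ep -> 0 < eta -> (0 < a)%N -> (0 < b)%N ->
  0 < sX -> 0 < s -> ln a%:R / n%:R <= Rr -> ln b%:R / n%:R <= Rc -> psi sX s <= Pp ->
  kappa < rho1 * rho2 - eta - 2 * ((2 * eta)^-1 + 2^-1) *
    (covering_bound rho1 s1 dl ep n a + covering_bound rho2 s2 dl ep n (a * b)) ->
  achievable mu sX Rr Rc Pp (sX ^+ 2 + s ^+ 2 - 2 * sX * s * kappa).
Proof.
move=> s10 rs1 s20 rs2 dl0 dl2 ep0 eta0 a0 b0 sX0 s0 aR bR psiP kappaP.
have aN : a%:R != 0 :> R by rewrite pnatr_eq0 -lt0n.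
have bN : b%:R != 0 :> R by rewrite pnatr_eq0 -lt0n.
have J10 : (0 < #|'I_a|)%N by rewrite card_ord.
have cJ : #|{: 'I_a * 'I_b}| = (a * b)%N by rewrite card_prod !card_ord.
have J20 : (0 < #|{: 'I_a * 'I_b}|)%N by rewrite cJ muln_gt0 a0.
have [d' [C [PC [U [mU Ulaw Upair]]]]] := exists_random_codebook P ('I_a * 'I_b)%type.
(* One error per seed, for the subcodebook that must reproduce X^n, and one for the whole codebook,
   which must reproduce Y^n. The weights [w] average the former over the seeds. *)
pose F (i : 'I_b + unit) c : \bar R :=
  if i is inl k then codebook_error P X rho1 s1 (fun j => U (j, k) c)
  else codebook_error P X rho2 s2 (U^~ c).
set B := 2 * ((2 * eta)^-1 + 2^-1) in kappaP.
have B0 : 0 < B by rewrite mulr_gt0// addr_gt0 ?invr_gt0 ?mulr_gt0.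
pose w (i : 'I_b + unit) : R := if i is inl k then B * b%:R^-1 else B.
pose e (i : 'I_b + unit) : R := if i is inl k then covering_bound rho1 s1 dl ep n a
  else covering_bound rho2 s2 dl ep n (a * b).
pose G c := (rho1 * rho2 - eta) * ((a%:R * b%:R)^-1 * \sum_i power X (U i c)).
have LU i := mean_same_law (mU i) (Ulaw i) (measurable_power mX) (power_ge0 X) (mean_power n0 mX Xlaw).1.
have LS : has_mean PC (fun c => \sum_i power X (U i c)) by apply: has_mean_sum => i; exact: (LU i).1.
have LG : has_mean PC G by do 2!apply: has_meanZ.
have EG : mean PC G = rho1 * rho2 - eta.
  rewrite meanZ; last exact: has_meanZ.
  rewrite meanZ// mean_sum => [|i]; last exact: (LU i).1.
  rewrite (eq_bigr (fun=> 1)) => [|i _].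
    by rewrite sumr_const cJ natrM mulVf ?mulr1// mulf_neq0.
  by rewrite (LU i).2 (mean_power n0 mX Xlaw).2.
have sumw (r : 'I_b + unit -> R) :
    \sum_i w i * r i = B * (b%:R^-1 * (\sum_k r (inl k)) + r (inr tt)).
  rewrite big_sumType/= (big_pred1 tt) => [|[]//]; rewrite mulrDr mulrA mulr_sumr.
  by congr (_ + _).
have [||||| c [r [Fr Gr]]] := @exists_point_sum_le _ C R PC _ w e G F kappa _ LG.
- by case=> [k|[]]//=; rewrite mulr_gt0// invr_gt0 ltr0n.
- case=> [k|[]] /=; last exact: (measurable_codebook_error P mX rho2 s2 mU).
  exact: (measurable_codebook_error P mX rho1 s1 (fun j => mU (j, k))).
- by case=> [k|[]] c /=; exact: codebook_error_ge0.
- case=> [k|[]] /=.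
    have := integral_codebook_error n0 mX Xlaw s10 rs1 (fun j => mU (j, k))
      (fun j => Ulaw (j, k)) _ J10 dl0 dl2 ep0; rewrite card_ord; apply.
    by move=> i j ij; apply: Upair; apply: contra ij => /eqP[->].
  have := integral_codebook_error n0 mX Xlaw s20 rs2 mU Ulaw Upair J20 dl0 dl2 ep0.
  by rewrite cJ.
- by rewrite EG sumw /= sumr_const card_ord -[covering_bound _ _ _ _ _ _ *+ b]mulr_natl mulKf.
apply: (@achievable_of_codebook _ _ _ P n X n0 mX Xlaw rho1 s1 rho2 s2 a b (U^~ c)
  (fun k => r (inl k)) (r (inr tt)) s10 rs1 s20 rs2 a0 b0 _ _ mu sX s Rr Rc Pp eta) => //.
- by move=> k; exact: (Fr (inl k)).
- exact: (Fr (inr tt)).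
- by move: Gr; rewrite sumw.
Qed.

End random_code.

(** * Asymptotics and upper bound *)

(** After squaring, with z = dl^2 in (0, 1], the chain is exp(-z) <= 1/(1 + z) < 1 - z/4. *)
Lemma tail_rate_lt1 (R : realType) (dl rho : R) : 0 < dl -> dl <= 1 -> rho ^+ 2 <= 1 ->
  0 <= expR (- (dl ^+ 2 / 2)) / Num.sqrt (1 - (dl / 2) ^+ 2 * rho ^+ 2) < 1.
Proof.
move=> dl0 dl1 r1.
have d2 : 0 < dl ^+ 2 <= 1 by rewrite exprn_gt0//= exprn_ile1// ltW.
pose q := 1 - (dl / 2) ^+ 2 * rho ^+ 2.
have qE : 1 - dl ^+ 2 / 4 <= q.
  have : (dl / 2) ^+ 2 * rho ^+ 2 <= (dl / 2) ^+ 2 * 1 by rewrite ler_wpM2l ?sqr_ge0.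
  have -> : (dl / 2) ^+ 2 * 1 = dl ^+ 2 / 4 by field.
  by rewrite /q; lra.
have q0 : 0 < q by case/andP: d2; lra.
rewrite divr_ge0 ?expR_ge0 ?sqrtr_ge0//= ltr_pdivrMr ?sqrtr_gt0// mul1r.
rewrite -(ltr_pXn2r (ltn0Sn 1)) ?nnegrE ?expR_ge0 ?sqrtr_ge0// sqr_sqrtr ?(ltW q0)//.
rewrite -expRM_natl; have -> : 2%:R * - (dl ^+ 2 / 2) = - dl ^+ 2 :> R by field.
apply: lt_le_trans qE; rewrite expRN.
apply: (@le_lt_trans _ _ (1 + dl ^+ 2)^-1).
  by rewrite lef_pV2 ?posrE ?expR_gt0 ?expR_ge1Dx//; case/andP: d2; lra.
case/andP: d2 => d20 d21.
rewrite -[ltLHS]mul1r ltr_pdivrMr; last by lra.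
by move: (dl ^+ 2) d20 d21 => z z0 z1; nra.
Qed.

(** The rate condition makes the truncation level grow more slowly than the number of codewords:
    their ratio per letter is v < 1. The constant q absorbs the rounding of the number of codewords.
    Each of the four terms ends below ep. *)
Lemma covering_bound_near0 (R : realType) (rho s dl ep q r : R) (N : nat -> nat) :
  0 < s -> rho ^+ 2 + s ^+ 2 = 1 -> 0 < dl -> dl <= 1 -> 0 < ep -> 0 < q ->
  dl - ln s < r -> (forall m, q * expR r ^+ m <= (N m)%:R) ->
  \forall m \near \oo, covering_bound rho s dl ep m (N m) <= 4 * ep.
Proof.
move=> s0 rs dl0 dl1 ep0 q0 rr Nm.
have r1 : rho ^+ 2 <= 1 by rewrite -rs lerDl sqr_ge0.
have /andP[t0 t1] := tail_rate_lt1 dl0 dl1 r1.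
rewrite /covering_bound; set t := _ / _ in t0 t1 *.
pose v := s^-1 * expR dl / expR r.
have v0 : 0 <= v by rewrite !mulr_ge0 ?invr_ge0 ?expR_ge0// ltW.
have v1 : v < 1.
  rewrite /v -[s in s^-1](lnK s0) -!expRN -!expRD -expR0 ltr_expR; lra.
have e1 : 0 < ep * (ep * q) by rewrite !mulr_gt0.
have e2 : 0 < ep / 4 by rewrite divr_gt0.
have nv : `|v| < 1 by rewrite ger0_norm.
have nt : `|t| < 1 by rewrite ger0_norm.
have HV := cvgr0_norm_lt _ (cvg_expr nv) _ e1.
have HT := cvgr0_norm_lt _ (cvg_expr nt) _ e2.
near=> m.
have V : v ^+ m <= ep * (ep * q).
  rewrite -[v ^+ m]ger0_norm ?exprn_ge0// ltW//; near: m.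
  exact: HV.
have T : t ^+ m <= ep / 4.
  rewrite -[t ^+ m]ger0_norm ?exprn_ge0// ltW//; near: m.
  exact: HT.
have M : 8 / ep < m%:R by near: m; exact: nbhs_infty_gtr.
have m0 : 0 < m%:R :> R by apply: le_lt_trans M; rewrite divr_ge0// ltW.
have A : 2 * (4 / m%:R) <= ep.
  by rewrite mulrA -natrM ler_pdivrMr// mulrC -ler_pdivrMr// ltW.
have E0 : 0 < expR r ^+ m by rewrite exprn_gt0// expR_gt0.
have B : (s^-1 * expR dl) ^+ m / (ep * (N m)%:R) <= ep.
  have N0 : 0 < (N m)%:R :> R by apply: lt_le_trans (Nm m); rewrite mulr_gt0.
  rewrite ler_pdivrMr ?mulr_gt0//.
  have -> : (s^-1 * expR dl) ^+ m = v ^+ m * expR r ^+ m.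
    by rewrite -exprMn divfK// gt_eqF// expR_gt0.
  apply: (@le_trans _ _ (ep * (ep * q) * expR r ^+ m)); first by rewrite ler_wpM2r// ltW.
  by rewrite -!mulrA !ler_pM2l.
by move: A B T; clear -ep0; set a := 2 * _; set b := _ / _; set c := t ^+ m; lra.
Unshelve. all: by end_near. Qed.

Lemma truncn_ge_half (R : archiRealFieldType) (x : R) : 1 <= x -> x / 2 <= (Num.truncn x)%:R.
Proof.
move=> x1; have x0 : 0 <= x by lra.
have /andP[_] := truncn_itv x0; rewrite -natr1.
have : 1 <= (Num.truncn x)%:R :> R by rewrite ler1n truncn_gt0.
by move: (_%:R) => z; lra.
Qed.

Lemma ln_truncn_le (R : realType) (r : R) (n : nat) : (0 < n)%N -> 0 <= r ->
  ln (Num.truncn (expR r ^+ n))%:R / n%:R <= r.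
Proof.
move=> n0 r0; have nR : 0 < n%:R :> R by rewrite ltr0n.
have e1 : 1 <= expR r ^+ n by rewrite exprn_ege1// -expR0 ler_expR.
rewrite ler_pdivrMr// -[leRHS]expRK mulrC expRM_natl ler_ln ?posrE ?exprn_gt0 ?expR_gt0//.
  by rewrite truncn_le exprn_ge0 ?expR_ge0.
by rewrite ltr0n truncn_gt0.
Qed.

Lemma achievable_of_rates (R : realType) (rho1 s1 rho2 s2 mu sX s Rr Rc Pp kappa : R) :
  0 < s1 -> rho1 ^+ 2 + s1 ^+ 2 = 1 -> 0 < s2 -> rho2 ^+ 2 + s2 ^+ 2 = 1 ->
  0 <= Rr -> 0 <= Rc -> - ln s1 < Rr -> - ln s2 < Rr + Rc ->
  0 < sX -> 0 < s -> psi sX s <= Pp -> kappa < rho1 * rho2 ->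
  achievable mu sX Rr Rc Pp (sX ^+ 2 + s ^+ 2 - 2 * sX * s * kappa).
Proof.
move=> s10 rs1 s20 rs2 Rr0 Rc0 R1 R2 sX0 s0 psiP kr.
pose eta := (rho1 * rho2 - kappa) / 2.
have eta0 : 0 < eta by rewrite divr_gt0// subr_gt0.
pose B := 2 * ((2 * eta)^-1 + 2^-1).
have B0 : 0 < B.
  by apply: mulr_gt0 => //; apply: addr_gt0; rewrite invr_gt0//; apply: mulr_gt0.
(* Two covering bounds of at most 4 ep each, multiplied by B, cost 8/9 eta, strictly less than the
   eta that remains of the gap 2 eta. *)
pose ep := eta / (9 * B).
have ep0 : 0 < ep by apply: divr_gt0 => //; apply: mulr_gt0.
have Bep : B * ep = eta / 9 by rewrite /ep; field; rewrite gt_eqF.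
(* At most half the slack in either rate condition, and at most 1 for the Chernoff rate. *)
pose dl := Num.min 1 (Num.min ((Rr + ln s1) / 2) ((Rr + Rc + ln s2) / 2)).
have dl0 : 0 < dl by rewrite !lt_min ltr01/=; apply/andP; split; lra.
have dl1 : dl <= 1 by rewrite ge_min lexx.
have dlR1 : dl - ln s1 < Rr.
  have : dl <= (Rr + ln s1) / 2 by rewrite !ge_min lexx orbT.
  by lra.
have dlR2 : dl - ln s2 < Rr + Rc.
  have : dl <= (Rr + Rc + ln s2) / 2 by rewrite !ge_min lexx !orbT.
  by lra.
pose a m := Num.truncn (expR Rr ^+ m); pose b m := Num.truncn (expR Rc ^+ m).
have e1 r m : 0 <= r -> 1 <= expR r ^+ m :> R.
  by move=> r0; rewrite exprn_ege1// -expR0 ler_expR.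
have aE m : 2^-1 * expR Rr ^+ m <= (a m)%:R by rewrite mulrC truncn_ge_half// e1.
have bE m : 2^-1 * expR Rc ^+ m <= (b m)%:R by rewrite mulrC truncn_ge_half// e1.
have abE m : 4^-1 * expR (Rr + Rc) ^+ m <= (a m * b m)%:R.
  rewrite natrM expRD exprMn.
  have -> : 4^-1 * (expR Rr ^+ m * expR Rc ^+ m) =
    2^-1 * expR Rr ^+ m * (2^-1 * expR Rc ^+ m) :> R by field.
  by rewrite ler_pM// mulr_ge0 ?invr_ge0 ?exprn_ge0 ?expR_ge0.
have q1 : 0 < 2^-1 :> R by rewrite invr_gt0.
have q2 : 0 < 4^-1 :> R by rewrite invr_gt0.
have N1 := covering_bound_near0 s10 rs1 dl0 dl1 ep0 q1 dlR1 aE.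
have N2 := covering_bound_near0 s20 rs2 dl0 dl1 ep0 q2 dlR2 abE.
near \oo => n.
have n0 : (0 < n)%N by near: n; exact: nbhs_infty_gt.
have C1 : covering_bound rho1 s1 dl ep n (a n) <= 4 * ep by near: n; exact: N1.
have C2 : covering_bound rho2 s2 dl ep n (a n * b n) <= 4 * ep by near: n; exact: N2.
have [d [Om [P [X [mX Xlaw]]]]] :=
  @exists_independent_copies _ (measurableTypeR R) R (normal_prob 0 1) n.
apply: (@achievable_random_code _ _ _ P n X n0 mX Xlaw rho1 s1 rho2 s2 dl ep eta mu sX s _ _ _ _
  (a n) (b n)) => //.
- by lra.
- by rewrite truncn_gt0 e1.
- by rewrite truncn_gt0 e1.
- exact: ln_truncn_le.
- exact: ln_truncn_le.
rewrite -/B; have : B * (covering_bound rho1 s1 dl ep n (a n) +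
    covering_bound rho2 s2 dl ep n (a n * b n)) <= B * (4 * ep + 4 * ep).
  by rewrite ler_pM2l// lerD.
have -> : B * (4 * ep + 4 * ep) = 8 / 9 * eta.
  by rewrite -mulrDl mulrCA Bep; field.
have -> : kappa = rho1 * rho2 - 2 * eta by rewrite /eta; field.
set w := B * _; set z := rho1 * rho2; move: w z eta0 => w z; move: (eta) => h.
by clear; lra.
Unshelve. all: by end_near. Qed.

(* Encoding nothing and drawing the reconstruction independently of the source. *)
Lemma achievable_independent (R : realType) (mu sX s Rr Rc Pp : R) :
  0 <= Rr -> 0 <= Rc -> 0 < sX -> 0 < s -> psi sX s <= Pp ->
  achievable mu sX Rr Rc Pp (sX ^+ 2 + s ^+ 2).
Proof.
move=> Rr0 Rc0 sX0 s0 psiP.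
have [d [Om [P [X [mX Xlaw]]]]] :=
  @exists_independent_copies _ (measurableTypeR R) R (normal_prob 0 1) 1.
rewrite -[sX ^+ 2 + s ^+ 2]subr0 -[X in _ - X](mulr0 (2 * sX * s)).
apply: (@code_achievable _ _ _ P 1 1 1 (fun _ _ => 1) (fun _ _ => 1) X) => //.
- by move=> k _; rewrite big_ord1.
- by move=> _; rewrite (big_pred1 (ord0, ord0)) => [//|[i j]]; rewrite !ord1.
- by move=> _; rewrite mean_cst invr1.
- by move=> _; rewrite mean_cst mulr1 invr1.
- by rewrite ln1 mul0r.
- by rewrite ln1 mul0r.
- rewrite invr1 mul1r; apply: sumr_ge0 => t _; apply: sumr_ge0 => i _.
  by rewrite mul1r -expr2 sqr_ge0.
Qed.

(** The factor 1 - g pushes rho^2 strictly below 1 - exp(-2r), so s^2 > exp(-2r). Its square root is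
    kept apart so that the product of two such correlations is (1 - g) times [xi]. *)
Lemma exists_correlation (R : realType) (g r : R) : 0 < g -> g < 1 -> 0 < r ->
  exists s, [/\ 0 < s,
    (Num.sqrt (1 - g) * Num.sqrt (1 - expR (- (2 * r)))) ^+ 2 + s ^+ 2 = 1 & - ln s < r].
Proof.
move=> g0 g1 r0; set e := expR (- (2 * r)).
have e0 : 0 < e by exact: expR_gt0.
have e1 : e < 1 by rewrite /e -[ltRHS]expR0 ltr_expR; lra.
pose v := 1 - (1 - g) * (1 - e).
have ve : e < v by rewrite /v; nra.
have v0 : 0 < v by exact: lt_trans ve.
exists (Num.sqrt v); split.
- by rewrite sqrtr_gt0.
- have gE : Num.sqrt (1 - g) ^+ 2 = 1 - g by rewrite sqr_sqrtr//; lra.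
  have eE : Num.sqrt (1 - e) ^+ 2 = 1 - e by rewrite sqr_sqrtr//; lra.
  have vE : Num.sqrt v ^+ 2 = v by rewrite sqr_sqrtr// ltW.
  by rewrite exprMn gE eE vE /v; ring.
- rewrite ltrNl -(ltr_expR) lnK ?posrE ?sqrtr_gt0//.
  rewrite -(ltr_pXn2r (ltn0Sn 1)) ?nnegrE ?expR_ge0 ?sqrtr_ge0// sqr_sqrtr ?(ltW v0)//.
  by rewrite -expRM_natl mulrN.
Qed.

Lemma xi_ge0_le1 (R : realType) (Rr Rc : R) : 0 <= Rr -> 0 <= Rc -> 0 <= xi Rr Rc <= 1.
Proof.
move=> Rr0 Rc0; rewrite sqrtr_ge0/= -[leRHS]sqrtr1 ler_sqrt// mulr_ile1 ?gerBl ?expR_ge0//.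
- by rewrite subr_ge0 -[leRHS]expR0 ler_expR; lra.
- by rewrite subr_ge0 -[leRHS]expR0 ler_expR; lra.
Qed.

Lemma RDP_le_Dupper (R : realType) (mu sX Rr Rc P : R) :
  0 < sX -> 0 <= Rr -> 0 <= Rc -> 0 <= P ->
  (RDP mu sX Rr Rc P <= (Dupper sX Rr Rc P)%:E)%E.
Proof.
move=> sX0 Rr0 Rc0 P0.
have [/andP[g0 gX] gP] := sigmaP_spec sX0 P0.
have /andP[x0 x1] := xi_ge0_le1 Rr0 Rc0.
(* The minimiser of sX^2 + s^2 - 2 sX s xi over [sigma(P), sX]; it unites the two cases of
   [Dupper]. *)
pose s := Num.max (sigmaP sX P) (sX * xi Rr Rc).
have s0 : 0 < s by rewrite lt_max g0.
have sX1 : s <= sX by rewrite ge_max gX ler_piMr// ltW.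
have psiP : psi sX s <= P by apply: sigmaP_le_psi => //; rewrite le_max lexx.
have -> : Dupper sX Rr Rc P = sX ^+ 2 + s ^+ 2 - 2 * sX * s * xi Rr Rc.
  rewrite /Dupper /s; case: (leP (sigmaP sX P) (sX * xi Rr Rc)) => [_|//].
  by ring.
(* At rate 0 the strict condition - ln s1 < Rr fails for every s1 <= 1; but then xi = 0 and an
   independent reconstruction attains the bound. *)
have [R0|Rn0] := eqVneq Rr 0.
  have -> : xi Rr Rc = 0 by rewrite /xi R0 mulr0 oppr0 expR0 subrr mul0r sqrtr0.
  rewrite mulr0 subr0; apply: ereal_inf_lbound; exists (sX ^+ 2 + s ^+ 2) => //.
  exact: achievable_independent.
have Rp : 0 < Rr by rewrite lt_def Rn0.
apply/lee_addgt0Pr => e e0.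
(* The loss of correlation that costs exactly e in distortion. *)
pose c := e / (2 * sX * s).
have c0 : 0 < c by rewrite divr_gt0// !mulr_gt0.
(* Since xi <= 1, g <= c/2 ensures (1 - g) xi > xi - c; the bound 1/2 keeps g below 1. *)
pose g := Num.min 2^-1 (c / 2).
have gg0 : 0 < g by rewrite lt_min invr_gt0 ltr0n/=; lra.
have g1 : g < 1 by apply: (@le_lt_trans _ _ 2^-1); [rewrite ge_min lexx|lra].
have gc : g <= c / 2 by rewrite ge_min lexx orbT.
have [s1 [s10 rs1 R1]] := exists_correlation gg0 g1 Rp.
have [s2 [s20 rs2 R2]] := exists_correlation gg0 g1 (ltr_wpDr Rc0 Rp).
rewrite -EFinD; have -> : sX ^+ 2 + s ^+ 2 - 2 * sX * s * xi Rr Rc + e =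
    sX ^+ 2 + s ^+ 2 - 2 * sX * s * (xi Rr Rc - c).
  by rewrite /c; field; rewrite !gt_eqF.
apply: ereal_inf_lbound; exists (sX ^+ 2 + s ^+ 2 - 2 * sX * s * (xi Rr Rc - c)) => //.
apply: (achievable_of_rates _ s10 rs1 s20 rs2) => //.
have E : xi Rr Rc = Num.sqrt (1 - expR (- (2 * Rr))) * Num.sqrt (1 - expR (- (2 * (Rr + Rc)))).
  by rewrite /xi sqrtrM// subr_ge0 -[leRHS]expR0 ler_expR; lra.
rewrite mulrACA -expr2 sqr_sqrtr -?E; last by lra.
by nra.
Qed.

Unset Implicit Arguments.

Theorem theorem3 (R : realType) (mu sX Rr Rc P : R) :
  0 < sX -> 0 <= Rr -> 0 <= Rc -> 0 <= P ->
  (Dlower sX Rr Rc P <= RDP mu sX Rr Rc P <= (Dupper sX Rr Rc P)%:E)%E.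
Proof.
move=> sX0 Rr0 Rc0 P0; apply/andP; split.
  exact: Dlower_le_RDP.
exact: RDP_le_Dupper.
Qed.
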